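(* Let $n\ge 2$, and let $D_i\ge 0$ and $A_{ij}\ge 0$ ($1\le i,j\le n$) be constants such that (i) $A_{ii}>0$ for all $i$; (ii) there are constants $\pi_i>0$ with $\pi_iA_{ij}=\pi_jA_{ji}$ for all $1\le i,j\le n$. Let $u_i^0:\mathbb{T}\to(0,\infty)$, $1\le i\le n$, be continuous and (strictly) positive functions. Then for every $M\in\mathbb{N}$, $M\ge1$, with $h:=1/M$ and $x_k:=kh$, there exists a unique global (i.e. defined for all $t\ge 0$) solution $(u_i(t,x_k))_{1\le i\le n,\,0\le k\le M-1}$, of class $C^\infty$ and with $u_i(t,x_k)>0$, to the discrete system $$\partial_t u_i(t,x_k)=D_i[\Delta_h u_i(t,\cdot)](x_k)+\Big[\Delta_h\Big(u_i(t,\cdot)\sum_{j=1}^nA_{ij}u_j(t,\cdot)\Big)\Big](x_k),\qquad u_i(0,x_k)=u_i^0(x_k),$$ for $k=0,\dots,M-1$, $i=1,\dots,n$, with periodic convention $u_i(t,x_M)=u_i(t,x_0)$, $u_i(t,x_{-1})=u_i(t,x_{M-1})$. Moreover, let $[\tilde u_i]^M(t,\cdot)$ denote the periodic piecewise linear interpolant of $(u_i(t,x_k))_{k}$. Then there exist a subsequence of $M\to\infty$ and functions $u_i$, $1\le i\le n$, such that, along this subsequence, $[\tilde u_i]^M\to u_i$ in $L^{4-\varepsilon}([0,T]\times\mathbb{T})$ for all $T>0$ and all $\varepsilon\in(0,3]$, where $u_i\in L^4([0,T]\times\mathbb{T})\cap L^2([0,T],H^1(\mathbb{T}))$ for all $T>0$,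 and $(u_1,\dots,u_n)$ is a weak solution of $\partial_tu_i=\Delta(D_iu_i+\sum_{j=1}^nA_{ij}u_iu_j)$ on $\mathbb{T}$ with initial data $u_i^0$, in the following sense: for all $\varphi\in C_c^2([0,\infty)\times\mathbb{T})$ and all $i=1,\dots,n$, $$-\int_{\mathbb{T}}u_i^0(x)\varphi(0,x)\,dx-\int_0^\infty\int_{\mathbb{T}}u_i(t,x)\,\partial_t\varphi(t,x)\,dx\,dt=\int_0^\infty\int_{\mathbb{T}}\Big[D_iu_i(t,x)+\sum_{j=1}^nA_{ij}u_i(t,x)u_j(t,x)\Big]\Delta\varphi(t,x)\,dx\,dt.$$
   Context: $\mathbb{T}=[0,1)$ is the one-dimensional torus (periodic boundary conditions), so $\Delta=\partial_x^2$. For $h=1/M$ and a function $f$ on the periodic grid $\{x_k=kh: k=0,\dots,M-1\}$, the discrete Laplacian is $(\Delta_hf)(x)=\dfrac{f(x+h)+f(x-h)-2f(x)}{h^2}$. Given values $(w(x_k))_{k=0,\dots,M-1}$, the linear interpolant $\tilde w:\mathbb{T}\to\mathbb{R}$ is, for $x\in[0,1)$, $\tilde w(x)=\sum_{k=0}^{M-1}w(x_k)\Lambda_h(x-x_k)+w(x_0)\Lambda_h(x-x_M)$ with $\Lambda_h(x)=(1-|x|/h)\mathbf{1}_{\{|x|\le h\}}$ and $x_M=1$; i.e. $\tilde w$ is affine on each $[x_k,x_{k+1}]$, equals $w(x_k)$ at $x_k$, with $w(x_M):=w(x_0)$. For time-dependent values the interpolation is done in $x$ for each fixed $t$. *)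

(* Defs.v *)
From HB Require Import structures.
From mathcomp Require Import all_boot all_order all_algebra.
From mathcomp Require Import all_classical all_reals all_analysis.

Set Implicit Arguments.
Unset Strict Implicit.
Unset Printing Implicit Defensive.
Import Order.TTheory GRing.Theory Num.Theory.
Import numFieldNormedType.Exports.

Local Open Scope classical_set_scope.
Local Open Scope ring_scope.

(* A continuous or differentiable function on the torus is a 1-periodic
   function on R; a function defined up to null sets, or only used under
   integrals, is a function on R of which only the values on [0, 1[ matter. *)

Section OneSidedCalculus.
Variable R : realType.
Implicit Types (f : R -> R) (phi : R -> R -> R) (t l : R).

Definition halfline : set R := [set t | 0 <= t].

(* Difference quotients over [0, +oo[: for t > 0 their limit is the ordinary
   derivative at t, for t = 0 it is the right derivative. *)
Definition has_tderiv f t l : Prop :=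
  (f s - f t) / (s - t) @[s --> within halfline t^'] --> l.

Definition tderivable f t : Prop := exists l, has_tderiv f t l.

Definition tderiv f t : R :=
  lim ((f s - f t) / (s - t) @[s --> within halfline t^']).

Definition tsmooth f : Prop :=
  forall (m : nat) t, halfline t -> tderivable (iter m tderiv f) t.

Definition dt phi : R -> R -> R := fun t x => tderiv (phi^~ x) t.
Definition dx phi : R -> R -> R := fun t x => (phi t)^`()%classic x.

Fixpoint Ck (k : nat) phi : Prop :=
  {within [set z : R * R | halfline z.1],
    continuous (fun z : R * R => phi z.1 z.2)} /\
  match k with
  | 0%N => True
  | j.+1 =>
      (forall t x, halfline t ->
         tderivable (phi^~ x) t /\ derivable (phi t) x 1) /\
      Ck j (dt phi) /\ Ck j (dx phi)
  end.

(* The torus being compact, only the support in time is constrained; phi need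
   not vanish at t = 0. *)
Definition Cc2 phi : Prop :=
  [/\ Ck 2 phi,
      forall t, halfline t -> periodic (phi t) 1
    & exists T : R, forall t x, T <= t -> phi t x = 0].

End OneSidedCalculus.

Arguments halfline {R}.

(* Grids have M = m.+1 >= 1 points x_k = k * mesh m, k : 'I_m.+1; ordS and
   ord_pred are the cyclic successor and predecessor, which gives the periodic
   convention. *)
Section DiscreteSystem.
Variable R : realType.

Definition mesh (m : nat) : R := m.+1%:R^-1.

Definition dlaplacian (m : nat) (w : 'I_m.+1 -> R) (k : 'I_m.+1) : R :=
  (w (ordS k) + w (ord_pred k) - 2 * w k) / mesh m ^+ 2.

Definition discrete_solution (n m : nat) (D : 'I_n -> R) (A : 'I_n -> 'I_n -> R)
    (u0 : 'I_n -> R -> R) (u : 'I_n -> R -> 'I_m.+1 -> R) : Prop :=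
  (forall i k, u i 0 k = u0 i (k%:R * mesh m)) /\
  (forall i t k, halfline t ->
     has_tderiv (fun s => u i s k) t
       (D i * dlaplacian (u i t) k +
        dlaplacian (fun l => u i t l * \sum_(j < n) A i j * u j t l) k)).

Definition hat (h x : R) : R := (1 - `|x| / h) * (`|x| <= h)%R%:R.

Definition interpolant (m : nat) (w : 'I_m.+1 -> R) (x : R) : R :=
  \sum_(k < m.+1) w k * hat (mesh m) (x - k%:R * mesh m)
  + w ord0 * hat (mesh m) (x - 1).

End DiscreteSystem.

Section FunctionSpaces.
Variable R : realType.

Let mu : {measure set (measurableTypeR R) -> \bar R} := @lebesgue_measure R.

Definition leb2 :
    {measure set (measurableTypeR R * measurableTypeR R) -> \bar R} :=
  (@lebesgue_measure R \x @lebesgue_measure R)%E.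

Definition torus : set (measurableTypeR R) := [set` `[0%R, 1%R[].

Definition cylinder (T : R) : set (measurableTypeR R * measurableTypeR R) :=
  [set` `[0%R, T]] `*` torus.

Definition uncurried (u : R -> R -> R) :
    measurableTypeR R * measurableTypeR R -> R := fun z => u z.1 z.2.

Definition Lp_torus (p : R) (v : R -> R) : Prop :=
  ((v : measurableTypeR R -> R) \_ torus) \in Lfun mu p%:E.

Definition Lp_cylinder (p T : R) (u : R -> R -> R) : Prop :=
  (uncurried u \_ (cylinder T)) \in Lfun leb2 p%:E.

Definition cvg_Lp_cylinder (p T : R) (f : nat -> R -> R -> R)
    (u : R -> R -> R) : Prop :=
  let err N := uncurried (fun t x => f N t x - u t x) \_ (cylinder T) in
  ('N[leb2]_p%:E [EFin \o err N])%E @[N --> \oo] --> 0%E.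

Definition test_torus (psi : R -> R) : Prop :=
  periodic psi 1 /\ forall (m : nat) x, derivable (psi^`(m)%classic) x 1.

Definition weak_derivative (v g : R -> R) : Prop :=
  forall psi, test_torus psi ->
    \int[mu]_(x in torus) (v x * psi^`()%classic x) =
    - (\int[mu]_(x in torus) (g x * psi x)).

(* v belongs to H^1 of the torus, with v' = g *)
Definition H1_torus (v g : R -> R) : Prop :=
  [/\ Lp_torus 2 v, Lp_torus 2 g & weak_derivative v g].

(* L^2([0, T], H^1): elements of the Bochner space are identified with jointly
   measurable functions, and by Tonelli the integral over [0, T] of the squared
   H^1 norm of u t is the sum of the integrals of u ^ 2 and g ^ 2 over the
   cylinder. *)
Definition L2H1 (T : R) (u : R -> R -> R) : Prop :=
  exists g : R -> R -> R,
    [/\ Lp_cylinder 2 T u, Lp_cylinder 2 T g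
      & {ae mu, forall t, [set` `[0%R, T]] t -> H1_torus (u t) (g t)}].

Definition weak_solution (n : nat) (D : 'I_n -> R) (A : 'I_n -> 'I_n -> R)
    (u0 : 'I_n -> R -> R) (u : 'I_n -> R -> R -> R) : Prop :=
  forall (phi : R -> R -> R) (i : 'I_n), Cc2 phi ->
    - (\int[mu]_(x in torus) (u0 i x * phi 0 x))
    - (\int[mu]_(t in halfline)
         (\int[mu]_(x in torus) (u i t x * dt phi t x))) =
    \int[mu]_(t in halfline)
      (\int[mu]_(x in torus)
         ((D i * u i t x + \sum_(j < n) A i j * u i t x * u j t x)
          * dx (dx phi) t x)).

End FunctionSpaces.

(* Main.v *)
Require Import Defs.
From HB Require Import structures.
From mathcomp Require Import all_boot all_order all_algebra.
From mathcomp Require Import all_classical all_reals all_analysis measurable_realfun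
measurable_fun_approximation.
From mathcomp Require Import ring lra.

Set Implicit Arguments.
Unset Strict Implicit.
Unset Printing Implicit Defensive.
Import Order.TTheory GRing.Theory Num.Theory.
Import numFieldNormedType.Exports.

Local Open Scope classical_set_scope.
Local Open Scope ring_scope.


(** The scheme preserves, uniformly in the mesh, the two structures of the equation: conservation of
    mass, and decay of the entropy [\sum_i pi_i \int (u_i ln u_i - u_i + 1)].

    On one grid the problem is a finite system of ordinary differential equations. Clamping the
    unknowns to [[0, B]] makes it globally Lipschitz and Picard iteration solves it
    ([lipschitz_ode]). A differential inequality keeps the solution positive ([tderiv_gt0]) and
    conserved sums keep it below [B], so the clamp never acts ([discrete_solution_exists]). The
    derivative of a polynomial in the solution is again such a polynomial, whence smoothness; a
    Gronwall argument gives uniqueness.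

    Uniform estimates come from detailed balance, which symmetrises the entropy production; the
    diagonal terms, with [A i i > 0], dominate squared gradients ([entropy_production]). Hence the
    height [H], one plus the squared discrete H^1 seminorms, has a primitive [P] with
    [P t <= t + E], where [E] does not depend on the grid ([height_primitive]). Together with the
    mass, [H] bounds the cube of the supremum ([cube_sup_le]), which gives an L^4 bound and a bound
    on the gradient of the flux ([grad2_flux_le]). Testing the equation with the increment
    [u t - u s] and interpolating ([agmon]) gives a pointwise modulus of continuity in time
    ([time_modulus]). These facts are bundled in [controlled].

    For compactness, time is cut into short slabs, in each of which some time has a height equal to
    the average. The interpolant is then L^1-close to finitely many sampled values, all bounded.
    Along an ultrafilter the samples converge, so the interpolants are L^1-Cauchy ([ultra_cauchy]);
    a diagonal subsequence converges in L^1 and almost everywhere. Fatou transfers the L^4 bound,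
    and interpolation between L^1 and L^4 gives convergence in L^p for [p < 4]. Midpoint averages of
    the slopes with nearly minimal L^2 norm converge to the weak gradient of the limit ([mazur]).

    Finally, summation by parts gives an exact discrete weak identity ([discrete_identity]). Its
    integrand differs from the weak integrand of the interpolants by at most [error_rate * H] with
    [error_rate] tending to 0 ([weak_error_pointwise]), and the quadratic integrand passes to the
    limit by L^1 convergence and L^4 bounds ([integrand_integral_dist], [weak_limit]). *)

(** * One-sided derivatives and comparison on the half-line *)

Section OneSided.
Variable R : realType.
Implicit Types (f g : R -> R) (t l e : R).

Lemma has_tderivP f t l : has_tderiv f t l <->
  forall e, 0 < e -> exists2 d, 0 < d & forall s, 0 <= s -> s != t ->
    `|s - t| < d -> `|(f s - f t) / (s - t) - l| < e.
Proof.
rewrite /has_tderiv; split=> [/cvgrPdist_lt H e e0|H].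
  have := H e e0; rewrite near_withinE /dnbhs near_withinE.
  move=> /nbhs_ballP[d /= d0 dP]; exists d => // s s0 st sd.
  by rewrite distrC; apply: dP => //=; rewrite /ball /= distrC.
apply/cvgrPdist_lt => e e0; have [d d0 dP] := H e e0.
rewrite near_withinE /dnbhs near_withinE.
apply/nbhs_ballP; exists d => //= s /= sd st s0.
by rewrite distrC; apply: dP => //; rewrite distrC.
Qed.

Lemma is_deriveP f t l : is_derive t 1 f l <->
  forall e, 0 < e -> exists2 d, 0 < d & forall s, s != t ->
    `|s - t| < d -> `|(f s - f t) / (s - t) - l| < e.
Proof.
have cvgP : (h^-1 *: (f (h *: 1 + t) - f t) @[h --> 0^'] --> l) <->
    forall e, 0 < e -> exists2 d, 0 < d & forall s, s != t ->
    `|s - t| < d -> `|(f s - f t) / (s - t) - l| < e.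
  split=> [/cvgrPdist_lt H e e0|H].
    have := H e e0; rewrite /dnbhs near_withinE.
    move=> /nbhs_ballP[d /= d0 dP]; exists d => // s st sd.
    have := dP (s - t); rewrite /= /ball /= sub0r normrN subr_eq0 => /(_ sd st).
    by rewrite distrC [_ *: 1]mulr1 subrK /= [_ *: _]mulrC.
  apply/cvgrPdist_lt => e e0; have [d d0 dP] := H e e0.
  rewrite /dnbhs near_withinE.
  apply/nbhs_ballP; exists d => //= h; rewrite /ball /= sub0r normrN => hd h0.
  have := dP (h + t); rewrite addrK distrC [_ *: 1]mulr1 [_ *: _]mulrC; apply=> //.
  by rewrite -subr_eq0 addrK.
rewrite -cvgP; split=> [[df <-]|H]; first exact: df.
have df : derivable f t 1 by apply/cvg_ex; exists l.
by apply: DeriveDef => //; apply: cvg_lim H.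
Qed.

Lemma is_derive_has_tderiv f t l : is_derive t 1 f l -> has_tderiv f t l.
Proof.
move=> /is_deriveP H; apply/has_tderivP => e /H[d d0 dP].
by exists d => // s _; exact: dP.
Qed.

Lemma has_tderiv_is_derive f t l : 0 < t -> has_tderiv f t l -> is_derive t 1 f l.
Proof.
move=> t0 /has_tderivP H; apply/is_deriveP => e /H[d d0 dP].
exists (Num.min d t); first by rewrite lt_min d0.
move=> s st; rewrite lt_min => /andP[sd /ltr_distlCDr]; rewrite ltrDr => s0.
by apply: dP => //; exact: ltW.
Qed.

Lemma eq_has_tderiv f g t l : {in halfline, f =1 g} -> 0 <= t ->
  has_tderiv f t l -> has_tderiv g t l.
Proof.
move=> fg t0 /has_tderivP H; apply/has_tderivP => e /H[d d0 dP].
by exists d => // s s0 st sd; rewrite -!fg ?inE//; exact: dP.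
Qed.

Lemma halfline_dnbhs_proper t : 0 <= t -> ProperFilter (within halfline t^').
Proof.
move=> t0; apply: Build_ProperFilter; rewrite /within /= /dnbhs => /nbhs_ballP.
move=> [d /= d0 dP]; apply: (dP (t + d / 2)).
- rewrite /ball /= opprD addNKr normrN gtr0_norm ?divr_gt0//.
  by rewrite ltr_pdivrMr// ltr_pMr// ltr1n.
- by rewrite -subr_eq0 addrC addKr gt_eqF// divr_gt0.
- by rewrite /halfline /= addr_ge0// divr_ge0// ltW.
Qed.

Lemma tderivE f t l : 0 <= t -> has_tderiv f t l -> tderiv f t = l.
Proof.
by move=> t0; have := halfline_dnbhs_proper t0 => P /cvg_lim; apply.
Qed.

Lemma tderivable_tderiv f t : 0 <= t -> tderivable f t -> has_tderiv f t (tderiv f t).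
Proof. by move=> t0 [l fl]; rewrite (tderivE t0 fl). Qed.

Lemma dist_max0 s t : `|Num.max 0 s - Num.max 0 t| <= `|s - t| :> R.
Proof.
by rewrite ler_distl; apply/andP; split; case: (leP 0 s) => ?; case: (leP 0 t) => ?;
  have := ler_norm (s - t); have := ler_norm (t - s); rewrite (distrC t s); lra.
Qed.

Lemma max0_continuous : continuous (fun s : R => Num.max 0 s).
Proof.
move=> t; apply/cvgrPdist_lt => e e0; apply/nbhs_ballP; exists e => // s /=.
by apply: le_lt_trans; exact: dist_max0.
Qed.

(** Near [Num.max 0 t] the difference quotients are bounded by [|l| + 1], and truncation at [0] does
    not increase distances. One-sided data thus become a function continuous on the whole line, as
    the mean value theorem and integration require. *)
Lemma has_tderiv_max_continuous f :
  (forall t, 0 <= t -> tderivable f t) ->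
  continuous (fun t => f (Num.max 0 t)).
Proof.
move=> fd t; set T := Num.max 0 t; have T0 : 0 <= T by rewrite le_max lexx.
have [l /has_tderivP/(_ 1 ltr01)[d d0 dP]] := fd _ T0.
apply/cvgrPdist_lt => e e0; apply/nbhs_ballP.
have K0 : 0 < `|l| + 1 by rewrite ltr_wpDl.
exists (Num.min d (e / (`|l| + 1))); first by rewrite /= lt_min d0 divr_gt0.
move=> s; rewrite /ball/= lt_min => /andP[sd se].
have sT : `|Num.max 0 s - T| <= `|t - s| by rewrite distrC dist_max0.
have [->|nE] := eqVneq (Num.max 0 s) T; first by rewrite subrr normr0.
have s0 : 0 <= Num.max 0 s by rewrite le_max lexx.
have := dP _ s0 nE (le_lt_trans sT sd).
set q := _ / _ => ql.
have -> : f T - f (Num.max 0 s) = - (q * (Num.max 0 s - T)).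
  by rewrite /q divfK ?subr_eq0// opprB.
rewrite normrN normrM; apply: (@le_lt_trans _ _ ((`|l| + 1) * `|t - s|)).
  apply: ler_pM => //; rewrite -[q](subrK l) (le_trans (ler_normD _ _))//.
  by rewrite addrC lerD2l ltW.
by rewrite mulrC -ltr_pdivlMr.
Qed.

(* [max 0] freezes a function at its value at [0] for negative times, turning
   one-sided regularity into regularity on the whole line. *)
Lemma has_tderiv_max_is_derive f t l : 0 < t -> has_tderiv f t l ->
  is_derive t 1 (fun s => f (Num.max 0 s)) l.
Proof.
move=> t0 H; apply: has_tderiv_is_derive => //.
by apply: eq_has_tderiv H; [move=> s; rewrite inE => s0; rewrite max_r | exact: ltW].
Qed.

Lemma antiderivative g : continuous g ->
  exists Y : R -> R, Y 0 = 0 /\ forall t, 0 <= t -> is_derive t 1 Y (g t).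
Proof.
move=> gc; set mu := @lebesgue_measure R.
(* The integral starts at [-1], not at [0], so that each [t >= 0] is interior to the interval and
   the derivative at [0] is two-sided; subtracting [Y0 0] restores the initial value. *)
pose Y0 x : R := \int[mu]_(t in [set` `[-1, x]]) (g t).
exists (fun x => Y0 x - Y0 0); split; first by rewrite subrr.
move=> t t0.
have /= := @continuous_FTC1_closed R g (-1) t (t + 1).
rewrite ltrDl ltr01 => /(_ isT).
have int : mu.-integrable `[-1, t + 1] (EFin \o g).
  apply: continuous_compact_integrable; first exact: segment_compact.
  exact: continuous_subspaceT.
move=> /(_ int); rewrite (lt_le_trans _ t0) ?ltrN10// => /(_ isT (gc t))[d1 d2].
rewrite -[g t]subr0; apply: (@is_deriveB _ _ _ Y0 (cst (Y0 0))).
by rewrite -d2 derive1E; exact: derivableP.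
Qed.

(** The mean value theorem for [g - f]. Derivatives are required only inside the interval, so the
    comparison applies to functions frozen for negative times, which may have a corner at [0]. *)
Lemma derive_le_le_from f g (df dg : R -> R) a T : f a <= g a -> a <= T ->
  continuous f -> continuous g ->
  (forall t, a < t -> t < T -> is_derive t 1 f (df t)) ->
  (forall t, a < t -> t < T -> is_derive t 1 g (dg t)) ->
  (forall t, a < t -> t < T -> df t <= dg t) -> f T <= g T.
Proof.
move=> fga; rewrite le_eqVlt => /predU1P[<-//|T0] fc gc fd gd fg.
have [|||c] := @MVT R (g - f) (fun t => dg t - df t) a T.
- exact: T0.
- move=> x; rewrite in_itv/= => /andP[x0 xT].
  by apply: is_deriveB; [exact: gd|exact: fd].
- by apply: continuous_subspaceT => x; apply: cvgB; [exact: gc|exact: fc].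
rewrite in_itv/= => /andP[c0 cT] H.
have {}H : (g T - f T) - (g a - f a) = (dg c - df c) * (T - a) := H.
have : 0 <= (dg c - df c) * (T - a) by rewrite mulr_ge0 ?subr_ge0 ?fg// ltW.
by rewrite -H; lra.
Qed.

Lemma derive_le_le f g (df dg : R -> R) T : f 0 <= g 0 -> 0 <= T ->
  continuous f -> continuous g ->
  (forall t, 0 < t -> t < T -> is_derive t 1 f (df t)) ->
  (forall t, 0 < t -> t < T -> is_derive t 1 g (dg t)) ->
  (forall t, 0 < t -> t < T -> df t <= dg t) -> f T <= g T.
Proof. exact: derive_le_le_from. Qed.

Lemma tderiv_le_from f g (df dg : R -> R) a T : 0 <= a -> f a <= g a -> a <= T ->
  continuous f -> continuous g ->
  (forall t, a < t -> t < T -> has_tderiv f t (df t)) ->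
  (forall t, a < t -> t < T -> has_tderiv g t (dg t)) ->
  (forall t, a < t -> t < T -> df t <= dg t) -> f T <= g T.
Proof.
move=> a0 fga aT fc gc fd gd; apply: (derive_le_le_from fga aT fc gc) => t ta tT.
  by apply: has_tderiv_is_derive; [exact: le_lt_trans ta | exact: fd].
by apply: has_tderiv_is_derive; [exact: le_lt_trans ta | exact: gd].
Qed.

End OneSided.

(** * Picard iteration for globally Lipschitz systems *)

Section LipschitzODE.
Variables (R : realType) (I : finType) (F : (I -> R) -> I -> R) (L : R).
Hypothesis L0 : 0 < L.
Hypothesis F_lip : forall x y i, `|F x i - F y i| <= L * \sum_j `|x j - y j|.

(** Growth rate of the weight [expR (K * t)] against which distances of paths are measured: at least
    twice the Lipschitz constant [L * #|I|] of [F] in the sup norm, so that a Picard step halves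
    distances. The successor keeps [K] positive when [I] is empty. *)
Let K : R := 2 * L * #|I|.+1%:R.

Lemma lipschitz_continuous (X : R -> I -> R) i :
  (forall j, continuous (X^~ j)) -> continuous (fun t => F (X t) i).
Proof.
move=> Xc t; apply/cvgrPdist_lt => e e0.
have e'0 : 0 < e / (L * #|I|.+1%:R) by rewrite divr_gt0// mulr_gt0.
have H j : \forall s \near t, `|X t j - X s j| < e / (L * #|I|.+1%:R).
  by have /cvgrPdist_lt := Xc j t; apply.
have {}H : \forall s \near t, forall j, `|X t j - X s j| < e / (L * #|I|.+1%:R).
  exact: (@filter_forall _ _ (fun j s => `|X t j - X s j| < e / (L * #|I|.+1%:R)) _ (nbhs_filter t) H).
near=> s; have sP j : `|X t j - X s j| < e / (L * #|I|.+1%:R).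
  by move: j; near: s.
apply: le_lt_trans (F_lip _ _ _) _.
apply: (@le_lt_trans _ _ (L * (#|I|%:R * (e / (L * #|I|.+1%:R))))).
  rewrite ler_pM2l// (le_trans (ler_sum _ (fun j _ => ltW (sP j))))//.
  by rewrite sumr_const mulr_natl.
have -> : L * (#|I|%:R * (e / (L * #|I|.+1%:R))) = e * (#|I|%:R / #|I|.+1%:R).
  by field; rewrite nat1r pnatr_eq0/= gt_eqF.
by rewrite gtr_pMr// ltr_pdivrMr// mul1r ltr_nat.
Unshelve. all: by end_near. Qed.

(** The next Picard iterate: integrate [F (X t)] from [0] and freeze the result at [x0] for negative
    times, which keeps it continuous on the whole line and ready for another step. *)
Lemma picard_step (x0 : I -> R) (X : R -> I -> R) :
  (forall i, continuous (X^~ i)) ->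
  exists Y : R -> I -> R, [/\ forall i, continuous (Y^~ i),
    forall (t : R) i, t <= 0 -> Y t i = x0 i &
    forall (t : R) i, 0 <= t -> has_tderiv (Y^~ i) t (F (X t) i)].
Proof.
move=> Xc.
have /choice[Y YP] : forall i, exists Y : R -> R, Y 0 = x0 i /\
    forall t : R, 0 <= t -> is_derive t 1 Y (F (X t) i).
  move=> i; have [Y [Y0 Yd]] := antiderivative (lipschitz_continuous (i := i) Xc).
  exists (fun t : R => Y t + x0 i); split; first by rewrite Y0 add0r.
  move=> t t0; rewrite -[F _ _]addr0.
  by apply: (@is_deriveD _ _ _ Y (cst (x0 i))); exact: Yd.
exists (fun t i => Y i (Num.max 0 t)); split.
- move=> i; apply: has_tderiv_max_continuous => t t0.
  by exists (F (X t) i); apply: is_derive_has_tderiv; exact: (YP i).2.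
- by move=> t i t0; rewrite max_l// (YP i).1.
- move=> t i t0; apply: (@eq_has_tderiv _ (Y i)) => //.
    by move=> s; rewrite inE => s0; rewrite max_r.
  by apply: is_derive_has_tderiv; exact: (YP i).2.
Qed.

Let K0 : 0 < K. Proof. by rewrite !mulr_gt0. Qed.

Lemma is_derive_expM (c k t : R) :
  is_derive t 1 (fun t : R => c * expR (k * t)) (c * (k * expR (k * t))).
Proof.
have e1 : is_derive t 1 (fun t : R => k * t) (k *: (1 : R)).
  exact: (@is_deriveZ _ _ _ id).
have e2 := @is_derive1_comp _ expR (fun t : R => k * t) t _ _ (is_derive_expR _) e1.
have := @is_deriveZ _ _ _ _ c t 1 _ e2.
by rewrite /GRing.scale /= mulr1 [expR _ * _]mulrC.
Qed.

Lemma expM_continuous (c k : R) : continuous (fun t : R => c * expR (k * t)).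
Proof.
move=> t; apply: differentiable_continuous; apply/derivable1_diffP.
by have [] := is_derive_expM c k t.
Qed.

(** The derivatives of [Y] and [Y'] differ by at most [L * #|I| * c * expR (K * t)], which is below
    the derivative of [c / 2 * expR (K * t)]; comparison of derivatives in both directions
    concludes. *)
Lemma picard_contract (x0 : I -> R) (X X' Y Y' : R -> I -> R) (c : R) :
  (forall t i, `|X t i - X' t i| <= c * expR (K * t)) ->
  (forall i, continuous (Y^~ i)) -> (forall (t : R) i, t <= 0 -> Y t i = x0 i) ->
  (forall (t : R) i, 0 <= t -> has_tderiv (Y^~ i) t (F (X t) i)) ->
  (forall i, continuous (Y'^~ i)) -> (forall (t : R) i, t <= 0 -> Y' t i = x0 i) ->
  (forall (t : R) i, 0 <= t -> has_tderiv (Y'^~ i) t (F (X' t) i)) ->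
  forall t i, `|Y t i - Y' t i| <= c / 2 * expR (K * t).
Proof.
move=> XX Yc Y0 Yd Y'c Y'0 Y'd T i.
have c0 : 0 <= c.
  by have := XX 0 i; rewrite mulr0 expR0 mulr1; exact: le_trans.
have [T0|/ltW T0] := leP T 0.
  by rewrite Y0// Y'0// subrr normr0 mulr_ge0 ?expR_ge0 ?divr_ge0.
have FF t : `|F (X t) i - F (X' t) i| <= c / 2 * (K * expR (K * t)).
  apply: le_trans (F_lip _ _ _) _.
  apply: (@le_trans _ _ (L * (#|I|%:R * (c * expR (K * t))))).
    rewrite ler_pM2l// (le_trans (ler_sum _ (fun j _ => XX t j)))//.
    by rewrite sumr_const mulr_natl.
  have -> : c / 2 * (K * expR (K * t)) = L * (#|I|.+1%:R * (c * expR (K * t))).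
    by rewrite /K; field.
  by rewrite ler_pM2l// ler_wpM2r ?ler_nat// mulr_ge0 ?expR_ge0.
have comp (Z Z' : R -> I -> R) (V V' : R -> I -> R) :
    (forall i, continuous (V^~ i)) -> (forall i, continuous (V'^~ i)) ->
    V 0 i = V' 0 i ->
    (forall (t : R) i, 0 <= t -> has_tderiv (V^~ i) t (F (Z t) i)) ->
    (forall (t : R) i, 0 <= t -> has_tderiv (V'^~ i) t (F (Z' t) i)) ->
    (forall t, F (Z t) i - F (Z' t) i <= c / 2 * (K * expR (K * t))) ->
    V T i <= V' T i + c / 2 * expR (K * T).
  move=> Vc V'c V0 Vd V'd ZZ.
  apply: (@derive_le_le _ (V^~ i) (fun t => V' t i + c / 2 * expR (K * t))
    (fun t => F (Z t) i) (fun t => F (Z' t) i + c / 2 * (K * expR (K * t)))) => //.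
  - by rewrite V0 lerDl mulr0 expR0 mulr1 divr_ge0.
  - by move=> t; apply: cvgD; [exact: V'c | exact: expM_continuous].
  - by move=> t t0 _; apply: has_tderiv_is_derive => //; apply: Vd; exact: ltW.
  - move=> t t0 _; apply: is_deriveD; last exact: is_derive_expM.
    by apply: has_tderiv_is_derive => //; apply: V'd; exact: ltW.
  - by move=> t _ _; rewrite -lerBlDl; exact: ZZ.
rewrite ler_norml; apply/andP; split.
  rewrite lerNl opprB lerBlDl; apply: (comp X' X) => //.
    by rewrite Y0// Y'0.
  by move=> t; rewrite (le_trans (ler_norm _))// distrC.
rewrite lerBlDl; apply: (comp X X') => //; first by rewrite Y0// Y'0.
by move=> t; rewrite (le_trans (ler_norm _)).
Qed.

(** The intervals of radius [2 * c / 2 ^+ p] around [a p] are nested; the supremum of their left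
    ends lies in all of them. *)
Lemma geometric_cauchy (a : nat -> R) (c : R) :
  (forall p, `|a p.+1 - a p| <= c / 2 ^+ p) ->
  exists l, forall p, `|a p - l| <= 2 * c / 2 ^+ p.
Proof.
move=> ac; pose e p : R := 2 * c / 2 ^+ p.
have eS p : e p = c / 2 ^+ p + e p.+1.
  by rewrite /e exprS; field; rewrite expf_neq0.
have e0 p : 0 <= e p.
  rewrite /e mulrAC -mulrA mulr_ge0//.
  have /(le_trans (normr_ge0 _)) := ac p.
  by rewrite [c / _]mulrC.
have lo p q : (p <= q)%N -> a p - e p <= a q - e q.
  elim: q => [|q IH]; first by rewrite leqn0 => /eqP ->.
  rewrite leq_eqVlt ltnS => /predU1P[->//|/IH/le_trans]; apply.
  by have := ac q; rewrite ler_norml => /andP[? _]; have := eS q; lra.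
have hi p q : (p <= q)%N -> a q + e q <= a p + e p.
  elim: q => [|q IH]; first by rewrite leqn0 => /eqP ->.
  rewrite leq_eqVlt ltnS => /predU1P[->//|/IH]; apply: le_trans.
  by have := ac q; rewrite ler_norml => /andP[_ ?]; have := eS q; lra.
have lohi p q : a p - e p <= a q + e q.
  case: (leqP p q) => [/lo|/ltnW/hi] H; [apply: le_trans H _|apply: le_trans _ H].
    by rewrite lerD2l; have := e0 q; lra.
  by rewrite lerD2l; have := e0 p; lra.
exists (sup (range (fun p => a p - e p))) => p; rewrite ler_norml; apply/andP; split.
  rewrite lerBrDl lerBlDr; apply: ge_sup; first by exists (a 0%N - e 0%N), 0%N.
  by move=> _ [q _ <-]; exact: lohi.
rewrite lerBlDr -lerBlDl; apply: ub_le_sup; last by exists p.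
by exists (a 0%N + e 0%N) => _ [q _ <-]; exact: lohi.
Qed.

Lemma le_geometric0 (x c : R) : (forall p, x <= c / 2 ^+ p) -> x <= 0.
Proof.
move=> xc; rewrite leNgt; apply/negP => x0.
have [n cn] : exists n, c / x < n%:R.
  by exists (Num.bound `|c / x|); apply: le_lt_trans (ler_norm _) (archi_boundP _).
have := xc n; apply/negP; rewrite -ltNge ltr_pdivrMr ?exprn_gt0//.
rewrite mulrC -ltr_pdivrMr// (lt_trans cn)// -natrX ltr_nat; exact: ltn_expl.
Qed.

(** Banach's fixed point argument carried out by hand: successive iterates approach each other by a
    factor [1 / 2] in the weighted distance, hence converge at every time, with a geometric rate
    that is locally uniform in time. *)
Theorem lipschitz_ode (x0 : I -> R) : exists X : R -> I -> R,
  (forall i, X 0 i = x0 i) /\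
  (forall (t : R) i, 0 <= t -> has_tderiv (X^~ i) t (F (X t) i)).
Proof.
pose ST := {X : R -> I -> R | (forall i, continuous (X^~ i)) /\
  forall (t : R) i, t <= 0 -> X t i = x0 i}.
have next (X : ST) : {Y : ST |
    forall (t : R) i, 0 <= t -> has_tderiv ((sval Y)^~ i) t (F (sval X t) i)}.
  apply: cid; have [Y [Yc Y0 Yd]] := picard_step x0 (svalP X).1.
  by exists (exist _ Y (conj Yc Y0)).
have st0P : (forall i, continuous ((fun _ : R => x0)^~ i)) /\
    forall (t : R) i, t <= 0 -> (fun _ : R => x0) t i = x0 i.
  by split => // i t; exact: cvg_cst.
pose X p : R -> I -> R :=
  sval (iter p (fun X => sval (next X)) (exist _ (fun _ : R => x0) st0P : ST)).
have Xc p i : continuous ((X p)^~ i) by rewrite /X; case: (iter p _ _) => ? [].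
have X0 p (t : R) i : t <= 0 -> X p t i = x0 i.
  by rewrite /X; case: (iter p _ _) => ? [? H] /=; exact: H.
have Xd p (t : R) i : 0 <= t -> has_tderiv ((X p.+1)^~ i) t (F (X p t) i).
  by rewrite /X /=; case: (next _) => /= Y; exact.
(* Size of the first increment: [c * K] bounds every [|F x0 i|], so [c * expR (K * t)] grows at
   least as fast as the first iterate moves. *)
pose c : R := 1 + \sum_i `|F x0 i| / K.
have Fc t i : F (X 0%N t) i <= c * K /\ - F (X 0%N t) i <= c * K.
  rewrite /X /= mulrDl mul1r -mulr_suml divfK ?gt_eqF//.
  have : `|F x0 i| <= \sum_i `|F x0 i|.
    by rewrite (bigD1 i)//= lerDl sumr_ge0.
  by rewrite ler_norml => /andP[? ?]; split; have := K0; lra.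
have c0 : 0 <= c by rewrite addr_ge0// sumr_ge0// => i _; rewrite divr_ge0// ltW.
have XS p t i : `|X p.+1 t i - X p t i| <= c * expR (K * t) / 2 ^+ p.
  elim: p t i => [|p IH] t i.
    rewrite expr0 divr1; have [t0|/ltW t0] := leP t 0.
      by rewrite !X0// subrr normr0 mulr_ge0 ?expR_ge0.
    have Vd (u : R) : 0 < u -> is_derive u 1 (X 1%N ^~ i) (F (X 0%N u) i).
      by move=> u0; apply: has_tderiv_is_derive => //; apply: Xd; exact: ltW.
    have ed (u : R) : is_derive u 1 (fun t : R => c * expR (K * t) + X 1%N 0 i)
        (c * (K * expR (K * u)) + 0).
      by apply: (@is_deriveD _ _ _ _ (cst (X 1%N 0 i))); exact: is_derive_expM.
    have ec : continuous (fun t : R => c * expR (K * t) + X 1%N 0 i).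
      by move=> u; apply: cvgD; [exact: expM_continuous | exact: cvg_cst].
    have eK (u : R) : 0 < u -> c * K <= c * (K * expR (K * u)).
      move=> u0; rewrite ler_wpM2l// ler_peMr//; first exact: ltW.
      by rewrite -expR0 ler_expR mulr_ge0// ltW.
    have -> : X 0%N t i = X 1%N 0 i by rewrite (X0 1%N 0 i (lexx 0)).
    rewrite ler_norml; apply/andP; split.
      rewrite lerNl opprB lerBlDr.
      apply: (@derive_le_le _ (cst (X 1%N 0 i)) (fun t => c * expR (K * t) + X 1%N t i)
        (cst 0) (fun u => c * (K * expR (K * u)) + F (X 0%N u) i)) => //.
      + by rewrite lerDr mulr0 expR0 mulr1.
      + by move=> u; exact: cvg_cst.
      + by move=> u; apply: cvgD; [exact: expM_continuous | exact: Xc].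
      + by move=> u u0 _; apply: is_deriveD; [exact: is_derive_expM | exact: Vd].
      + by move=> u u0 _; have := eK u u0; have := (Fc u i).2 => /=; lra.
    rewrite lerBlDr.
    apply: (@derive_le_le _ (X 1%N ^~ i) (fun t : R => c * expR (K * t) + X 1%N 0 i)
      (fun u => F (X 0%N u) i) (fun t : R => c * (K * expR (K * t)) + 0)) => //.
    - by rewrite lerDr mulr0 expR0 mulr1.
    - by move=> u u0 _; exact: Vd.
    - by move=> u u0 _; rewrite addr0 (le_trans (Fc _ _).1)// eK.
  rewrite exprSr invfM [X in _ <= X]mulrA.
  have -> : c * expR (K * t) / 2 ^+ p / 2 = c / 2 ^+ p / 2 * expR (K * t) by field; rewrite expf_neq0.
  apply: (@picard_contract x0 (X p.+1) (X p)); first by move=> u j; rewrite mulrAC.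
  - exact: Xc.
  - exact: X0.
  - exact: Xd.
  - exact: Xc.
  - exact: X0.
  - exact: Xd.
have /choice[Xl XlP] : forall t, exists l : I -> R, forall i p,
    `|X p t i - l i| <= 2 * (c * expR (K * t)) / 2 ^+ p.
  move=> t; have /choice[l lP] : forall i, exists l, forall p,
      `|X p t i - l| <= 2 * (c * expR (K * t)) / 2 ^+ p.
    by move=> i; apply: (@geometric_cauchy (fun p => X p t i)) => p; exact: XS.
  by exists l => i p; exact: lP.
have Xl0 (t : R) i : t <= 0 -> Xl t i = x0 i.
  move=> t0; apply/eqP; rewrite eq_sym -subr_eq0 -normr_le0.
  by apply: (@le_geometric0 _ (2 * (c * expR (K * t)))) => p; rewrite -(X0 p t).
have Xlc i : continuous (Xl^~ i).
  move=> t; apply/cvgrPdist_lt => e e0.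
  (* The error bound taken at time [t + 1] serves for all [s <= t + 1], so the convergence is
     uniform near [t] and the limit is continuous. *)
  pose d := 2 * (c * expR (K * (t + 1))).
  have [p pd] : exists p, d / 2 ^+ p < e / 3.
    apply/not_existsP => H; have : e / 3 <= 0.
      by apply: (@le_geometric0 _ d) => p; rewrite leNgt; apply/negP; exact: H.
    by apply/negP; rewrite -ltNge divr_gt0.
  have dP (s : R) : s <= t + 1 -> `|X p s i - Xl s i| < e / 3.
    move=> st; apply: le_lt_trans pd; apply: le_trans (XlP _ _ _) _.
    by rewrite ler_pM2r ?invr_gt0 ?exprn_gt0// ler_pM2l// ler_wpM2l// ler_expR ler_pM2l.
  have := Xc p i t => /cvgrPdist_lt/(_ (e / 3)).
  rewrite divr_gt0// => /(_ isT) H; near=> s.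
  have : `|X p t i - X p s i| < e / 3 by near: s.
  have : `|X p s i - Xl s i| < e / 3.
    by apply: dP; near: s; apply: lt_le_nbhsl; rewrite ltrDl.
  have : `|X p t i - Xl t i| < e / 3 by apply: dP; rewrite lerDl.
  rewrite !ltr_norml; lra.
exists Xl; split=> [i|]; first by rewrite Xl0.
(* [Y] is the Picard image of the limit [Xl]. The iterates are geometrically close to [Xl] and, by
   contraction, to [Y]; hence both agree, and [Y] has the required derivative. *)
have [Y [Yc Y0 Yd]] := picard_step x0 Xlc.
suff XY t i : Xl t i = Y t i.
  by move=> t i t0; apply: eq_has_tderiv (Yd t i t0) => // s _; rewrite XY.
apply/eqP; rewrite -subr_eq0 -normr_le0.
apply: (@le_geometric0 _ (2 * (c * expR (K * t)))) => p.
have h1 := XlP t i p.+1; rewrite distrC in h1.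
rewrite -[Xl t i](subrK (X p.+1 t i)) -addrA.
rewrite (le_trans (ler_normD _ _))//.
have h2 : `|X p.+1 t i - Y t i| <= (2 * c / 2 ^+ p) / 2 * expR (K * t).
    apply: (@picard_contract x0 (X p) Xl).
    - by move=> u j; rewrite mulrAC -[2 * c * _]mulrA; exact: XlP.
    - exact: Xc.
    - exact: X0.
    - exact: Xd.
    - exact: Yc.
    - exact: Y0.
    - exact: Yd.
apply: le_trans (lerD h1 h2) _; rewrite exprSr.
rewrite le_eqVlt; apply/orP; left; apply/eqP.
by field; rewrite expf_neq0.
Unshelve. all: by end_near. Qed.

End LipschitzODE.

(** * Calculus rules for one-sided derivatives *)

Section TDeriv.
Variable R : realType.
Implicit Types (f g : R -> R) (t l k : R).

Lemma has_tderiv_cst (a t : R) : has_tderiv (cst a) t 0.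
Proof. by apply: is_derive_has_tderiv; exact: is_derive_cst. Qed.

Lemma has_tderivD f g t l k : has_tderiv f t l -> has_tderiv g t k ->
  has_tderiv (fun s => f s + g s) t (l + k).
Proof.
move=> fl gk; rewrite /has_tderiv.
have -> : (fun s => (f s + g s - (f t + g t)) / (s - t)) =
  (fun s => (f s - f t) / (s - t) + (g s - g t) / (s - t)).
  by apply/funext => s; rewrite opprD addrACA mulrDl.
by apply: cvgD.
Qed.

Lemma has_tderivM f g t l k : has_tderiv f t l -> has_tderiv g t k ->
  has_tderiv (fun s => f s * g s) t (l * g t + f t * k).
Proof.
move=> fl gk; rewrite /has_tderiv.
(* Each factor is frozen at [t], and the remainder is the product of both quotients with [s - t]; so
   only limits of quotients occur and continuity of [f] or [g] need not be established. *)
have -> : (fun s => (f s * g s - f t * g t) / (s - t)) =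
  (fun s => (f s - f t) / (s - t) * g t + f t * ((g s - g t) / (s - t))
    + (f s - f t) / (s - t) * (((g s - g t) / (s - t)) * (s - t))).
  apply/funext => s; have [->|st] := eqVneq s t.
    by rewrite !subrr !mul0r mulr0 !addr0.
  by field; rewrite subr_eq0.
rewrite -[X in _ --> X]addr0; apply: cvgD.
  by apply: cvgD; [apply: cvgM => //; exact: cvg_cst | apply: cvgM => //; exact: cvg_cst].
rewrite -(mulr0 l); apply: cvgM => //; rewrite -(mulr0 k); apply: cvgM => //.
rewrite -(subrr t); apply: cvgB; last exact: cvg_cst.
move=> P Pt; apply: filterS (Pt : nbhs t P) => s Ps _ _; exact: Ps.
Qed.

Lemma has_tderivN f t l : has_tderiv f t l -> has_tderiv (fun s => - f s) t (- l).
Proof.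
move=> fl; have := has_tderivM (has_tderiv_cst (-1) t) fl; rewrite mul0r add0r mulN1r.
by under eq_fun do rewrite /cst mulN1r.
Qed.

Lemma has_tderiv_sum (J : finType) (f : J -> R -> R) t (l : J -> R) :
  (forall j, has_tderiv (f j) t (l j)) ->
  has_tderiv (fun s => \sum_j f j s) t (\sum_j l j).
Proof.
move=> fl; rewrite unlock; elim: (index_enum J) => [|j r IH] /=.
  exact: has_tderiv_cst.
exact: has_tderivD.
Qed.

Lemma tderiv_le f g (df dg : R -> R) T : f 0 <= g 0 -> 0 <= T ->
  (forall t, 0 <= t -> has_tderiv f t (df t)) ->
  (forall t, 0 <= t -> has_tderiv g t (dg t)) ->
  (forall t, 0 < t -> t < T -> df t <= dg t) -> f T <= g T.
Proof.
move=> fg0 T0 fd gd fg.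
have := @derive_le_le R (fun t => f (Num.max 0 t)) (fun t => g (Num.max 0 t)) df dg T.
rewrite maxxx max_r//; apply => //.
- by apply: has_tderiv_max_continuous => t /fd H; exists (df t).
- by apply: has_tderiv_max_continuous => t /gd H; exists (dg t).
- by move=> t t0 _; apply: has_tderiv_max_is_derive => //; exact/fd/ltW.
- by move=> t t0 _; apply: has_tderiv_max_is_derive => //; exact/gd/ltW.
Qed.

Lemma has_tderiv_expM k t : has_tderiv (fun s => expR (k * s)) t (k * expR (k * t)).
Proof.
have := is_derive_expM 1 k t; rewrite mul1r => /is_derive_has_tderiv.
by under eq_fun do rewrite mul1r.
Qed.

(* The first zero [t0] of [f] would satisfy [f t0 >= f 0 * expR (- K * t0) > 0]. *)
Lemma tderiv_gt0 f (df : R -> R) K : 0 < f 0 ->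
  (forall t, 0 <= t -> has_tderiv f t (df t)) ->
  (forall t, 0 <= t -> 0 <= f t -> - K * f t <= df t) ->
  forall t, 0 <= t -> 0 < f t.
Proof.
move=> f0 fd fK T T0; rewrite ltNge; apply/negP => fT.
pose S := [set t | 0 <= t /\ f t <= 0].
have S0 : S !=set0 by exists T.
have Sl : has_lbound S by exists 0 => t [].
have t0 : 0 <= inf S by apply: lb_le_inf => // t [].
have fc : continuous (fun t => f (Num.max 0 t)).
  by apply: has_tderiv_max_continuous => t /fd H; exists (df t).
have ft0 : f (inf S) <= 0.
  rewrite leNgt; apply/negP => fp.
  have /cvgrPdist_lt/(_ _ fp)/nbhs_ballP[d /= d0 dP] := fc (inf S).
  have [s [s0 fs] sd] := inf_adherent d0 (conj S0 Sl).
  have := dP s; rewrite /ball /= !max_r// => /(_ _)/wrap[].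
    by rewrite distrC ger0_norm ?subr_ge0 ?ge_inf// ltrBlDl.
  by rewrite ltr_norml => /andP[]; lra.
have fpos t : 0 <= t -> t < inf S -> 0 < f t.
  move=> tp; rewrite ltNge => H; rewrite ltNge; apply: contra H => ft.
  by apply: ge_inf.
have : f 0 <= f (inf S) * expR (K * inf S).
  apply: (@tderiv_le (cst (f 0)) (fun t => f t * expR (K * t)) (cst 0)
     (fun t => df t * expR (K * t) + f t * (K * expR (K * t)))) => //.
  - by rewrite mulr0 expR0 mulr1.
  - by move=> t _; exact: has_tderiv_cst.
  - by move=> t tp; apply: has_tderivM; [exact: fd | exact: has_tderiv_expM].
  - move=> t tp /(fpos _ (ltW tp))/ltW/(fK _ (ltW tp)) H.
    rewrite mulrA -mulrDl mulr_ge0 ?expR_ge0//; move: H; rewrite /cst/=; lra.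
apply/negP; rewrite -ltNge (le_lt_trans _ f0)//.
by rewrite mulr_le0_ge0// expR_ge0.
Qed.

End TDeriv.

(** * The discrete system: existence, positivity, conservation *)

Section Grid.
Variables (R : realType) (m : nat).
Implicit Types (w z : 'I_m.+1 -> R).

Lemma sum_ordS w : \sum_k w (ordS k) = \sum_k w k.
Proof. by rewrite [RHS](reindex _ (onW_bij _ (@ordS_bij m.+1))). Qed.

Lemma sum_ord_pred w : \sum_k w (ord_pred k) = \sum_k w k.
Proof. by rewrite [RHS](reindex _ (onW_bij _ (@ord_pred_bij m.+1))). Qed.

Lemma mesh_gt0 : 0 < mesh R m.
Proof. by rewrite invr_gt0. Qed.

Lemma sum_dlaplacian w : \sum_k dlaplacian w k = 0.
Proof.
rewrite /dlaplacian -mulr_suml sumrB big_split/= sum_ordS sum_ord_pred -mulr_sumr.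
by ring.
Qed.

Lemma dlaplacian_dist w z k :
  `|dlaplacian w k - dlaplacian z k| <= 4 / mesh R m ^+ 2 * \sum_l `|w l - z l|.
Proof.
rewrite /dlaplacian -mulrBl normrM [X in _ * X]ger0_norm; last first.
  by rewrite invr_ge0 sqr_ge0.
rewrite -mulrA [_^-1 * _]mulrC mulrA ler_pM2r ?invr_gt0 ?exprn_gt0 ?mesh_gt0//.
have le l : `|w l - z l| <= \sum_l `|w l - z l|.
  by rewrite (bigD1 l)//= lerDl sumr_ge0.
have := le (ordS k); have := le (ord_pred k); have := le k.
rewrite !ler_norml => /andP[? ?] /andP[? ?] /andP[? ?].
by apply/andP; split; lra.
Qed.

End Grid.

Section System.
Variables (R : realType) (n m : nat) (D : 'I_n -> R) (A : 'I_n -> 'I_n -> R).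
Hypothesis D_ge0 : forall i, 0 <= D i.
Hypothesis A_ge0 : forall i j, 0 <= A i j.
Implicit Types (u v : 'I_n -> 'I_m.+1 -> R).

Definition flux u i l : R := D i * u i l + u i l * \sum_j A i j * u j l.

Lemma dlaplacian_flux u i k : dlaplacian (flux u i) k =
  D i * dlaplacian (u i) k + dlaplacian (fun l => u i l * \sum_j A i j * u j l) k.
Proof. by rewrite /dlaplacian /flux mulrA -mulrDl; congr (_ / _); ring. Qed.

(** A single constant dominating [D i + \sum_j A i j] for every [i], used in all Lipschitz and
    growth bounds of the flux. *)
Definition total_rate : R := \sum_i D i + \sum_i \sum_j A i j.

Lemma total_rate_ge0 : 0 <= total_rate.
Proof. by rewrite addr_ge0 ?sumr_ge0// => i _; rewrite sumr_ge0. Qed.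

Lemma sumA_le_total_rate i : D i + \sum_j A i j <= total_rate.
Proof.
apply: lerD; rewrite [leRHS](bigD1 i)//= lerDl sumr_ge0// => j _.
by rewrite sumr_ge0.
Qed.

Lemma A_le_total_rate i j : A i j <= total_rate.
Proof.
apply: le_trans (sumA_le_total_rate i).
by rewrite (bigD1 j)//= addrCA lerDl addr_ge0// sumr_ge0.
Qed.

(** The quadratic terms differ by [(u_i - v_i) \sum_j A_ij u_j + v_i \sum_j A_ij (u_j - v_j)]. The
    Lipschitz constant grows only linearly in the size [B] of the values, which the height can
    absorb later. *)
Lemma flux_dist (B : R) u v i l :
  (forall j, `|u j l| <= B) -> (forall j, `|v j l| <= B) ->
  `|flux u i l - flux v i l| <= total_rate * (1 + 2 * B) * \sum_j `|u j l - v j l|.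
Proof.
move=> uB vB; set K := total_rate; set d := \sum_j _.
have B0 : 0 <= B := le_trans (normr_ge0 _) (uB i).
have d0 j : `|u j l - v j l| <= d by rewrite /d (bigD1 j)//= lerDl sumr_ge0.
have -> : flux u i l - flux v i l =
   D i * (u i l - v i l) + (u i l - v i l) * (\sum_j A i j * u j l)
   + v i l * (\sum_j A i j * (u j l - v j l)).
  rewrite /flux; under [X in _ = _ + _ * X]eq_bigr do rewrite mulrBr.
  by rewrite sumrB; ring.
have sA : \sum_j A i j <= K.
  by apply: le_trans (sumA_le_total_rate i); rewrite lerDr.
have sum_le (w : 'I_n -> R) b : (forall j, `|w j| <= b) ->
    `|\sum_j A i j * w j| <= K * b.
  move=> wb; apply: le_trans (ler_norm_sum _ _ _) _.
  apply: (@le_trans _ _ (\sum_j A i j * b)).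
    by apply: ler_sum => j _; rewrite normrM ger0_norm// ler_wpM2l.
  by rewrite -mulr_suml ler_wpM2r// (le_trans _ (wb i)).
have K0 : 0 <= K := total_rate_ge0.
rewrite (le_trans (ler_normD _ _))//.
have -> : K * (1 + 2 * B) * d = K * d + d * (K * B) + B * (K * d) by ring.
apply: lerD; last first.
  by rewrite normrM ler_pM//; apply: sum_le => j; exact: d0.
rewrite (le_trans (ler_normD _ _))// lerD//.
  rewrite normrM ger0_norm// ler_pM//; apply: le_trans (sumA_le_total_rate i).
  by rewrite lerDl sumr_ge0.
by rewrite normrM ler_pM//; exact: sum_le.
Qed.

Lemma rhs_dist (B : R) u v i k :
  (forall j l, `|u j l| <= B) -> (forall j l, `|v j l| <= B) ->
  `|dlaplacian (flux u i) k - dlaplacian (flux v i) k| <=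
  4 / mesh R m ^+ 2 * (total_rate * (1 + 2 * B)) * \sum_(p : 'I_n * 'I_m.+1) `|u p.1 p.2 - v p.1 p.2|.
Proof.
move=> uB vB; apply: le_trans (dlaplacian_dist _ _ _) _.
rewrite -[leRHS]mulrA ler_wpM2l ?divr_ge0 ?exprn_ge0 ?(ltW (mesh_gt0 _ _))//.
have -> : \sum_(p : 'I_n * 'I_m.+1) `|u p.1 p.2 - v p.1 p.2| = \sum_l \sum_j `|u j l - v j l|.
  by rewrite exchange_big pair_bigA.
rewrite mulr_sumr.
by apply: ler_sum => l _; apply: flux_dist.
Qed.

Definition clamp (b x : R) : R := Num.max 0 (Num.min b x).

Lemma clamp_dist b x y : `|clamp b x - clamp b y| <= `|x - y|.
Proof.
apply: le_trans (dist_max0 _ _) _.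
rewrite ler_distl; apply/andP; split; case: (leP b x) => ?; case: (leP b y) => ?;
  have := ler_norm (x - y); have := ler_norm (y - x); rewrite (distrC y x); lra.
Qed.

Lemma clamp_itv b x : 0 <= b -> 0 <= clamp b x <= b.
Proof. by move=> b0; rewrite /clamp le_max lexx/= ge_max b0 ge_min lexx. Qed.

Lemma clamp_le b x : 0 <= x -> clamp b x <= x.
Proof. by move=> x0; rewrite /clamp ge_max x0 ge_min lexx orbT. Qed.

Lemma clamp_id b x : 0 <= x -> x <= b -> clamp b x = x.
Proof. by move=> x0 xb; rewrite /clamp min_r// max_r. Qed.

Variable u0 : 'I_n -> R -> R.
Hypothesis u0_gt0 : forall i x, 0 < u0 i x.

(** A discrete Laplacian sums to zero over the cyclic grid, so the total mass has zero derivative;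
    comparison with a constant is made in both directions. *)
Lemma conserved_sum (f : 'I_m.+1 -> R -> R) (w : R -> 'I_m.+1 -> R) :
  (forall t k, 0 <= t -> has_tderiv (f k) t (dlaplacian (w t) k)) ->
  forall t, 0 <= t -> \sum_k f k t = \sum_k f k 0.
Proof.
move=> fd T T0.
have sd t : 0 <= t -> has_tderiv (fun s => \sum_k f k s) t 0.
move=> t0; have := @has_tderiv_sum R _ f t _ (fun k => fd t k t0).
  by rewrite sum_dlaplacian.
have cd (c : R) t : 0 <= t -> has_tderiv (cst c) t 0 by move=> _; exact: has_tderiv_cst.
apply/le_anti/andP; split.
  by apply: (@tderiv_le _ (fun s => \sum_k f k s) (cst (\sum_k f k 0)) (cst 0) (cst 0)) => //; exact: cd.
by apply: (@tderiv_le _ (cst (\sum_k f k 0)) (fun s => \sum_k f k s) (cst 0) (cst 0)) => //; exact: cd.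
Qed.

(** The right-hand side is evaluated at values clamped to [[0, B]], where [B] is the sum of all
    initial values over species and nodes; it is then globally Lipschitz. Fluxes at neighbouring
    nodes are nonnegative and the flux at the node itself is at most a multiple of its value, whence
    positivity. The conserved sums then bound each value by [B], so the clamp is the identity along
    the solution. *)
Lemma discrete_solution_exists : exists u : 'I_n -> R -> 'I_m.+1 -> R,
  discrete_solution D A u0 u /\ forall i t k, 0 <= t -> 0 < u i t k.
Proof.
pose B : R := \sum_i \sum_(k < m.+1) u0 i (k%:R * mesh R m).
have B0 : 0 <= B by apply: sumr_ge0 => i _; apply: sumr_ge0 => k _; exact: ltW.
pose C (x : 'I_n * 'I_m.+1 -> R) i k := clamp B (x (i, k)).
pose F (x : 'I_n * 'I_m.+1 -> R) p := dlaplacian (flux (C x) p.1) p.2.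
pose L := 4 / mesh R m ^+ 2 * (total_rate * (1 + 2 * B)) + 1.
have h0 : 0 < mesh R m ^+ 2 by rewrite exprn_gt0// mesh_gt0.
have L'0 : 0 <= 4 / mesh R m ^+ 2 * (total_rate * (1 + 2 * B)).
  apply: mulr_ge0; first by rewrite divr_ge0 ?(ltW h0).
  by rewrite mulr_ge0 ?total_rate_ge0 ?addr_ge0 ?mulr_ge0.
have L0 : 0 < L by rewrite ltr_wpDl.
have CB x i k : `|C x i k| <= B.
  by have /andP[? ?] := clamp_itv (x (i, k)) B0; rewrite ger0_norm.
have F_lip x y p : `|F x p - F y p| <= L * \sum_q `|x q - y q|.
  apply: le_trans (@rhs_dist B _ _ _ _ _ _) _ => //.
  apply: ler_pM => //; rewrite ?sumr_ge0//.
  - by rewrite lerDl.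
  - by apply: ler_sum => -[i k] _; exact: clamp_dist.
have [X [X0 Xd]] := lipschitz_ode L0 F_lip (fun p => u0 p.1 (p.2%:R * mesh R m)).
have C0 t j l : 0 <= C (X t) j l by have /andP[] := clamp_itv (X t (j, l)) B0.
have flux0 t j l : 0 <= flux (C (X t)) j l.
  by rewrite addr_ge0 ?mulr_ge0// sumr_ge0// => q _; rewrite mulr_ge0.
have Xpos i k t : 0 <= t -> 0 < X t (i, k).
  apply: (@tderiv_gt0 _ (X^~ (i, k)) (fun t => F (X t) (i, k))
    (2 / mesh R m ^+ 2 * (total_rate * (1 + B)))).
  - by rewrite X0.
  - by move=> s; exact: Xd.
  move=> s s0 Xs.
  have : flux (C (X s)) i k <= total_rate * (1 + B) * X s (i, k).
    rewrite [total_rate * (1 + B)]mulrC -mulrA mulrDl mul1r /flux.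
    have Cx : C (X s) i k <= X s (i, k) by exact: clamp_le.
    apply: lerD.
      apply: ler_pM => //; apply: le_trans (sumA_le_total_rate i).
      by rewrite lerDl sumr_ge0.
    rewrite mulrA [leRHS]mulrC ler_pM// ?sumr_ge0// => [q _|]; first by rewrite mulr_ge0.
    apply: (@le_trans _ _ (\sum_j A i j * B)).
      by apply: ler_sum => j _; rewrite ler_wpM2l// (le_trans (ler_norm _)).
    rewrite -mulr_suml mulrC ler_wpM2l//; apply: le_trans (sumA_le_total_rate i).
    by rewrite lerDr.
  rewrite /F /dlaplacian /= => fl.
  rewrite ler_pdivlMr//.
  have -> : - (2 / mesh R m ^+ 2 * (total_rate * (1 + B))) * X s (i, k) * mesh R m ^+ 2
    = - (2 * (total_rate * (1 + B) * X s (i, k))).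
    by field; rewrite gt_eqF// mesh_gt0.
  by have := flux0 s i (ordS k); have := flux0 s i (ord_pred k); lra.
have Xsum i t : 0 <= t -> \sum_k X t (i, k) = \sum_(k < m.+1) u0 i (k%:R * mesh R m).
  move=> t0; rewrite (@conserved_sum (fun k s => X s (i, k)) (fun s => flux (C (X s)) i))//.
    by apply: eq_bigr => k _; rewrite X0.
  by move=> s k s0; exact: (Xd s (i, k)).
have CX t i k : 0 <= t -> C (X t) i k = X t (i, k).
  move=> t0; rewrite /C clamp_id//; first exact/ltW/Xpos.
  apply: (@le_trans _ _ (\sum_k X t (i, k))).
    by rewrite (bigD1 k)//= lerDl sumr_ge0// => l _; exact/ltW/Xpos.
  rewrite Xsum// /B [leRHS](bigD1 i)//= lerDl sumr_ge0// => j _.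
  by rewrite sumr_ge0// => l _; exact: ltW.
exists (fun i t k => X t (i, k)); split => [|i t k]; last exact: Xpos.
split=> [i k|i t k t0]; first by rewrite X0.
rewrite -dlaplacian_flux.
have -> : flux (fun j : 'I_n => [eta fun k0 => X t (j, k0)]) = flux (C (X t)).
  apply/funext => j; apply/funext => l; rewrite /flux CX//; congr (_ + _ * _).
  by apply: eq_bigr => q _; rewrite CX.
exact: (Xd t (i, k)).
Qed.

End System.

(** * Smoothness and uniqueness of discrete solutions *)

Section SmoothUnique.
Variables (R : realType) (n m : nat) (D : 'I_n -> R) (A : 'I_n -> 'I_n -> R).
Variable u0 : 'I_n -> R -> R.
Implicit Types u v : 'I_n -> R -> 'I_m.+1 -> R.

(** The ring of functions of time generated by the components of a solution. The system expresses
    the derivative of a component as such a polynomial, so the class is stable under differentiation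
    and iterated derivatives exist to all orders. *)
Inductive poly_in u : (R -> R) -> Prop :=
| poly_cst c : poly_in u (cst c)
| poly_var i k : poly_in u (fun t => u i t k)
| poly_add f g : poly_in u f -> poly_in u g -> poly_in u (fun t => f t + g t)
| poly_mul f g : poly_in u f -> poly_in u g -> poly_in u (fun t => f t * g t).

Lemma poly_sum u (J : finType) (f : J -> R -> R) : (forall j, poly_in u (f j)) ->
  poly_in u (fun t => \sum_j f j t).
Proof.
move=> fp; rewrite unlock; elim: (index_enum J) => [|j r IH] /=.
  exact: poly_cst.
exact: poly_add.
Qed.

Lemma poly_dlaplacian u (w : R -> 'I_m.+1 -> R) k :
  (forall l, poly_in u (w^~ l)) -> poly_in u (fun t => dlaplacian (w t) k).
Proof.
move=> wp; apply: poly_mul; last exact: poly_cst.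
apply: poly_add; first exact: poly_add.
have -> : (fun t => - (2 * w t k)) = (fun t => cst (- 2) t * w t k).
  by apply/funext => t; rewrite /cst mulNr.
by apply: poly_mul => //; exact: poly_cst.
Qed.

Lemma poly_tderiv u f : discrete_solution D A u0 u -> poly_in u f ->
  exists2 g, poly_in u g & forall t, 0 <= t -> has_tderiv f t (g t).
Proof.
move=> [_ ud]; elim=> [c|i k|f1 g1 _ [f2 pf fd] _ [g2 pg gd]|
    f1 g1 pf1 [f2 pf fd] pg1 [g2 pg gd]].
- by exists (cst 0) => [|t _]; [exact: poly_cst | exact: has_tderiv_cst].
- exists (fun t => dlaplacian (flux D A (fun j => u j t) i) k); last first.
    by move=> t t0; rewrite dlaplacian_flux; exact: ud.
  apply: poly_dlaplacian => l; apply: poly_add.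
    by apply: poly_mul; [exact: poly_cst | exact: poly_var].
  apply: poly_mul; first exact: poly_var.
  apply: poly_sum => j; apply: poly_mul; [exact: poly_cst | exact: poly_var].
- exists (fun t => f2 t + g2 t); first exact: poly_add.
  by move=> t t0; apply: has_tderivD; [exact: fd | exact: gd].
- exists (fun t => f2 t * g1 t + f1 t * g2 t).
    by apply: poly_add; exact: poly_mul.
  by move=> t t0; apply: has_tderivM; [exact: fd | exact: gd].
Qed.

Lemma discrete_solution_tsmooth u : discrete_solution D A u0 u ->
  forall i k, tsmooth (fun t => u i t k).
Proof.
move=> uS i k p.
have [f pf fE] : exists2 f, poly_in u f &
    {in halfline, f =1 iter p (@tderiv R) (fun t => u i t k)}.
  elim: p => [|p [f pf fE]]; first by exists (fun t => u i t k) => //; exact: poly_var.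
  have [g pg gd] := poly_tderiv uS pf.
  exists g => // t /[!inE] t0 /=; apply/esym/tderivE => //.
  exact: eq_has_tderiv fE t0 (gd t t0).
have [g pg gd] := poly_tderiv uS pf.
by move=> t t0; exists (g t); exact: eq_has_tderiv fE t0 (gd t t0).
Qed.

Hypothesis D_ge0 : forall i, 0 <= D i.
Hypothesis A_ge0 : forall i j, 0 <= A i j.

Lemma sum_sqr_le (J : finType) (e : J -> R) :
  (\sum_j `|e j|) ^+ 2 <= #|J|%:R * \sum_j e j ^+ 2.
Proof.
rewrite expr2 mulr_suml.
apply: (@le_trans _ _ (\sum_i \sum_j (e i ^+ 2 / 2 + e j ^+ 2 / 2))).
  apply: ler_sum => i _; rewrite mulr_sumr; apply: ler_sum => j _.
  rewrite -(real_normK (num_real (e i))) -(real_normK (num_real (e j))).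
  have := sqr_ge0 (`|e i| - `|e j|); rewrite !expr2; lra.
rewrite le_eqVlt; apply/orP; left; apply/eqP.
under eq_bigr do rewrite big_split/= sumr_const.
rewrite big_split/= sumr_const sumrMnl -!mulr_suml -!(mulr_natl (_ / 2)).
by field.
Qed.

(** Gronwall for the squared Euclidean distance [E]: both solutions are bounded on [[0, T]], where
    the right-hand side is Lipschitz, so [dE <= K * E] and [E * expR (- K * t)] cannot leave [0].
    Solutions of any sign are covered, which lets positivity be transferred to arbitrary
    solutions. *)
Lemma discrete_solution_unique u v :
  discrete_solution D A u0 u -> discrete_solution D A u0 v ->
  forall i t k, 0 <= t -> v i t k = u i t k.
Proof.
move=> [u00 ud] [v00 vd] i0 T k0 T0.
have bounded (w : 'I_n -> R -> 'I_m.+1 -> R) : (forall i t k, 0 <= t -> tderivable (fun s => w i s k) t) ->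
    exists2 b, 0 <= b & forall i t k, 0 <= t -> t <= T -> `|w i t k| <= b.
  move=> wd.
  have wb (p : 'I_n * 'I_m.+1) : exists b, forall t, 0 <= t -> t <= T -> `|w p.1 t p.2| <= b.
    have wc := has_tderiv_max_continuous (fun t => wd p.1 t p.2).
    have [|c _ cP] := @EVT_max R (fun t => `|w p.1 (Num.max 0 t) p.2|) 0 T T0.
      apply: continuous_subspaceT => t.
      by apply: (@cvg_norm _ _ _ _ _ _ _); exact: wc.
    exists `|w p.1 (Num.max 0 c) p.2| => t t0 tT.
    by have := cP t; rewrite in_itv/= t0 tT max_r//; exact.
  have [b bP] := choice wb.
  exists (\sum_p `|b p|); first exact: sumr_ge0.
  move=> i t k t0 tT; apply: le_trans (bP (i, k) t t0 tT) _.
  by rewrite (bigD1 (i, k))//= (le_trans (ler_norm _))// lerDl sumr_ge0.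
have [bu bu0 uB] : exists2 b, 0 <= b & forall i t k, 0 <= t -> t <= T -> `|u i t k| <= b.
  by apply: bounded => i t k t0; eexists; exact: ud.
have [bv bv0 vB] : exists2 b, 0 <= b & forall i t k, 0 <= t -> t <= T -> `|v i t k| <= b.
  by apply: bounded => i t k t0; eexists; exact: vd.
set B := bu + bv.
set L := 4 / mesh R m ^+ 2 * (total_rate D A * (1 + 2 * B)).
have L0 : 0 <= L.
  apply: mulr_ge0; first by rewrite divr_ge0// exprn_ge0// ltW// mesh_gt0.
  by rewrite mulr_ge0 ?total_rate_ge0 ?addr_ge0 ?mulr_ge0 ?addr_ge0.
pose e (p : 'I_n * 'I_m.+1) t := v p.1 t p.2 - u p.1 t p.2.
pose rhs (w : 'I_n -> R -> 'I_m.+1 -> R) (p : 'I_n * 'I_m.+1) t :=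
  dlaplacian (flux D A (fun j => w j t) p.1) p.2.
pose de p t := rhs v p t - rhs u p t.
have ed p t : 0 <= t -> has_tderiv (e p) t (de p t).
  move=> t0; apply: has_tderivD; first by rewrite /rhs dlaplacian_flux; exact: vd.
  by apply: has_tderivN; rewrite /rhs dlaplacian_flux; exact: ud.
pose N : R := #|{: 'I_n * 'I_m.+1}|%:R.
have dele p t : 0 <= t -> t <= T -> `|de p t| <= L * \sum_q `|e q t|.
  move=> t0 tT; apply: (@rhs_dist _ _ _ _ _ _ _ B) => // j l.
    by rewrite (le_trans (vB _ _ _ _ _))// lerDr.
  by rewrite (le_trans (uB _ _ _ _ _))// lerDl.
pose E t := \sum_p e p t * e p t.
pose dE t := \sum_p (de p t * e p t + e p t * de p t).
have Ed t : 0 <= t -> has_tderiv E t (dE t).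
  move=> t0; apply: (@has_tderiv_sum R _ (fun p s => e p s * e p s) t) => p.
  by apply: has_tderivM; exact: ed.
pose K := 2 * L * N.
have dEle t : 0 <= t -> t <= T -> dE t <= K * E t.
  move=> t0 tT; have SE := sum_sqr_le (e^~ t).
  apply: (@le_trans _ _ (2 * (L * (\sum_q `|e q t|) ^+ 2))).
    rewrite expr2 !mulr_sumr; apply: ler_sum => p _.
    have : de p t * e p t <= L * (\sum_q `|e q t|) * `|e p t|.
      rewrite (le_trans (ler_norm _))// normrM ler_wpM2r//; exact: dele.
    by rewrite -mulrA (mulrC (e p t)); set x := L * _; lra.
  rewrite /K -(mulrA 2) -(mulrA 2) ler_pM2l// -mulrA.
  exact: ler_wpM2l.
have Ezero : E T * expR (- K * T) <= 0.
  apply: (@tderiv_le _ (fun t => E t * expR (- K * t)) (cst 0)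
     (fun t => dE t * expR (- K * t) + E t * (- K * expR (- K * t))) (cst 0)) => //.
  - rewrite /E big1 ?mul0r// => p _.
    by rewrite /e v00 u00 subrr mul0r.
  - by move=> t t0; apply: has_tderivM; [exact: Ed | exact: has_tderiv_expM].
  - by move=> t t0; exact: has_tderiv_cst.
  - move=> s s0 sT; rewrite mulrA -mulrDl mulr_le0_ge0 ?expR_ge0//.
    by have := dEle s (ltW s0) (ltW sT); lra.
have E0 : E T <= 0 by move: Ezero; rewrite pmulr_lle0// expR_gt0.
have : e (i0, k0) T * e (i0, k0) T <= 0.
  apply: le_trans E0; rewrite /E (bigD1 (i0, k0))//= lerDl sumr_ge0// => p _.
  by rewrite -expr2 sqr_ge0.
rewrite -expr2 => e0; have : e (i0, k0) T ^+ 2 == 0 by rewrite eq_le e0 sqr_ge0.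
by rewrite sqrf_eq0 subr_eq0 => /eqP.
Qed.

End SmoothUnique.

(** * Discrete functional inequalities *)

Lemma cauchy_schwarz (R : realFieldType) (J : Type) (r : seq J) (a b : J -> R) :
  (\sum_(i <- r) a i * b i) ^+ 2 <= (\sum_(i <- r) a i ^+ 2) * (\sum_(i <- r) b i ^+ 2).
Proof.
set A := \sum_(i <- r) a i ^+ 2; set B := \sum_(i <- r) b i ^+ 2; set C := \sum_(i <- r) _.
have : 0 <= \sum_(i <- r) \sum_(j <- r) (a i * b j - a j * b i) ^+ 2.
  by apply: sumr_ge0 => i _; apply: sumr_ge0 => j _; exact: sqr_ge0.
have inner i : \sum_(j <- r) (a i * b j - a j * b i) ^+ 2 =
    a i ^+ 2 * B + b i ^+ 2 * A - 2 * (a i * b i) * C.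
  rewrite /A /B /C !mulr_sumr -big_split -sumrB; apply: eq_bigr => j _ /=; ring.
under eq_bigr do rewrite inner.
rewrite sumrB big_split/= -!mulr_suml -mulr_sumr -/A -/B -/C expr2; lra.
Qed.

Section GridIneq.
Variables (R : realType) (m : nat).
Implicit Types (w f g : 'I_m.+1 -> R).
Local Notation h := (mesh R m).

Definition delta w k : R := w (ordS k) - w k.
Definition mean w : R := h * \sum_k w k.
(** The squared Dirichlet seminorm [h * \sum_k (delta w k / h) ^+ 2], that is, the integral of the
    squared slope of the interpolant. *)
Definition grad2 w : R := (\sum_k delta w k ^+ 2) / h.

Lemma grad2_ge0 w : 0 <= grad2 w.
Proof. by rewrite divr_ge0 ?sumr_ge0 ?(ltW (mesh_gt0 _ _))// => k _; rewrite sqr_ge0. Qed.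

Lemma sum_delta w (k l : 'I_m.+1) : (k <= l)%N ->
  w l - w k = \sum_(k <= j < l) delta w (inord j).
Proof.
move=> kl; rewrite -{1}(inord_val l) -{1}(inord_val k).
rewrite -(telescope_sumr (fun j => w (inord j)))//.
apply: eq_big_nat => j /andP[_ jl]; rewrite /delta; congr (w _ - _).
have jm : (j.+1 < m.+1)%N by exact: leq_ltn_trans jl (ltn_ord l).
by apply/val_inj; rewrite /= !inordK ?modn_small// ltnW.
Qed.

Lemma sum_nat_ord_le (F : 'I_m.+1 -> R) (k l : 'I_m.+1) : (forall j, 0 <= F j) ->
  (k <= l)%N -> \sum_(k <= j < l) F (inord j) <= \sum_j F j.
Proof.
move=> F0 kl; have -> : \sum_j F j = \sum_(0 <= j < m.+1) F (inord j).
  by rewrite big_mkord; apply: eq_bigr => j _; rewrite inord_val.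
rewrite [leRHS](@big_cat_nat _ _ _ k)//=; last exact/ltnW/ltn_ord.
rewrite [X in _ <= _ + X](@big_cat_nat _ _ _ l)//=; last exact/ltnW/ltn_ord.
by rewrite addrCA lerDl addr_ge0// sumr_ge0.
Qed.

Lemma osc_le w k l : w k - w l <= \sum_j `|delta w j|.
Proof.
wlog kl : w k l / (k <= l)%N => [H|].
  case: (leqP k l) => [|/ltnW lk]; first exact: H.
  have := H (fun j => - w j) l k lk; rewrite opprK addrC => /le_trans; apply.
  by apply: ler_sum => j _; rewrite /delta -opprD normrN.
rewrite (le_trans (ler_norm _))// distrC sum_delta// (le_trans (ler_norm_sum _ _ _))//.
exact: (@sum_nat_ord_le (fun j => `|delta w j|)).
Qed.

(** Cauchy-Schwarz along the increments from [k] to [l]: the discrete embedding of H^1 into Hölder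
    functions of exponent one half. *)
Lemma dist_sqr_le w (k l : 'I_m.+1) (d : R) : `|k%:R * h - l%:R * h| <= d ->
  (w k - w l) ^+ 2 <= d * grad2 w.
Proof.
wlog kl : k l / (k <= l)%N => [H|].
  case: (leqP k l) => [|/ltnW lk]; first exact: H.
  by rewrite distrC -sqrrN opprB; exact: H.
have h0 := mesh_gt0 R m.
rewrite -mulrBl normrM (ger0_norm (ltW h0)) distrC -natrB// ger0_norm// => kd.
rewrite -sqrrN opprB sum_delta//.
have := cauchy_schwarz (index_iota k l) (fun=> 1) (fun j => delta w (inord j)).
under eq_bigr do rewrite mul1r.
move=> /le_trans; apply; rewrite expr1n sumr_const_nat.
apply: (@le_trans _ _ ((l - k)%:R * \sum_j delta w j ^+ 2)).
  by rewrite ler_wpM2l// (@sum_nat_ord_le (fun j => delta w j ^+ 2))// => j; rewrite sqr_ge0.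
rewrite /grad2 mulrA mulrAC ler_wpM2r ?sumr_ge0// => [j _|]; first by rewrite sqr_ge0.
by rewrite ler_pdivlMr.
Qed.

Lemma mean_cst (c : R) : mean (cst c) = c.
Proof.
by rewrite /mean sumr_const card_ord -[c *+ _]mulr_natl mulrA mulVf ?mul1r// pnatr_eq0.
Qed.

Lemma ler_mean f g : (forall k, f k <= g k) -> mean f <= mean g.
Proof. by move=> fg; rewrite ler_wpM2l ?ler_sum// ltW// mesh_gt0. Qed.

Lemma ex_le_mean w : exists k, w k <= mean w.
Proof.
apply/not_existsP => H.
have : \sum_(k < m.+1) mean w < \sum_k w k.
  apply: ltr_sum => [|k _]; last by rewrite ltNge; apply/negP.
  by apply/hasP; exists ord0 => //; exact: mem_index_enum.
rewrite sumr_const card_ord -mulr_natl {1}/mean mulrA mulfV ?mul1r ?ltxx// pnatr_eq0.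
Qed.

Lemma sum_sqrD_le f : \sum_k (f (ordS k) + f k) ^+ 2 <= 4 * \sum_k f k ^+ 2.
Proof.
have -> : 4 * \sum_k f k ^+ 2 = \sum_k 2 * (f (ordS k) ^+ 2 + f k ^+ 2).
  by rewrite -mulr_sumr big_split/= (sum_ordS (fun k => f k ^+ 2)); ring.
by apply: ler_sum => k _; have := sqr_ge0 (f (ordS k) - f k); rewrite !expr2; lra.
Qed.

Lemma sqr_osc_le f k l : f k ^+ 2 - f l ^+ 2 <= \sum_j `|f (ordS j) + f j| * `|delta f j|.
Proof.
apply: le_trans (osc_le (fun j => f j ^+ 2) k l) _; rewrite le_eqVlt; apply/orP; left.
by apply/eqP; apply: eq_bigr => j _; rewrite -normrM /delta; congr `|_|; ring.
Qed.

(** Start from a node [l] where [f ^+ 2] is at most its mean. The difference [f k ^+ 2 - f l ^+ 2]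
    is bounded by the sum of [|f (ordS j) + f j| * |delta f j|], to which Young's inequality
    applies; [lam] trades the gradient against the L^2 norm. *)
Lemma agmon f (lam : R) k : 0 < lam ->
  f k ^+ 2 <= lam ^+ 2 * grad2 f + (1 + lam ^- 2) * mean (fun j => f j ^+ 2).
Proof.
move=> lam0; have h0 := mesh_gt0 R m.
have [l fl] := ex_le_mean (fun j => f j ^+ 2).
have := sqr_osc_le f k l.
have : \sum_j `|f (ordS j) + f j| * `|delta f j| <=
   \sum_j (lam ^+ 2 / h * delta f j ^+ 2 + h / (4 * lam ^+ 2) * (f (ordS j) + f j) ^+ 2).
  apply: ler_sum => j _.
  rewrite -(real_normK (num_real (delta f j))) -(real_normK (num_real (f (ordS j) + f j))).
  set x := `|delta f j|; set y := `|f (ordS j) + f j|.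
  have -> : lam ^+ 2 / h * x ^+ 2 + h / (4 * lam ^+ 2) * y ^+ 2 =
     (lam ^+ 2 / h) * (x - h / (2 * lam ^+ 2) * y) ^+ 2 + y * x.
    by field; rewrite !gt_eqF.
  by rewrite lerDr mulr_ge0 ?sqr_ge0// divr_ge0 ?sqr_ge0// ltW.
rewrite big_split/= -!mulr_sumr.
have := sum_sqrD_le f; rewrite -(@ler_pM2l _ (h / (4 * lam ^+ 2))); last first.
  by rewrite divr_gt0// mulr_gt0// exprn_gt0.
have -> : h / (4 * lam ^+ 2) * (4 * \sum_k0 f k0 ^+ 2) = lam ^- 2 * mean (fun j => f j ^+ 2).
  by rewrite /mean; field; rewrite gt_eqF.
have -> : lam ^+ 2 / h * \sum_i delta f i ^+ 2 = lam ^+ 2 * grad2 f.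
  by rewrite /grad2; field; rewrite gt_eqF.
by rewrite mulrDl mul1r; lra.
Qed.

(** A Gagliardo-Nirenberg inequality whose lower-order norm is the mass. Let [S] be the maximum. If
    [S <= 2 * mean w] the first term suffices. Otherwise a node [l] below the mean gives
    [S ^+ 2 - w l ^+ 2 >= 3 / 4 * S ^+ 2], while by Cauchy-Schwarz the square of this difference is
    at most [4 * S * mean w * grad2 w]; divide by [S]. *)
Lemma cube_sup_le w k : (forall l, 0 <= w l) ->
  w k ^+ 3 <= 8 * mean w ^+ 3 + 8 * mean w * grad2 w.
Proof.
move=> w0; have h0 := mesh_gt0 R m.
wlog wmax : k / forall l, w l <= w k.
  move=> H; case: (@Order.TotalTheory.arg_maxP _ _ _ k xpredT w isT) => K _ KP.
  apply: le_trans (H K _) => [|l]; last exact: KP.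
  by rewrite lerXn2r ?nnegrE//; exact: KP.
have [l wl] := ex_le_mean w.
have M0 : 0 <= mean w := le_trans (w0 l) wl.
set S := w k; have S0 : 0 <= S := w0 k.
have sq : (S ^+ 2 - w l ^+ 2) ^+ 2 <= 4 * S * mean w * grad2 w.
  apply: (@le_trans _ _ ((\sum_j `|w (ordS j) + w j| * `|delta w j|) ^+ 2)).
    apply: lerXn2r; last exact: sqr_osc_le.
      by rewrite nnegrE subr_ge0 lerXn2r ?nnegrE.
    by rewrite nnegrE sumr_ge0// => j _; rewrite mulr_ge0.
  apply: le_trans (cauchy_schwarz _ _ _) _.
  under eq_bigr do rewrite real_normK ?num_real//.
  under [X in _ * X]eq_bigr do rewrite real_normK ?num_real//.
  have -> : \sum_i delta w i ^+ 2 = h * grad2 w.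
    by rewrite /grad2 mulrCA mulfV ?mulr1// gt_eqF.
  rewrite mulrA ler_wpM2r ?grad2_ge0//.
  have -> : 4 * S * mean w = (\sum_j 2 * S * (w (ordS j) + w j)) * h.
    rewrite -mulr_sumr big_split/= (sum_ordS w) /mean; ring.
  rewrite ler_wpM2r ?(ltW h0)//; apply: ler_sum => j _.
  rewrite expr2 ler_wpM2r ?addr_ge0//.
  by have := wmax (ordS j); have := wmax j; rewrite -/S; lra.
have MG0 : 0 <= mean w * grad2 w := mulr_ge0 M0 (grad2_ge0 w).
have M20 : 0 <= 2 * mean w := mulr_ge0 (ler0n _ 2) M0.
have [SM|SM] := leP S (2 * mean w).
  apply: (@le_trans _ _ ((2 * mean w) ^+ 3)).
    by apply: lerXn2r; rewrite // nnegrE.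
  by rewrite exprMn -natrX lerDl -mulrA mulr_ge0.
have Sp : 0 < S := le_lt_trans M20 SM.
have wl2 : w l ^+ 2 <= S ^+ 2 / 4.
  have : w l ^+ 2 <= (S / 2) ^+ 2.
    by rewrite lerXn2r ?nnegrE ?divr_ge0//; move: wl SM; lra.
  by rewrite expr_div_n -natrX.
have : (3 / 4 * S ^+ 2) ^+ 2 <= 4 * S * mean w * grad2 w.
  apply: le_trans sq; rewrite lerXn2r ?nnegrE ?mulr_ge0 ?sqr_ge0 ?subr_ge0//.
  - by rewrite (le_trans wl2)// ler_pdivrMr// ler_peMr ?sqr_ge0// ler1n.
  - by move: wl2; lra.
have -> : (3 / 4 * S ^+ 2) ^+ 2 = (9 / 16 * S ^+ 3) * S by field.
have -> : 4 * S * mean w * grad2 w = (4 * mean w * grad2 w) * S by ring.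
rewrite ler_pM2r// => H.
have : 0 <= mean w ^+ 3 by rewrite exprn_ge0.
by move: H; rewrite -mulrA -(mulrA 8); move: MG0; lra.
Qed.

Lemma sum_by_parts f g : h * \sum_k f k * dlaplacian g k =
  - (\sum_k delta f k * delta g k) / h.
Proof.
have h0 := mesh_gt0 R m.
have -> : \sum_k f k * dlaplacian g k =
    (\sum_k f k * (g (ordS k) - g k) - \sum_k f k * (g k - g (ord_pred k))) / h ^+ 2.
  rewrite -sumrB mulr_suml; apply: eq_bigr => k _; rewrite /dlaplacian; ring.
have -> : \sum_k f k * (g k - g (ord_pred k)) = \sum_k f (ordS k) * (g (ordS k) - g k).
  rewrite -(sum_ordS (fun k => f k * (g k - g (ord_pred k)))).
  by apply: eq_bigr => k _; rewrite ordSK.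
rewrite -sumrB -sumrN !mulr_suml mulr_sumr; apply: eq_bigr => k _.
by rewrite /delta; field; rewrite gt_eqF.
Qed.

End GridIneq.

(** * Entropy production and bounds on the flux *)

Section LogIneq.
Variable R : realType.
Implicit Types a b : R.

Lemma ln_monotone_ge0 a b : 0 < a -> 0 < b -> 0 <= (a - b) * (ln a - ln b).
Proof.
move=> a0 b0; have [ab|/ltW ba] := leP a b.
  by rewrite mulr_le0 ?subr_le0// ler_ln.
by rewrite mulr_ge0 ?subr_ge0// ler_ln.
Qed.

(** For [b <= a], [ln (b / a) <= b / a - 1] gives [ln a - ln b >= (a - b) / a], and
    [(a ^+ 2 - b ^+ 2) * (a - b) / a] is [(a - b) ^+ 2] times [1 + b / a]. This is how a diagonal
    coefficient [A i i] produces a squared gradient. *)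
Lemma sqr_ln_ge a b : 0 < a -> 0 < b ->
  (a - b) ^+ 2 <= (a ^+ 2 - b ^+ 2) * (ln a - ln b).
Proof.
wlog ba : a b / b <= a => [H a0 b0|a0 b0].
  have [|/ltW ab] := leP b a; first by move/H; exact.
  have := H _ _ ab b0 a0; rewrite -sqrrN opprB => /le_trans; apply.
  by rewrite -mulrNN !opprB.
have lnab : (a - b) / a <= ln a - ln b.
  have : ln (1 + (b / a - 1)) <= b / a - 1.
    by apply: le_ln1Dx; rewrite ltrBrDl subrr divr_gt0.
  rewrite addrC subrK ln_div ?posrE// mulrBl divff ?gt_eqF//; lra.
apply: (@le_trans _ _ ((a ^+ 2 - b ^+ 2) * ((a - b) / a))); last first.
  by rewrite ler_wpM2l// subr_ge0 lerXn2r// nnegrE ltW.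
have -> : (a ^+ 2 - b ^+ 2) * ((a - b) / a) = (a - b) ^+ 2 + b * (a - b) ^+ 2 / a.
  by field; rewrite gt_eqF.
rewrite lerDl; apply: divr_ge0; last exact: ltW.
by apply: mulr_ge0; [exact: ltW | exact: sqr_ge0].
Qed.

End LogIneq.

Section SystemIneq.
Variables (R : realType) (n m : nat) (D : 'I_n -> R) (A : 'I_n -> 'I_n -> R).
Hypothesis D_ge0 : forall i, 0 <= D i.
Hypothesis A_ge0 : forall i j, 0 <= A i j.
Implicit Types (u : 'I_n -> 'I_m.+1 -> R) (f g : 'I_m.+1 -> R).
Local Notation h := (mesh R m).

Lemma grad2_cauchy_schwarz f g (a b : R) : 0 <= a -> 0 <= b ->
  grad2 f <= a ^+ 2 -> grad2 g <= b ^+ 2 ->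
  `|(\sum_k delta f k * delta g k) / h| <= a * b.
Proof.
move=> a0 b0 fa gb; have h0 := mesh_gt0 R m.
rewrite -ler_sqr ?nnegrE ?mulr_ge0// real_normK ?num_real// expr_div_n exprMn.
apply: (@le_trans _ _ (grad2 f * grad2 g)); last first.
  by apply: ler_pM => //; exact: grad2_ge0.
rewrite /grad2 mulf_div -expr2 ler_wpM2r ?invr_ge0 ?exprn_ge0 ?(ltW h0)//.
exact: cauchy_schwarz.
Qed.

(** The shift by [1] allows additive constants and lower powers to be absorbed: every gradient
    quantity at a given time is measured by a power of the height. *)
Definition height u : R := 1 + \sum_i grad2 (u i).

Lemma height_ge1 u : 1 <= height u.
Proof. by rewrite lerDl sumr_ge0// => i _; exact: grad2_ge0. Qed.

Lemma grad2_le_height u i : grad2 (u i) <= height u.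
Proof.
rewrite /height (bigD1 i)//= addrCA lerDl addr_ge0// sumr_ge0// => j _.
exact: grad2_ge0.
Qed.

Lemma sup_height u (M0 : R) : (forall i k, 0 <= u i k) ->
  (forall i, mean (u i) <= M0) -> 0 <= M0 ->
  exists S, [/\ 0 <= S, forall i k, u i k <= S &
    S ^+ 3 <= (8 * M0 ^+ 3 + 8 * M0) * height u].
Proof.
move=> upos uM M00; set C := _ + 8 * M0.
have C0 : 0 <= C by rewrite addr_ge0 ?mulr_ge0 ?exprn_ge0.
have cube i k : u i k ^+ 3 <= C * height u.
  apply: le_trans (cube_sup_le k (upos i)) _.
  have m0 : 0 <= mean (u i) by rewrite mulr_ge0 ?sumr_ge0 ?(ltW (mesh_gt0 _ _)).
  rewrite /C [leRHS]mulrDl; apply: lerD.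
    apply: (@le_trans _ _ (8 * M0 ^+ 3)).
      by rewrite ler_pM2l// lerXn2r// nnegrE.
    by rewrite ler_peMr ?height_ge1 ?mulr_ge0 ?exprn_ge0.
  apply: ler_pM; rewrite ?grad2_ge0 ?ler_pM2l ?grad2_le_height//.
  exact: mulr_ge0 (ler0n _ 8) m0.
case: (pickP (@predT ('I_n))) => [i0 _|H]; last first.
  exists 0; split=> [//|i k|]; first by have := H i.
  by rewrite expr0n/= mulr_ge0// (le_trans ler01)// height_ge1.
case: (@Order.TotalTheory.arg_maxP _ _ _ (i0, ord0) xpredT
  (fun p : 'I_n * 'I_m.+1 => u p.1 p.2) isT) => -[i k] _ kP.
by exists (u i k); split => // j l; exact: (kP (j, l)).
Qed.

Lemma delta_flux_le u (S : R) i k : (forall i k, 0 <= u i k) ->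
  (forall i k, u i k <= S) ->
  `|delta (flux D A u i) k| <=
    total_rate D A * (1 + 2 * S) * \sum_j `|delta (u j) k|.
Proof.
move=> upos uS.
by apply: (@flux_dist _ _ _ _ _ D_ge0 A_ge0 S (fun j l => u j (ordS l)) u i k) => j;
  rewrite ger0_norm.
Qed.

Definition flux_const (M0 : R) : R :=
  1 + total_rate D A ^+ 2 * n%:R * (10 + 8 * (8 * M0 ^+ 3 + 8 * M0)).

Lemma flux_const_ge1 M0 : 0 <= M0 -> 1 <= flux_const M0.
Proof.
move=> M00; have M30 : 0 <= M0 ^+ 3 by exact: exprn_ge0.
rewrite lerDl; apply: mulr_ge0; first by apply: mulr_ge0; rewrite ?sqr_ge0.
move: M30; set M3 := M0 ^+ 3; lra.
Qed.

(** The constants [10] and [8] come from [(1 + 2 * S) ^+ 2 <= 2 + 8 * S ^+ 2] and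
    [S ^+ 2 <= 1 + S ^+ 3]. *)
Lemma sup_sqr_height u (M0 S : R) : 0 <= M0 -> 0 <= S ->
  S ^+ 3 <= (8 * M0 ^+ 3 + 8 * M0) * height u ->
  (1 + 2 * S) ^+ 2 <= (10 + 8 * (8 * M0 ^+ 3 + 8 * M0)) * height u.
Proof.
move=> M00 S0 S3; have H1 := height_ge1 u.
have S2 : S ^+ 2 <= 1 + S ^+ 3.
  have [S1|/ltW S1] := leP S 1.
    by apply: (@le_trans _ _ 1); rewrite ?expr_le1// lerDl exprn_ge0.
  by rewrite [S ^+ 3]exprS (@le_trans _ _ (S * S ^+ 2))// ?ler_peMl ?sqr_ge0// lerDr.
rewrite [leRHS]mulrDl -(mulrA 8); move: S2 S3 H1.
set T := _ * height u; set H := height u; set S3 := S ^+ 3.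
have := sqr_ge0 (1 - 2 * S); rewrite !expr2; lra.
Qed.

(** The flux has a Lipschitz constant of order [1 + 2 * S], whose square is of the order of the
    height. Multiplied with the squared gradients this costs the square of the height and no more,
    so the seminorm of the flux is integrable in time as soon as the height is. *)
Lemma grad2_flux_le u (M0 : R) i : (forall i k, 0 <= u i k) ->
  (forall i, mean (u i) <= M0) -> 0 <= M0 ->
  grad2 (flux D A u i) <= (flux_const M0 * height u) ^+ 2.
Proof.
move=> upos uM M00; have h0 := mesh_gt0 R m.
have [S [S0 uS S3]] := sup_height upos uM M00.
have SH := sup_sqr_height M00 S0 S3.
have H1 := height_ge1 u; have H0 : 0 <= height u := le_trans ler01 H1.
set K := total_rate D A; set Q := 10 + _ in SH.
have M30 : 0 <= M0 ^+ 3 by exact: exprn_ge0.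
have Q0 : 0 <= Q by rewrite /Q; move: M30; set M3 := M0 ^+ 3; lra.
have K0 : 0 <= K := total_rate_ge0 D_ge0 A_ge0.
have step k : delta (flux D A u i) k ^+ 2 <=
    K ^+ 2 * (Q * height u) * n%:R * \sum_j delta (u j) k ^+ 2.
  rewrite -(real_normK (num_real (delta _ k))).
  apply: (@le_trans _ _ ((K * (1 + 2 * S) * \sum_j `|delta (u j) k|) ^+ 2)).
    apply: lerXn2r; rewrite ?nnegrE//; last exact: delta_flux_le.
    by apply: mulr_ge0; [rewrite mulr_ge0// addr_ge0// mulr_ge0 | rewrite sumr_ge0].
  rewrite !exprMn -[leRHS]mulrA; apply: ler_pM.
  - by apply: mulr_ge0; exact: sqr_ge0.
  - exact: sqr_ge0.
  - by apply: ler_wpM2l => //; exact: sqr_ge0.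
  by have := sum_sqr_le (fun j => delta (u j) k); rewrite card_ord.
apply: (@le_trans _ _ (K ^+ 2 * (Q * height u) * n%:R * \sum_j grad2 (u j))).
  rewrite /grad2 -mulr_suml mulrA ler_wpM2r ?invr_ge0 ?(ltW h0)//.
  by rewrite exchange_big/= mulr_sumr ler_sum.
apply: (@le_trans _ _ ((K ^+ 2 * n%:R * Q) * height u ^+ 2)).
  have -> : K ^+ 2 * n%:R * Q * height u ^+ 2 =
    K ^+ 2 * (Q * height u) * n%:R * height u by ring.
  rewrite ler_wpM2l ?lerDr// !mulr_ge0// exprn_ge0//.
rewrite exprMn ler_wpM2r ?sqr_ge0//.
have C1 := flux_const_ge1 M00.
apply: (@le_trans _ _ (flux_const M0)); first by rewrite lerDr.
by rewrite expr2 ler_peMl// (le_trans ler01).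
Qed.

Variable pi_ : 'I_n -> R.
Hypothesis pi_gt0 : forall i, 0 < pi_ i.
Hypothesis A_rev : forall i j, pi_ i * A i j = pi_ j * A j i.

(* Reversibility symmetrises the cross terms into
   [1/2 sum_ij pi_i A_ij (a_i a_j - b_i b_j) (ln (a_i a_j) - ln (b_i b_j))]. *)
Lemma entropy_production_pointwise (a b : 'I_n -> R) :
  (forall i, 0 < a i) -> (forall i, 0 < b i) ->
  \sum_i pi_ i * A i i * (a i - b i) ^+ 2 <=
  \sum_i pi_ i * ((D i * a i + a i * \sum_j A i j * a j) -
    (D i * b i + b i * \sum_j A i j * b j)) * (ln (a i) - ln (b i)).
Proof.
move=> a0 b0; pose L i := ln (a i) - ln (b i).
pose T i j := pi_ i * A i j * (a i * a j - b i * b j).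
have Tsym i j : T i j = T j i by rewrite /T A_rev (mulrC (a i)) (mulrC (b i)).
have -> : \sum_i pi_ i * ((D i * a i + a i * \sum_j A i j * a j) -
    (D i * b i + b i * \sum_j A i j * b j)) * (ln (a i) - ln (b i)) =
    \sum_i pi_ i * D i * ((a i - b i) * L i) + \sum_i \sum_j T i j * L i.
  rewrite -big_split; apply: eq_bigr => i _ /=.
  have -> : \sum_j T i j * L i =
      pi_ i * (a i * \sum_j A i j * a j - b i * \sum_j A i j * b j) * L i.
    rewrite -mulr_suml; congr (_ * _); rewrite !mulr_sumr -sumrB mulr_sumr.
    by apply: eq_bigr => j _; rewrite /T; ring.
  by rewrite -/(L i); ring.
have -> : \sum_i \sum_j T i j * L i = \sum_i \sum_j T i j * (L i + L j) / 2.
  transitivity ((\sum_i \sum_j T i j * L i + \sum_i \sum_j T i j * L i) / 2); first by field.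
  rewrite [X in (_ + X)]exchange_big -big_split mulr_suml; apply: eq_bigr => i _.
  rewrite -big_split mulr_suml; apply: eq_bigr => j _ /=.
  by rewrite (Tsym j i) -mulrDr.
rewrite -[leLHS]add0r lerD//.
  by apply: sumr_ge0 => i _; rewrite mulr_ge0 ?ln_monotone_ge0// mulr_ge0// ltW.
have T0 i j : 0 <= T i j * (L i + L j) / 2.
  apply: divr_ge0 => //; rewrite /T -mulrA; apply: mulr_ge0.
    by apply: mulr_ge0 => //; exact: ltW.
  have -> : L i + L j = ln (a i * a j) - ln (b i * b j).
    by rewrite !lnM ?posrE// /L; ring.
  by apply: ln_monotone_ge0; exact: mulr_gt0.
apply: ler_sum => i _; rewrite (bigD1 i)//= -[leLHS]addr0 lerD ?sumr_ge0//.
have -> : T i i * (L i + L i) / 2 = pi_ i * A i i * ((a i ^+ 2 - b i ^+ 2) * L i).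
  by rewrite /T; field.
by rewrite ler_wpM2l ?sqr_ln_ge// mulr_ge0// ltW.
Qed.

(** Summation by parts turns the left-hand side into a sum over edges of the grid, and the pointwise
    inequality applies to the two end values of each edge. *)
Lemma entropy_production u : (forall i k, 0 < u i k) ->
  \sum_i pi_ i * (h * \sum_k ln (u i k) * dlaplacian (flux D A u i) k) <=
  - \sum_i pi_ i * A i i * grad2 (u i).
Proof.
move=> upos; have h0 := mesh_gt0 R m.
have -> : \sum_i pi_ i * (h * \sum_k ln (u i k) * dlaplacian (flux D A u i) k) =
    - (\sum_k \sum_i pi_ i * delta (flux D A u i) k * (ln (u i (ordS k)) - ln (u i k))) / h.
  rewrite exchange_big/= -sumrN mulr_suml; apply: eq_bigr => i _.
  rewrite (sum_by_parts (fun k => ln (u i k))) mulrA mulrN mulr_sumr.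
  by congr (- _ / _); apply: eq_bigr => k _; rewrite /delta; ring.
have -> : \sum_i pi_ i * A i i * grad2 (u i) =
    (\sum_k \sum_i pi_ i * A i i * (u i (ordS k) - u i k) ^+ 2) / h.
  rewrite exchange_big/= mulr_suml; apply: eq_bigr => i _.
  by rewrite /grad2 mulrA mulr_sumr.
rewrite mulNr lerN2 ler_wpM2r ?invr_ge0 ?(ltW h0)//.
apply: ler_sum => k _.
by apply: (entropy_production_pointwise (a := fun i => u i (ordS k)) (b := fun i => u i k)).
Qed.

End SystemIneq.

(** * Entropy bound and time regularity of the solution *)

Section Continuity.
Variables (R : realType) (T : topologicalType).

Lemma continuous_sum (J : finType) (f : J -> T -> R) :
  (forall j, continuous (f j)) -> continuous (fun t => \sum_j f j t).
Proof.
move=> fc; rewrite unlock; elim: (index_enum J) => [|j r IH] /= x.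
  exact: cvg_cst.
by apply: cvgD; [exact: fc | exact: IH].
Qed.

End Continuity.

Section EntropyDensity.
Variable R : realType.

(** Boltzmann's entropy density, with the affine part chosen so that it is nonnegative, vanishes at
    [1] and has derivative exactly [ln]. *)
Definition psi (x : R) : R := x * ln x - x + 1.

Lemma psi_ge0 (x : R) : 0 < x -> 0 <= psi x.
Proof.
move=> x0; have : ln (1 + (x^-1 - 1)) <= x^-1 - 1.
  by apply: le_ln1Dx; rewrite ltrBrDl subrr invr_gt0.
rewrite addrC subrK lnV ?posrE// -(ler_pM2l x0) mulrBr mulfV ?gt_eqF// /psi; lra.
Qed.

Lemma psi_le (x : R) : 0 < x -> psi x <= (x - 1) ^+ 2.
Proof.
move=> x0; have : ln (1 + (x - 1)) <= x - 1.
  by apply: le_ln1Dx; rewrite ltrBrDl subrr.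
rewrite addrC subrK -(ler_pM2l x0) /psi expr2; lra.
Qed.

Lemma is_derive_psi (x : R) : 0 < x -> is_derive x 1 psi (ln x).
Proof.
move=> x0; have dln := is_derive1_ln x0.
have d1 := is_deriveM (is_derive_id x 1) dln.
have := is_deriveD (is_deriveB d1 (is_derive_id x 1)) (is_derive_cst (1 : R) x 1).
have -> : x *: x^-1 + (ln x)%:A - 1 + 0 = ln x.
  by rewrite /GRing.scale/= mulfV ?gt_eqF// mulr1; ring.
exact.
Qed.

End EntropyDensity.

Section Solution.
Variables (R : realType) (n m : nat) (D : 'I_n -> R) (A : 'I_n -> 'I_n -> R).
Variables (pi_ : 'I_n -> R) (u0 : 'I_n -> R -> R) (B0 : R).
Hypothesis D_ge0 : forall i, 0 <= D i.
Hypothesis A_ge0 : forall i j, 0 <= A i j.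
Hypothesis A_diag : forall i, 0 < A i i.
Hypothesis pi_gt0 : forall i, 0 < pi_ i.
Hypothesis A_rev : forall i j, pi_ i * A i j = pi_ j * A j i.
Hypothesis u0_gt0 : forall i x, 0 < u0 i x.
Hypothesis u0_le : forall i x, u0 i x <= B0.
Variable u : 'I_n -> R -> 'I_m.+1 -> R.
Hypothesis u_sol : discrete_solution D A u0 u.
Hypothesis u_gt0 : forall i t k, 0 <= t -> 0 < u i t k.
Local Notation h := (mesh R m).

Definition frozen : 'I_n -> R -> 'I_m.+1 -> R := fun i t k => u i (Num.max 0 t) k.
Local Notation W := frozen.
Local Notation "'H" := (fun t : R => height (fun i => W i t)).

Lemma frozenE i t k : 0 <= t -> W i t k = u i t k.
Proof. by move=> t0; rewrite /W max_r. Qed.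

Lemma frozen_gt0 i t k : 0 < W i t k.
Proof. by apply: u_gt0; rewrite le_max lexx. Qed.

Lemma frozen_continuous i k : continuous (fun t : R => W i t k).
Proof.
have H : forall t, 0 <= t -> tderivable (fun t => u i t k) t.
  by move=> t t0; have ud := u_sol.2 i t k t0; exact: ex_intro ud.
exact: has_tderiv_max_continuous H.
Qed.

Lemma frozen_derive i k (t : R) : 0 < t ->
  is_derive t 1 (fun t : R => W i t k) (dlaplacian (flux D A (fun j => W j t) i) k).
Proof.
move=> t0; apply: (@has_tderiv_max_is_derive R (fun t => u i t k)) => //.
have -> : (fun j => W j t) = (fun j => u j t).
  by apply/funext => j; apply/funext => l; rewrite frozenE// ltW.
by rewrite dlaplacian_flux; apply: u_sol.2; exact: ltW.
Qed.

Lemma frozen_mean i t : mean (W i t) <= B0.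
Proof.
have T0 : 0 <= Num.max 0 t by rewrite le_max lexx.
rewrite /mean /W (@conserved_sum _ _ (fun k s => u i s k)
    (fun s => flux D A (fun j => u j s) i)) //; last first.
  by move=> s k s0; rewrite dlaplacian_flux; exact: u_sol.2.
rewrite -[leRHS](mean_cst m); apply: ler_mean => k.
by rewrite u_sol.1.
Qed.

Lemma height_continuous : continuous 'H.
Proof.
move=> t; apply: cvgD; first exact: cvg_cst.
apply: continuous_sum => i {}t; apply: cvgM; last exact: cvg_cst.
apply: continuous_sum => k {}t.
have c : continuous (fun t : R => delta (W i t) k).
  by move=> s; apply: cvgB; exact: frozen_continuous.
by under eq_fun do rewrite expr2; apply: cvgM; exact: c.
Qed.

Definition entropy (t : R) : R := \sum_i pi_ i * (h * \sum_k psi (W i t k)).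

Lemma entropy_ge0 t : 0 <= entropy t.
Proof.
apply: sumr_ge0 => i _; apply: mulr_ge0; first exact: ltW.
apply: mulr_ge0; first exact/ltW/mesh_gt0.
by apply: sumr_ge0 => k _; apply: psi_ge0; exact: frozen_gt0.
Qed.

Lemma entropy0_le : entropy 0 <= (B0 + 1) ^+ 2 * \sum_i pi_ i.
Proof.
rewrite mulr_sumr; apply: ler_sum => i _; rewrite mulrC ler_wpM2r//; first exact: ltW.
rewrite -[leRHS](mean_cst m); apply: ler_mean => k.
apply: le_trans (psi_le (frozen_gt0 _ _ _)) _.
have w0 := frozen_gt0 i 0 k.
have wB : W i 0 k <= B0 by rewrite frozenE// u_sol.1.
rewrite /cst -(real_normK (num_real (_ - 1))) lerXn2r ?nnegrE//.
  by rewrite (le_trans (ltW w0))// (le_trans wB)// lerDl.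
by rewrite ler_norml; apply/andP; split; lra.
Qed.

Lemma entropy_continuous : continuous entropy.
Proof.
apply: continuous_sum => i t; apply: cvgM; first exact: cvg_cst.
apply: cvgM; first exact: cvg_cst.
apply: continuous_sum => k {}t.
apply: (@continuous_comp _ _ _ (fun t : R => W i t k) (@psi R)).
  exact: frozen_continuous.
apply: differentiable_continuous; apply/derivable1_diffP.
by have [] := is_derive_psi (frozen_gt0 i t k).
Qed.

Lemma entropy_derive (t : R) : 0 < t -> is_derive t 1 entropy
  (\sum_i pi_ i * (h * \sum_k ln (W i t k) * dlaplacian (flux D A (fun j => W j t) i) k)).
Proof.
move=> t0; apply: has_tderiv_is_derive => //.
apply: (@has_tderiv_sum R _ (fun i s => pi_ i * (h * \sum_k psi (W i s k)))) => i.
have mulc (c : R) f l : has_tderiv f t l -> has_tderiv (fun s => c * f s) t (c * l).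
  by move=> fl; have := has_tderivM (has_tderiv_cst c t) fl; rewrite mul0r add0r.
apply: (mulc); apply: (mulc).
apply: (@has_tderiv_sum R _ (fun k s => psi (W i s k))) => k.
apply: is_derive_has_tderiv; rewrite mulrC.
have := @is_derive1_comp R (@psi R) (fun s => W i s k) t _ _
  (is_derive_psi (frozen_gt0 i t k)) (frozen_derive i k t0).
by rewrite mulrC.
Qed.

(** An explicit positive lower bound of all the [pi_ i * A i i], in place of their minimum. *)
Definition diag_const : R := (1 + \sum_i (pi_ i * A i i)^-1)^-1.

Lemma diag_const_gt0 : 0 < diag_const.
Proof.
rewrite invr_gt0 ltr_wpDr// sumr_ge0// => i _; rewrite invr_ge0 ltW// mulr_gt0//.
Qed.

Lemma diag_const_le i : diag_const <= pi_ i * A i i.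
Proof.
have p0 j : 0 < (pi_ j * A j j)^-1 by rewrite invr_gt0 mulr_gt0.
rewrite -[leRHS]invrK lef_pV2 ?posrE//; last first.
  by rewrite ltr_wpDr// sumr_ge0// => j _; exact: ltW.
by rewrite (bigD1 i)//= addrCA lerDl addr_ge0// sumr_ge0// => j _; exact: ltW.
Qed.

Definition entropy_bound : R := (B0 + 1) ^+ 2 * (\sum_i pi_ i) / diag_const.

(** Entropy dissipation: [diag_const * P + entropy] grows at rate at most [diag_const], because
    entropy production beats the gradient part of the height and the summand [1] contributes the
    rest. The entropy is nonnegative and initially bounded through [B0], so the bound is the same on
    every grid. *)
Lemma height_primitive : exists P : R -> R, [/\ P 0 = 0, continuous P,
  forall t : R, 0 < t -> is_derive t 1 P (height (fun i => W i t)) &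
  forall t, 0 <= t -> P t <= t + entropy_bound].
Proof.
have [Y [Y0 Yd]] := antiderivative height_continuous.
exists (fun t : R => Y (Num.max 0 t)).
have Yc : continuous (fun t : R => Y (Num.max 0 t)).
  apply: (@has_tderiv_max_continuous R Y) => t t0.
  by exists (height (fun i => W i t)); apply: is_derive_has_tderiv; exact: Yd.
have Yd' (t : R) : 0 < t -> is_derive t 1 (fun t : R => Y (Num.max 0 t)) (height (fun i => W i t)).
  move=> t0; apply: (@has_tderiv_max_is_derive R Y) => //.
  by apply: is_derive_has_tderiv; apply: Yd; exact: ltW.
split => //; first by rewrite maxxx.
move=> T T0; have c0 := diag_const_gt0.
rewrite -lerBlDl /entropy_bound ler_pdivlMr//; apply: le_trans entropy0_le.
have mulc (c : R) f l t : has_tderiv f t l -> has_tderiv (fun s => c * f s) t (c * l).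
  by move=> fl; have := has_tderivM (has_tderiv_cst c t) fl; rewrite mul0r add0r.
have did (t : R) : has_tderiv id t 1.
  by apply: is_derive_has_tderiv; exact: is_derive_id.
suff : diag_const * Y (Num.max 0 T) + entropy T <= entropy 0 + diag_const * T.
  by have := entropy_ge0 T; lra.
apply: (@tderiv_le_from _ (fun t : R => diag_const * Y (Num.max 0 t) + entropy t)
   (fun t => entropy 0 + diag_const * t) (fun t => diag_const * height (fun i => W i t) +
  \sum_i pi_ i * (h * \sum_k ln (W i t k) * dlaplacian (flux D A (fun j => W j t) i) k))
  (fun t => 0 + diag_const * 1) 0 T (lexx 0) _ T0).
- by rewrite maxxx Y0 mulr0 addr0 add0r.
- move=> t; apply: cvgD; last exact: entropy_continuous.
  by apply: cvgM; [exact: cvg_cst | exact: Yc].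
- by move=> t; apply: cvgD; [exact: cvg_cst | apply: cvgM; [exact: cvg_cst|exact: cvg_id]].
- move=> t t0 _; apply: has_tderivD.
    by apply: mulc; apply: is_derive_has_tderiv; exact: Yd'.
  by apply: is_derive_has_tderiv; exact: entropy_derive.
- move=> t t0 _; apply: has_tderivD; first exact: has_tderiv_cst.
  by apply: mulc; exact: did.
- move=> t t0 _.
  have := entropy_production D_ge0 A_ge0 pi_gt0 A_rev (fun i k => frozen_gt0 i t k).
  have : diag_const * \sum_i grad2 (W i t) <= \sum_i pi_ i * A i i * grad2 (W i t).
    rewrite mulr_sumr; apply: ler_sum => i _.
    by rewrite ler_wpM2r ?grad2_ge0// diag_const_le.
  by rewrite /height mulrDr mulr1 add0r; lra.
Qed.


Lemma grad2B (f g : 'I_m.+1 -> R) :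
  grad2 (fun k => f k - g k) <= 2 * grad2 f + 2 * grad2 g.
Proof.
rewrite /grad2 !mulrA -mulrDl ler_wpM2r ?invr_ge0 ?(ltW (mesh_gt0 _ _))//.
rewrite !mulr_sumr -big_split; apply: ler_sum => k _ /=.
have -> : delta (fun k => f k - g k) k = delta f k - delta g k by rewrite /delta; ring.
by have := sqr_ge0 (delta f k + delta g k); rewrite !expr2; lra.
Qed.

(** Fix the increment [f] between times [s] and [t]. Its mean square is [y t - y s], where [y r]
    pairs [f] with the solution at time [r]. By parts and Cauchy-Schwarz, [y] grows at rate at most
    [G * C * height], so the mean square is at most [G * C * (P t - P s)]. Agmon's inequality then
    bounds [f k ^+ 2] by the first two terms of the square of the right-hand side. *)
Lemma time_modulus (P : R -> R) i k (s t lam : R) : continuous P ->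
  (forall t : R, 0 < t -> is_derive t 1 P (height (fun i => W i t))) ->
  0 <= s -> s <= t -> 0 < lam -> lam <= 1 ->
  `|W i t k - W i s k| <= lam * (height (fun i => W i t) + height (fun i => W i s))
    + lam ^- 3 * (flux_const D A B0 * (P t - P s)).
Proof.
move=> Pc Pd s0 st lam0 lam1.
have h0 := mesh_gt0 R m.
have B00 : 0 <= B0 by rewrite (le_trans (ltW (u0_gt0 i 0))).
have C1 : 1 <= flux_const D A B0 by apply: flux_const_ge1.
set C := flux_const D A B0 in C1 *.
set f := fun k => W i t k - W i s k.
set G := height _ + height _.
(* With [G >= 2], the bound [2 * G] on the squared seminorm of [f] may be replaced by [G ^+ 2]. *)
have G2 : 2 <= G by apply: lerD; exact: height_ge1.
have fG : grad2 f <= G ^+ 2.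
  apply: le_trans (grad2B _ _) _.
  have := grad2_le_height (fun i => W i t) i.
  have := grad2_le_height (fun i => W i s) i.
  have : 2 * G <= G ^+ 2 by rewrite expr2 ler_wpM2r//; lra.
  by rewrite /G; lra.
pose y (r : R) := h * \sum_k f k * W i r k.
have fm : mean (fun k => f k ^+ 2) = y t - y s.
  rewrite /mean /y -mulrBr -sumrB; congr (_ * _).
  by apply: eq_bigr => l _; rewrite -mulrBr expr2.
have yP : y t <= y s + G * C * (P t - P s).
  apply: (@tderiv_le_from _ y (fun r => y s + G * C * (P r - P s))
    (fun r => h * \sum_k f k * dlaplacian (flux D A (fun j => W j r) i) k)
    (fun r => G * C * height (fun i => W i r)) s t s0 _ st).
  - by rewrite subrr mulr0 addr0.
  - move=> r; apply: cvgM; first exact: cvg_cst.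
    apply: continuous_sum => l {}r; apply: cvgM; first exact: cvg_cst.
    exact: frozen_continuous.
  - move=> r; apply: cvgD; first exact: cvg_cst.
    by apply: cvgM; [exact: cvg_cst | apply: cvgB; [exact: Pc | exact: cvg_cst]].
  - move=> r sr _; have r0 : 0 < r by exact: le_lt_trans sr.
    have mulc (c : R) g l : has_tderiv g r l -> has_tderiv (fun s => c * g s) r (c * l).
      by move=> gl; have := has_tderivM (has_tderiv_cst c r) gl; rewrite mul0r add0r.
    apply: (mulc); apply: (@has_tderiv_sum R _ (fun k r => f k * W i r k)) => l.
    by apply: (mulc); apply: is_derive_has_tderiv; exact: frozen_derive.
  - move=> r sr _; have r0 : 0 < r by exact: le_lt_trans sr.
    have -> : G * C * height (fun i => W i r) = 0 + (0 * (P r - P s) + G * C * (height (fun i => W i r) + 0)).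
      by ring.
    apply: has_tderivD; first exact: has_tderiv_cst.
    apply: has_tderivM; first exact: has_tderiv_cst.
    apply: has_tderivD; last exact: has_tderiv_cst.
    by apply: is_derive_has_tderiv; exact: Pd.
  - move=> r sr _; rewrite sum_by_parts mulNr.
    have H0 : 0 <= height (fun i => W i r) := le_trans ler01 (height_ge1 _).
    apply: le_trans (ler_norm _) _; rewrite normrN -mulrA.
    apply: grad2_cauchy_schwarz => //; first by move: G2; lra.
      by rewrite mulr_ge0// (le_trans ler01).
    apply: grad2_flux_le => // [j l|j]; first exact/ltW/frozen_gt0.
    exact: frozen_mean.
set Q := P t - P s in yP *.
have m0 : 0 <= mean (fun k => f k ^+ 2).
  by rewrite mulr_ge0 ?(ltW h0)// sumr_ge0// => l _; exact: sqr_ge0.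
have mQ : mean (fun k => f k ^+ 2) <= G * (C * Q) by rewrite fm mulrA; lra.
have CQ0 : 0 <= C * Q.
  by have := le_trans m0 mQ; rewrite pmulr_rge0//; move: G2; lra.
have G0 : 0 <= G by move: G2; lra.
have l30 : 0 <= lam ^- 3 by rewrite invr_ge0 exprn_ge0// ltW.
have rhs0 : 0 <= lam * G + lam ^- 3 * (C * Q).
  by rewrite addr_ge0// mulr_ge0// ltW.
rewrite -/(f k) -ler_sqr ?nnegrE// real_normK ?num_real//.
apply: le_trans (agmon f k lam0) _.
have l2 : 1 <= lam ^- 2.
  by rewrite invf_ge1 ?exprn_gt0// expr_le1// ltW.
apply: (@le_trans _ _ (lam ^+ 2 * G ^+ 2 + (2 * lam ^- 2) * (G * (C * Q)))).
  apply: lerD; first by rewrite ler_wpM2l// sqr_ge0.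
  apply: ler_pM => //; first by rewrite addr_ge0// (le_trans ler01).
  by move: l2; lra.
have -> : (lam * G + lam ^- 3 * (C * Q)) ^+ 2 = lam ^+ 2 * G ^+ 2 +
   2 * lam ^- 2 * (G * (C * Q)) + (lam ^- 3 * (C * Q)) ^+ 2.
  by field; rewrite gt_eqF.
by rewrite lerDl sqr_ge0.
Qed.

End Solution.

(** * Almost everywhere limits and Fatou's lemma *)

Section Measure.
Context d (T : measurableType d) (R : realType).
Variables (mu : {measure set T -> \bar R}) (D : set T).
Hypothesis mD : measurable D.
Local Open Scope ereal_scope.

(** The bounds [2 / 2 ^ n.+1] add up to [2], so the sum of the series is integrable and hence finite
    almost everywhere. *)
Lemma summable_integral_ae (phi : nat -> T -> \bar R) :
  (forall n, measurable_fun D (phi n)) -> (forall n x, D x -> 0 <= phi n x) ->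
  (forall n, \int[mu]_(x in D) phi n x <= (2 / (2 ^ n.+1)%:R)%:E) ->
  {ae mu, forall x, D x -> (\sum_(n <oo) phi n x) \is a fin_num}.
Proof.
move=> mphi phi0 le.
have S0 x : D x -> 0 <= \sum_(n <oo) phi n x.
  by move=> Dx; apply: nneseries_ge0 => n _ _; exact: phi0.
apply: integrable_ae => //; apply/integrableP; split.
  by apply: (ge0_emeasurable_sum (P := xpredT)) => [n x Dx _|n _]; [exact: phi0|exact: mphi].
under eq_integral => x /[!inE] Dx do rewrite gee0_abs ?S0//.
rewrite integral_nneseries//.
apply: (@le_lt_trans _ _ 2%:E); last exact: ltry.
apply: le_trans (epsilon_trick0 _ _) => //.
by apply: lee_nneseries => // n _ _; apply: integral_ge0 => x; exact: phi0.
Qed.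

Lemma summable_integral_cvg0 (phi : nat -> T -> \bar R) :
  (forall n, measurable_fun D (phi n)) -> (forall n x, D x -> 0 <= phi n x) ->
  (forall n, \int[mu]_(x in D) phi n x <= (2 / (2 ^ n.+1)%:R)%:E) ->
  {ae mu, forall x, D x -> phi n x @[n --> \oo] --> 0}.
Proof.
move=> mphi phi0 le; have := summable_integral_ae mphi phi0 le.
apply: filterS => x /= + Dx => /(_ Dx) S.
set s := limn _ in S.
have part n : \sum_(0 <= k < n) phi k x <= s.
  by apply: nneseries_lim_ge => k _ _; exact: phi0.
have fin n : phi n x \is a fin_num.
  rewrite ge0_fin_numE ?phi0//; apply: (@le_lt_trans _ _ s); last by rewrite ltey_eq S.
  apply: le_trans (part n.+1); rewrite big_nat_recr//= leeDr// sume_ge0// => k _.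
  exact: phi0.
have phiE n : phi n x = (fine (phi n x))%:E by rewrite fineK.
under eq_cvg do rewrite phiE; apply: cvg_EFin; first by near=> n.
have -> : fine \o (fun n => (fine (phi n x))%:E) = (fun n => fine (phi n x)) by [].
apply: cvg_series_cvg_0; apply: nondecreasing_is_cvgn.
  apply/nondecreasing_seqP => n; rewrite !seriesEnat/= big_nat_recr//= lerDl.
  by rewrite fine_ge0// phi0.
exists (fine s) => _ [n _ <-].
rewrite -lee_fin fineK// seriesEnat/= -sumEFin; apply: le_trans (part n).
by apply: lee_sum => k _; rewrite fineK.
Unshelve. all: by end_near. Qed.

(** The increments of consecutive terms are summable almost everywhere, and telescoping turns this
    into convergence. *)
Lemma cauchy_integral_ae_cvg (f : nat -> T -> R) :
  (forall n, measurable_fun setT (f n)) ->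
  (forall n p, (n <= p)%N ->
    \int[mu]_(x in D) (`|f p x - f n x|%R)%:E <= (2 / (2 ^ n.+1)%:R)%:E) ->
  {ae mu, forall x, D x -> cvgn (f^~ x)}.
Proof.
move=> mf le.
have mg n p : measurable_fun D (fun x => (`|f p x - f n x|%R)%:E).
  apply/measurable_EFinP; apply: measurable_funTS; apply: measurableT_comp => //.
  exact: measurable_funB.
have := @summable_integral_ae (fun n x => (`|f n.+1 x - f n x|%R)%:E) (fun n => mg _ _)
  (fun n x _ => ltac:(by rewrite lee_fin)) (fun n => le n n.+1 (leqnSn n)).
apply: filterS => x /= + Dx => /(_ Dx) S.
set s := limn _ in S.
have tele : (f^~ x) = (fun n => f 0%N x + series (telescope (f^~ x)) n)%R.
  by apply/funext => n; rewrite -(eq_sum_telescope (f^~ x)).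
rewrite tele; apply: is_cvgD; first exact: is_cvg_cst.
apply: normed_cvg; apply: nondecreasing_is_cvgn.
  by apply/nondecreasing_seqP => n; rewrite /normed_series_of /series/= big_nat_recr//= lerDl.
exists (fine s) => _ [n _ <-].
rewrite /normed_series_of /series -lee_fin fineK//= -sumEFin.
apply: (@nneseries_lim_ge _ (fun k => (`|f k.+1 x - f k x|%R)%:E) xpredT 0 n) => k _ _.
by rewrite lee_fin.
Qed.

Lemma measurable_limn_einf (f : nat -> T -> \bar R) :
  (forall n, measurable_fun D (f n)) -> measurable_fun D (fun x => limn_einf (f^~ x)).
Proof.
move=> mf; apply: measurableT_comp => //.
by apply: measurable_fun_limn_esup => n; apply: measurableT_comp.
Qed.

(** Fatou in [p] applied to [|f p - f n|]: the Cauchy bound survives in the limit with the same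
    constant. *)
Lemma riesz_fischer_L1 (f : nat -> T -> R) (u : T -> R) (c : nat -> \bar R) :
  (forall n, measurable_fun setT (f n)) -> measurable_fun setT u ->
  {ae mu, forall x, D x -> f n x @[n --> \oo] --> u x} ->
  (forall n p, (n <= p)%N ->
    \int[mu]_(x in D) (`|f p x - f n x|%R)%:E <= c n) ->
  forall n, \int[mu]_(x in D) (`|u x - f n x|%R)%:E <= c n.
Proof.
move=> mf mu_ fu le n.
have mg p : measurable_fun D (fun x => (`|f p x - f n x|%R)%:E).
  apply/measurable_EFinP; apply: measurable_funTS; apply: measurableT_comp => //.
  exact: measurable_funB.
apply: (@le_trans _ _ (\int[mu]_(x in D) limn_einf (fun p => (`|f p x - f n x|%R)%:E))).
  apply: ae_ge0_le_integral; first exact: mD.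
  - by move=> x _; rewrite lee_fin.
  - apply/measurable_EFinP; apply: measurable_funTS; apply: measurableT_comp => //.
    exact: measurable_funB.
  - move=> x Dx; rewrite limn_einf_lim; apply: lime_ge; first exact: is_cvg_einfs.
    by near=> p; apply: le_ereal_inf_tmp => _ [k _ <-]; rewrite lee_fin.
  - exact: measurable_limn_einf.
  - move: fu; apply: filterS => x /= + Dx => /(_ Dx) fx.
    suff /cvg_limn_einf_sup[-> _] :
      (fun p => (`|f p x - f n x|%R)%:E) @ \oo --> (`|u x - f n x|%R)%:E by [].
    apply: cvg_EFin; first by near=> p.
    by apply: cvg_norm; apply: cvgB => //; exact: cvg_cst.
apply: le_trans (fatou mu mD mg _) _; first by move=> p x _; rewrite lee_fin.
rewrite limn_einf_lim; apply: lime_le; first exact: is_cvg_einfs.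
near=> p; apply: (@le_trans _ _ (\int[mu]_(x in D) (`|f (maxn n p) x - f n x|%R)%:E)).
  by apply: ereal_inf_lbound; exists (maxn n p) => //=; rewrite leq_maxr.
by apply: le; rewrite leq_maxl.
Unshelve. all: by end_near. Qed.

Lemma fatou_bound (f : nat -> T -> R) (u : T -> R) (C : \bar R) :
  (forall n, measurable_fun setT (f n)) -> measurable_fun setT u ->
  (forall n x, 0 <= f n x)%R ->
  {ae mu, forall x, D x -> f n x @[n --> \oo] --> u x} ->
  (forall n, \int[mu]_(x in D) (f n x)%:E <= C) ->
  \int[mu]_(x in D) (`|u x|%R)%:E <= C.
Proof.
move=> mf mu_ f0 fu le.
have mg p : measurable_fun D (fun x => (f p x)%:E).
  by apply/measurable_EFinP; exact: measurable_funTS.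
apply: (@le_trans _ _ (\int[mu]_(x in D) limn_einf (fun p => (f p x)%:E))).
  apply: ae_ge0_le_integral; first exact: mD.
  - by move=> x _; rewrite lee_fin.
  - by apply/measurable_EFinP; apply: measurable_funTS; apply: measurableT_comp.
  - move=> x Dx; rewrite limn_einf_lim; apply: lime_ge; first exact: is_cvg_einfs.
    by near=> p; apply: le_ereal_inf_tmp => _ [k _ <-]; rewrite lee_fin.
  - exact: measurable_limn_einf.
  - move: fu; apply: filterS => x /= + Dx => /(_ Dx) fx.
    suff /cvg_limn_einf_sup[-> _] : (fun p => (f p x)%:E) @ \oo --> (`|u x|%R)%:E by [].
    apply: cvg_EFin; first by near=> p.
    rewrite ger0_norm//; have <- : limn (f^~ x) = u x by exact: cvg_lim fx.
    by apply: limr_ge; [exact: cvgP fx | near=> p].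
apply: le_trans (fatou mu mD mg _) _; first by move=> p x _; rewrite lee_fin.
rewrite limn_einf_lim; apply: lime_le; first exact: is_cvg_einfs.
near=> p; apply: le_trans (le p).
by apply: ereal_inf_lbound; exists p => /=.
Unshelve. all: by end_near. Qed.

End Measure.

Section LimitFunction.
Context d (T : measurableType d) (R : realType).

(** The upper limit made real by [fine]: measurable on the whole space, and equal to the limit
    wherever that limit exists. *)
Definition limfun (f : nat -> T -> R) (x : T) : R :=
  fine (limn_esup (fun n => (f n x)%:E)).

Lemma measurable_limfun f : (forall n, measurable_fun setT (f n)) ->
  measurable_fun setT (limfun f).
Proof.
move=> mf; apply: measurableT_comp => //.
by apply: measurable_fun_limn_esup => n; exact/measurable_EFinP.
Qed.

Lemma cvg_limfun f x : cvgn (f^~ x) -> f n x @[n --> \oo] --> limfun f x.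
Proof.
move=> /cvg_ex[l fl].
have /cvg_limn_einf_sup[_ H] : (fun n => (f n x)%:E) @ \oo --> l%:E.
  by apply: cvg_EFin => //; near=> n.
by rewrite /limfun H.
Unshelve. all: by end_near. Qed.

End LimitFunction.

(** * Tonelli on rectangles, grid cells, interpolants and step functions *)

Section Tonelli.
Context d1 d2 (T1 : measurableType d1) (T2 : measurableType d2) (R : realType).
Variables (m1 : {sigma_finite_measure set T1 -> \bar R}).
Variables (m2 : {sigma_finite_measure set T2 -> \bar R}).
Local Open Scope ereal_scope.

Lemma tonelli_rect (A : set T1) (B : set T2) (f : T1 * T2 -> \bar R) :
  measurable A -> measurable B -> measurable_fun setT f -> (forall z, 0 <= f z) ->
  \int[m1 \x m2]_(z in A `*` B) f z = \int[m1]_(x in A) \int[m2]_(y in B) f (x, y).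
Proof.
move=> mA mB mf f0; have mAB : measurable (A `*` B) by exact: measurableX.
rewrite integral_mkcond fubini_tonelli1; last 2 first.
- by apply/(measurable_restrictT _ _).1 => //; exact: measurable_funTS.
- by move=> z; rewrite /patch; case: ifP.
rewrite [RHS]integral_mkcond; apply: eq_integral => x _.
rewrite /fubini_F /patch; case: ifPn => [/set_mem Ax|/negP Ax].
  rewrite [RHS]integral_mkcond; apply: eq_integral => y _; rewrite /patch.
  by rewrite in_setX mem_set.
rewrite (eq_integral (cst 0)) ?integral0// => y _.
by rewrite in_setX; case: ifPn => // /andP[].
Qed.

End Tonelli.

Section Cells.
Variables (R : realType) (m : nat).
Implicit Types (w c : 'I_m.+1 -> R) (x : R).
Local Notation h := (mesh R m).
Local Notation mu := (@lebesgue_measure R).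

Lemma hatE (e x : R) : 0 < e -> hat e x = Num.max 0 (1 - `|x| / e).
Proof.
move=> e0; rewrite /hat; have [xe|ex] := leP `|x| e.
  by rewrite mulr1 max_r// subr_ge0 ler_pdivrMr// mul1r.
by rewrite mulr0 max_l// subr_le0 ler_pdivlMr// mul1r ltW.
Qed.

Lemma hat0 (e x : R) : 0 < e -> e <= `|x| -> hat e x = 0.
Proof. by move=> e0 ex; rewrite hatE// max_l// subr_le0 ler_pdivlMr// mul1r. Qed.

Lemma hat_continuous (e : R) : 0 < e -> continuous (hat e).
Proof.
move=> e0; have -> : hat e = (fun x => Num.max 0 x) \o (fun x => 1 - `|x| / e).
  by apply/funext => x; rewrite hatE.
move=> x; apply: continuous_comp; last exact: max0_continuous.
apply: cvgB; first exact: cvg_cst.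
by apply: cvgM; [apply: cvg_norm; exact: cvg_id | exact: cvg_cst].
Qed.

Definition cell (k : 'I_m.+1) : set R := [set` `[k%:R * h, k.+1%:R * h[].

Lemma mesh1 : m.+1%:R * h = 1.
Proof. by rewrite /mesh mulfV// pnatr_eq0. Qed.

Lemma cell_sub_torus k : cell k `<=` @torus R.
Proof.
have h0 := mesh_gt0 R m.
move=> x; rewrite /cell /torus /= !in_itv/= => /andP[kx xk]; apply/andP; split.
  by apply: le_trans kx; rewrite mulr_ge0// ltW.
by apply: lt_le_trans xk _; rewrite -[leRHS]mesh1 ler_pM2r// ler_nat ltn_ord.
Qed.

Lemma torus_cell x : @torus R x -> exists k, cell k x.
Proof.
have h0 := mesh_gt0 R m.
rewrite /torus /= in_itv/= => /andP[x0 x1].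
have := truncn_itv (divr_ge0 x0 (ltW h0)); set k := Num.trunc _ => /andP[kx xk].
have km : (k < m.+1)%N.
  rewrite -(ltr_nat R); apply: le_lt_trans kx _.
  by rewrite ltr_pdivrMr// mesh1.
exists (Ordinal km); rewrite /cell /= in_itv/=; apply/andP; split.
  by rewrite -ler_pdivlMr.
by rewrite -ltr_pdivrMr.
Qed.

Lemma interpolant_cell w k x : cell k x ->
  interpolant w x = w k + (x / h - k%:R) * delta w k.
Proof.
have h0 := mesh_gt0 R m.
rewrite /cell /= in_itv/= => /andP[kx xk].
(* The boundary hat at [x = 1] becomes node number [m.+1], carrying the value of node [0]; on cell
   [k] only the hats at [k] and [k.+1] survive. *)
pose w' (j : nat) := if (j < m.+1)%N then w (inord j) else w ord0.
have -> : interpolant w x = \sum_(j < m.+2) w' j * hat h (x - j%:R * h).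
  rewrite big_ord_recr/= /interpolant mesh1 /w' ltnn; congr (_ + _).
  by apply: eq_bigr => j _; rewrite /= ltn_ord inord_val.
have k1m : (k.+1 < m.+2)%N by rewrite ltnS.
have km : (k < m.+2)%N by rewrite ltnW.
rewrite (bigD1 (Ordinal km))//= (bigD1 (Ordinal k1m))/=; last first.
  by rewrite -val_eqE/= gtn_eqF.
rewrite big1 ?addr0 => [|j /andP[]]; last first.
  rewrite -!val_eqE/= => jk jk1; rewrite hat0 ?mulr0//.
  have [jlt|jgt|/eqP] := ltngtP j k; last by rewrite (negbTE jk).
    have : j.+1%:R * h <= k%:R * h by rewrite ler_pM2r// ler_nat.
    rewrite -natr1 mulrDl mul1r => H; apply: le_trans (ler_norm _).
    by move: H kx; lra.
  have : k.+2%:R * h <= j%:R * h.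
    by rewrite ler_pM2r// ler_nat ltn_neqAle eq_sym jk1.
  rewrite -natr1 mulrDl mul1r => H; rewrite distrC; apply: le_trans (ler_norm _).
  by move: H xk; lra.
have -> : w' k = w k by rewrite /w' ltn_ord inord_val.
have -> : w' k.+1 = w (ordS k).
  rewrite /w'; case: ifPn => kS; congr w; apply: val_inj; rewrite /=.
    by rewrite inordK// modn_small.
  have -> : k.+1 = m.+1 by apply/eqP; rewrite eqn_leq ltn_ord leqNgt.
  by rewrite modnn.
rewrite !hatE// !max_r; first last.
- rewrite subr_ge0 ler_pdivrMr// mul1r ger0_norm ?subr_ge0//.
  by move: xk; rewrite -natr1 mulrDl mul1r; lra.
- rewrite subr_ge0 ler_pdivrMr// mul1r ler0_norm ?subr_le0 ?(ltW xk)//.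
  by move: kx; rewrite -natr1 mulrDl mul1r; lra.
rewrite ger0_norm ?subr_ge0// ler0_norm ?subr_le0 ?(ltW xk)//.
by rewrite /delta -natr1; field; rewrite gt_eqF.
Qed.

Lemma cell_theta k x : cell k x -> 0 <= x / h - k%:R < 1.
Proof.
have h0 := mesh_gt0 R m.
rewrite /cell /= in_itv/= => /andP[kx xk]; rewrite subr_ge0 ler_pdivlMr// kx/=.
by rewrite ltrBlDl natr1 ltr_pdivrMr.
Qed.

Lemma interpolant_dist w k x : cell k x ->
  `|interpolant w x - w k| <= `|delta w k|.
Proof.
move=> kx; rewrite (interpolant_cell w kx) [w k + _]addrC addrK normrM.
have /andP[t0 t1] := cell_theta kx.
by rewrite ler_piMl// ger0_norm// ltW.
Qed.

Lemma interpolant_itv w (a b : R) x : @torus R x -> (forall k, a <= w k <= b) ->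
  a <= interpolant w x <= b.
Proof.
move=> /torus_cell[k kx] wab; rewrite (interpolant_cell w kx).
have /andP[t0 /ltW t1] := cell_theta kx; set t := _ - _ in t0 t1 *.
have /andP[ka kb] := wab k; have /andP[Sa Sb] := wab (ordS k).
have -> : w k + t * delta w k = (1 - t) * w k + t * w (ordS k).
  by rewrite /delta; ring.
have s0 : 0 <= 1 - t by rewrite subr_ge0.
have := ler_wpM2l t0 Sa; have := ler_wpM2l t0 Sb.
have := ler_wpM2l s0 ka; have := ler_wpM2l s0 kb.
by move=> *; apply/andP; split; lra.
Qed.

Lemma interpolantB w c x : @torus R x ->
  interpolant w x - interpolant c x = interpolant (fun k => w k - c k) x.
Proof.
move=> /torus_cell[k kx]; rewrite !(interpolant_cell _ kx) /delta; ring.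
Qed.

(** Piecewise constant companion of the interpolant. Its integral over the torus is [mean c], which
    turns grid sums into integrals; with the slopes as values it is the derivative of the
    interpolant. *)
Definition stepf c x : R := \sum_k c k * \1_(cell k) x.

Lemma stepf_cell c k x : cell k x -> stepf c x = c k.
Proof.
have h0 := mesh_gt0 R m.
move=> kx; rewrite /stepf (bigD1 k)//= indicE mem_set// mulr1 big1 ?addr0// => j jk.
rewrite indicE memNset ?mulr0// => jx; move: jx kx.
rewrite /cell /= !in_itv/= => /andP[jx xj] /andP[kx xk].
have := le_lt_trans jx xk; have := le_lt_trans kx xj.
rewrite !ltr_pM2r// !ltr_nat !ltnS => kj jk'.
by move: jk; rewrite -val_eqE/= eqn_leq kj jk'.
Qed.

Lemma measurable_cell k : measurable (cell k : set (measurableTypeR R)).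
Proof. exact: measurable_itv. Qed.

Lemma measurable_torus : measurable (@torus R).
Proof. exact: measurable_itv. Qed.

Lemma measurable_stepf c : measurable_fun setT (stepf c : measurableTypeR R -> R).
Proof.
apply: measurable_sum => k; apply: measurable_funM => //.
by apply: measurable_indic; exact: measurable_cell.
Qed.

Lemma measure_cell k : mu (cell k) = h%:E.
Proof.
have h0 := mesh_gt0 R m.
rewrite /cell lebesgue_measure_itv/= lte_fin ltr_pM2r// ltr_nat ltnSn.
by rewrite -EFinB -mulrBl -natrB// subSnn mul1r.
Qed.

Lemma measure_torus : mu (@torus R) = 1%:E.
Proof. by rewrite /torus lebesgue_measure_itv/= lte_fin ltr01 sube0. Qed.

Lemma integral_stepf c : (\int[mu]_(x in @torus R) (stepf c x)%:E = (mean c)%:E)%E.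
Proof.
have mT := measurable_torus.
have int k : mu.-integrable (@torus R) (fun x => (c k * \1_(cell k) x)%:E).
  under eq_fun do rewrite EFinM; apply: integrableZl => //.
  apply: (integrableS measurableT) => //.
  apply: integrable_indic_itv.
under eq_integral do rewrite /stepf -sumEFin.
rewrite integral_sum// /mean mulr_sumr -sumEFin; apply: eq_bigr => k _.
under eq_integral do rewrite EFinM.
rewrite integralZl//; last first.
  apply: (integrableS measurableT) => //.
  apply: integrable_indic_itv.
rewrite integral_indic//; last exact: measurable_cell.
rewrite (_ : cell k `&` @torus R = cell k).
  by rewrite [X in (_ * X)%E]measure_cell muleC.
by apply/setIidl; exact: cell_sub_torus.
Qed.

End Cells.

(** * Joint measurability and space-time integrals *)

Section JointMeasurability.
Variable R : realType.
Local Notation MR := (measurableTypeR R).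

Lemma measurable_continuous_fst (g : R -> R) : continuous g ->
  measurable_fun setT (fun z : MR * MR => g z.1).
Proof.
move=> gc; apply: (@measurableT_comp _ _ _ _ _ _ (g : MR -> R)); last exact: measurable_fst.
exact: continuous_measurable_fun.
Qed.

Lemma measurable_slice (G : MR * MR -> R) (t : R) : measurable_fun setT G ->
  measurable_fun setT (fun x : MR => G (t, x)).
Proof.
by move=> mG; apply: (measurableT_comp mG); exact: pair1_measurable.
Qed.

Lemma measurable_interpolant m (w : R -> 'I_m.+1 -> R) :
  (forall k, continuous (w^~ k)) ->
  measurable_fun setT (fun z : MR * MR => interpolant (w z.1) z.2).
Proof.
move=> wc; have h0 := mesh_gt0 R m.
have mhat (y : R) : measurable_fun setT (fun z : MR * MR => hat (mesh R m) (z.2 - y)).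
  apply: (@measurableT_comp _ _ _ _ _ _ (fun x : MR => hat (mesh R m) (x - y))); last first.
    exact: measurable_snd.
  apply: continuous_measurable_fun => x.
  apply: (@continuous_comp _ _ _ (fun x : R => x - y) (hat (mesh R m))).
    by apply: cvgB; [exact: cvg_id | exact: cvg_cst].
  exact: hat_continuous.
apply: measurable_funD.
  apply: measurable_sum => k; apply: measurable_funM; last exact: mhat.
  exact: (measurable_continuous_fst (wc k)).
apply: measurable_funM; last exact: mhat.
exact: (measurable_continuous_fst (wc ord0)).
Qed.

Lemma measurable_stepf2 m (w : R -> 'I_m.+1 -> R) :
  (forall k, continuous (w^~ k)) ->
  measurable_fun setT (fun z : MR * MR => stepf (w z.1) z.2).
Proof.
move=> wc; apply: measurable_sum => k; apply: measurable_funM.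
  exact: (measurable_continuous_fst (wc k)).
apply: (@measurableT_comp _ _ _ _ _ _ (\1_(cell k) : MR -> R)); last exact: measurable_snd.
by apply: measurable_indic; exact: measurable_cell.
Qed.

Lemma measurable_cylinder (T : R) : measurable (cylinder T).
Proof. by apply: measurableX; [exact: measurable_itv | exact: measurable_torus]. Qed.

Lemma measurable_inner (f : MR * MR -> \bar R) : measurable_fun setT f ->
  (forall z, 0 <= f z)%E ->
  measurable_fun setT (fun t : MR => \int[@lebesgue_measure R]_(x in @torus R) f (t, x))%E.
Proof.
move=> mf f0; have mT : measurable (setT `*` @torus R : set (MR * MR)).
  by apply: measurableX => //; exact: measurable_torus.
have := @measurable_fun_fubini_tonelli_F _ _ _ _ _ (@lebesgue_measure R)
  (f \_ (setT `*` @torus R)).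
move=> H; apply: eq_measurable_fun (H _ _) => [t _||z].
- rewrite /fubini_F [RHS]integral_mkcond; apply: eq_integral => x _.
  by rewrite /patch in_setX mem_set.
- by apply/(measurable_restrictT _ _).1 => //; exact: measurable_funTS.
- by rewrite /patch; case: ifP.
Qed.

(** By Tonelli, a bound on each time slice integrates to a space-time bound; estimates in terms of
    the height at a fixed time enter here. *)
Lemma rect_integral_le (a b : R) (G : MR * MR -> R) (B : R -> R) :
  measurable_fun setT G -> measurable_fun setT (B : MR -> R) ->
  (forall t, a <= t <= b ->
    (\int[@lebesgue_measure R]_(x in @torus R) (`|G (t, x)|)%:E <= (B t)%:E)%E) ->
  (\int[leb2 R]_(z in [set` `[a, b]] `*` @torus R) (`|G z|)%:E <=
   \int[@lebesgue_measure R]_(t in [set` `[a, b]]) (B t)%:E)%E.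
Proof.
move=> mG mB GB; rewrite /leb2 tonelli_rect//.
- apply: ge0_le_integral => //.
  + by move=> t _; apply: integral_ge0 => x _; rewrite lee_fin.
  + apply: measurable_funTS.
    apply: (@measurable_inner (fun z => (`|G z|)%:E)); last by move=> z; rewrite lee_fin.
    by apply/measurable_EFinP; apply: measurableT_comp.
  + by apply/measurable_EFinP; exact: measurable_funTS.
- exact: measurable_torus.
- by apply/measurable_EFinP; apply: measurableT_comp.
Qed.

Lemma integral_torus_cst (c : R) : (\int[@lebesgue_measure R]_(x in @torus R) c%:E = c%:E)%E.
Proof.
have := integral_cst (@lebesgue_measure R) (@measurable_torus R) c%:E.
by rewrite [X in _ = (_ * X)%E -> _]measure_torus mule1.
Qed.

(** On a compact interval the image ultrafilter has a cluster point, and an ultrafilter converges to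
    each of its cluster points. *)
Lemma bounded_ultra_cvg (F : set_system nat) (a : nat -> R) (K : R) : UltraFilter F ->
  (forall n, `|a n| <= K) -> exists l : R, a @ F --> l.
Proof.
move=> FU aK; have FP : ProperFilter F by exact: ultra_proper.
have [|l [lK lc]] := @segment_compact R (- K) K (fmap a F) _.
  by apply: (@filterS _ F _ setT) => [n _|]; [rewrite /= in_itv/= -ler_norml | exact: filterT].
exists l => B lB; have [//|aB] := in_ultra_setVsetC (a @^-1` B) FU.
have [x []] := lc (~` B) B aB lB; exact.
Qed.

End JointMeasurability.

(** * Consequences of the uniform estimates *)

Section Controlled.
Variables (R : realType) (n m : nat).
Implicit Types (W : 'I_n -> R -> 'I_m.+1 -> R) (P : R -> R).
Local Notation h := (mesh R m).
Local Notation MR := (measurableTypeR R).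

Definition heightt W (t : R) : R := height (fun i => W i t).

(* [P] is a primitive of [heightt W]; stating time regularity through [P]
   avoids integrals in the pointwise estimates. *)
Definition controlled (B0 C E : R) W P : Prop :=
  [/\ forall i k, continuous (fun t => W i t k),
      (forall i t k, 0 <= W i t k) /\ (forall i t, mean (W i t) <= B0),
      [/\ continuous P, forall t, 0 < t -> has_tderiv P t (heightt W t), P 0 = 0 &
        forall t, 0 <= t -> P t <= t + E] &
      forall i k (s t lam : R), 0 <= s -> s <= t -> 0 < lam -> lam <= 1 ->
        `|W i t k - W i s k| <=
          lam * (heightt W t + heightt W s) + lam ^- 3 * (C * (P t - P s))].

Lemma heightt_ge1 W t : 1 <= heightt W t.
Proof. exact: height_ge1. Qed.

Lemma heightt_continuous W : (forall i k, continuous (fun t => W i t k)) ->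
  continuous (heightt W).
Proof.
move=> Wc t; apply: cvgD; first exact: cvg_cst.
apply: continuous_sum => i {}t; apply: cvgM; last exact: cvg_cst.
apply: continuous_sum => k {}t.
have c : continuous (fun t : R => delta (W i t) k) by move=> s; apply: cvgB; exact: Wc.
by under eq_fun do rewrite expr2; apply: cvgM; exact: c.
Qed.

Variables (B0 C E : R) (W : 'I_n -> R -> 'I_m.+1 -> R) (P : R -> R).
Hypothesis B00 : 0 <= B0.
Hypothesis C0 : 0 <= C.
Hypothesis WP : controlled B0 C E W P.

Let Wc i k : continuous (fun t => W i t k). Proof. by case: WP. Qed.
Let W0 i t k : 0 <= W i t k. Proof. by case: WP => _ []. Qed.
Let WB i t : mean (W i t) <= B0. Proof. by case: WP => _ []. Qed.
Let Pc : continuous P. Proof. by case: WP => _ _ []. Qed.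
Let Pd t : 0 < t -> has_tderiv P t (heightt W t).
Proof. by case: WP => _ _ [_ + _ _] _; exact. Qed.
Let P0 : P 0 = 0. Proof. by case: WP => _ _ []. Qed.
Let PT t : 0 <= t -> P t <= t + E.
Proof. by case: WP => _ _ [_ _ _ +] _; exact. Qed.
Let Hc : continuous (heightt W). Proof. exact: heightt_continuous. Qed.

Let mH (A : set MR) : measurable_fun A (fun t : MR => (heightt W t)%:E).
Proof.
by apply/measurable_EFinP/measurable_funTS; exact: continuous_measurable_fun.
Qed.

Lemma integral_heightt (a b : R) : 0 <= a -> a < b ->
  (\int[@lebesgue_measure R]_(t in [set` `[a, b]]) (heightt W t)%:E = (P b - P a)%:E)%E.
Proof.
move=> a0 ab; have Pd' x : x \in `]a, b[ -> is_derive x 1 P (heightt W x).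
  rewrite in_itv/= => /andP[ax _]; have x0 := le_lt_trans a0 ax.
  exact: has_tderiv_is_derive x0 (Pd x0).
rewrite EFinB; apply: continuous_FTC2 => //.
- exact: continuous_subspaceT.
- split; last 2 first.
  + by apply: cvg_at_right_filter; exact: Pc.
  + by apply: cvg_at_left_filter; exact: Pc.
  by move=> x /Pd' [].
- by move=> x /Pd' [_ <-]; rewrite derive1E.
Qed.

Lemma primitive_mono (s t : R) : 0 <= s -> s <= t -> t - s <= P t - P s.
Proof.
move=> s0; rewrite le_eqVlt => /predU1P[->|st]; first by rewrite !subrr.
rewrite -lee_fin -integral_heightt//.
have -> : (t - s)%:E = (\int[@lebesgue_measure R]_(t in [set` `[s, t]]) 1%:E)%E.
  rewrite integral_cst//= mul1e.
  by rewrite lebesgue_measure_itv/= lte_fin st EFinB.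
apply: ge0_le_integral => //.
by move=> x _; rewrite lee_fin heightt_ge1.
Qed.

Lemma primitive_le (a s t b : R) : 0 <= a -> a <= s -> s <= t -> t <= b ->
  P t - P s <= P b - P a.
Proof.
move=> a0 as_ st tb; have s0 := le_trans a0 as_.
have := primitive_mono a0 as_; have := primitive_mono (le_trans s0 st) tb; lra.
Qed.

(** The mean value theorem for [P]. The height is controlled uniformly only through its time
    integral; at [s] it equals its average over the slab and is therefore bounded. *)
Lemma good_time (a b : R) : 0 <= a -> a < b -> exists s,
  a <= s <= b /\ heightt W s * (b - a) = P b - P a.
Proof.
move=> a0 ab; have [||s] := @MVT R P (heightt W) a b ab.
- move=> x; rewrite in_itv/= => /andP[ax _]; have x0 := le_lt_trans a0 ax.
  exact: has_tderiv_is_derive x0 (Pd x0).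
- exact: continuous_subspaceT.
by rewrite in_itv/= => /andP[/ltW ? /ltW ?] ->; exists s; split => //; apply/andP.
Qed.

Definition cube_const : R := 8 * B0 ^+ 3 + 8 * B0.

Lemma cube_const_ge0 : 0 <= cube_const.
Proof.
have : 0 <= B0 ^+ 3 by exact: exprn_ge0.
by rewrite /cube_const; move: B00; set x := B0 ^+ 3; lra.
Qed.

Lemma sup_heightt t : exists S, [/\ 0 <= S, forall i k, W i t k <= S &
  S ^+ 3 <= cube_const * heightt W t].
Proof. exact: (sup_height (u := fun i => W i t) (W0 ^~ t) (WB ^~ t)). Qed.

Lemma value_le i t k : W i t k <= 1 + cube_const * heightt W t.
Proof.
have [S [S0 WS S3]] := sup_heightt t; apply: le_trans (WS i k) _.
apply: (@le_trans _ _ (1 + S ^+ 3)); last by rewrite lerD2l.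
have [S1|S1] := leP S 1; first by rewrite (le_trans S1)// lerDl exprn_ge0.
rewrite exprS (@le_trans _ _ (S * S ^+ 2))// ?lerDr// ler_peMr//.
by rewrite exprn_ege1// ltW.
Qed.

Lemma delta_sqr_le i t k : delta (W i t) k ^+ 2 <= h * heightt W t.
Proof.
have h0 := mesh_gt0 R m.
apply: (@le_trans _ _ (h * grad2 (W i t))).
  rewrite /grad2 mulrCA mulfV ?gt_eqF// mulr1 (bigD1 k)//= lerDl sumr_ge0// => l _.
  exact: sqr_ge0.
by rewrite ler_wpM2l ?(ltW h0)//; exact: (grad2_le_height (fun i => W i t)).
Qed.

(** Three moves: from [x] to the left node [k] of its cell; from node [k] to node [l], at distance
    at most [|x - y| + h <= 2 * r ^+ 2]; and from time [t] to time [s] by the time modulus. The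
    spatial moves cost the square root of the height, which is at most the height. *)
Lemma interpolant_sample_dist i (t s r lam a b : R) (x y : R) (l : 'I_m.+1) :
  0 < r -> h <= r ^+ 2 -> `|x - y| <= r ^+ 2 -> torus x -> cell l y ->
  0 <= a -> a <= s <= b -> a <= t <= b -> 0 < lam -> lam <= 1 ->
  `|interpolant (W i t) x - W i s l| <= 3 * r * heightt W t +
    (lam * (heightt W t + heightt W s) + lam ^- 3 * (C * (P b - P a))).
Proof.
move=> r0 hr xy /(@torus_cell R m)[k kx] ly a0 /andP[as_ sb] /andP[at_ tb] lam0 lam1.
have h0 := mesh_gt0 R m; have H1 := heightt_ge1 W t.
have H0 : 0 <= heightt W t := le_trans ler01 H1.
have HH : heightt W t <= heightt W t ^+ 2 by rewrite expr2 ler_peMr.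
have d1 : `|interpolant (W i t) x - W i t k| <= r * heightt W t.
  apply: le_trans (interpolant_dist _ kx) _.
  rewrite -ler_sqr ?nnegrE ?(mulr_ge0 (ltW r0))// real_normK ?num_real//.
  apply: le_trans (delta_sqr_le _ _ _) _; rewrite exprMn.
  by apply: ler_pM => //; exact: ltW.
have d2 : `|W i t k - W i t l| <= 2 * r * heightt W t.
  rewrite -ler_sqr ?nnegrE; last 2 first.
  - by [].
  - by rewrite mulr_ge0// mulr_ge0// ltW.
  rewrite real_normK ?num_real//.
  apply: le_trans (dist_sqr_le (W i t) (d := 2 * r ^+ 2) _) _.
    have := cell_theta kx; have := cell_theta ly.
    rewrite !subr_ge0 !ltrBlDr !ler_pdivlMr// !ltr_pdivrMr// !(mulrDl 1) !mul1r.
    move=> /andP[? ?] /andP[? ?]; move: xy; rewrite !ler_norml => /andP[? ?].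
    by apply/andP; split; lra.
  have -> : (2 * r * heightt W t) ^+ 2 = (4 * r ^+ 2) * heightt W t ^+ 2 by ring.
  apply: ler_pM.
  - by rewrite mulr_ge0// sqr_ge0.
  - exact: grad2_ge0.
  - by rewrite ler_wpM2r ?sqr_ge0// ler_nat.
  - apply: le_trans HH; exact: (grad2_le_height (fun i => W i t)).
have d3 : `|W i t l - W i s l| <= lam * (heightt W t + heightt W s) + lam ^- 3 * (C * (P b - P a)).
  have l30 : 0 <= lam ^- 3 by rewrite invr_ge0 exprn_ge0// ltW.
  have [_ _ _ mod] := WP.
  have [st|/ltW ts] := leP s t.
    apply: le_trans (mod i l s t lam _ _ _ _) _ => //; first exact: le_trans as_.
    by rewrite lerD2l ler_wpM2l// ler_wpM2l// primitive_le.
  rewrite distrC [heightt W t + _]addrC.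
  apply: le_trans (mod i l t s lam _ _ _ _) _ => //; first exact: le_trans at_.
  by rewrite lerD2l ler_wpM2l// ler_wpM2l// primitive_le.
have -> : interpolant (W i t) x - W i s l = (interpolant (W i t) x - W i t k) +
  (W i t k - W i t l) + (W i t l - W i s l) by ring.
apply: le_trans (ler_normD _ _) _; rewrite lerD//.
apply: le_trans (ler_normD _ _) _; apply: le_trans (lerD d1 d2) _.
by rewrite -mulrDl; apply: ler_wpM2r => //; lra.
Qed.

(** With [S] the bound on the values at time [t], the fourth power is at most [S ^+ 3] times the
    interpolant. The cube is controlled by the height, and the remaining factor integrates to at
    most twice the mass. *)
Lemma interpolant_L4 i (T : R) : 0 < T ->
  (\int[leb2 R]_(z in cylinder T) (`|interpolant (W i z.1) z.2 ^+ 4|)%:E <=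
   (2 * B0 * cube_const * (T + E))%:E)%E.
Proof.
move=> T0; have mf := measurable_interpolant (w := W i) (@Wc i).
apply: le_trans (rect_integral_le (B := fun t => 2 * B0 * cube_const * heightt W t) _ _ _) _.
- exact: measurable_funX.
- apply: continuous_measurable_fun => t; apply: cvgM; first exact: cvg_cst.
  exact: Hc.
- move=> t _ /=.
  have [S [S0 WS S3]] := sup_heightt t.
  pose c k := S ^+ 3 * (W i t k + W i t (ordS k)).
  have S30 : 0 <= S ^+ 3 by exact: exprn_ge0.
  apply: (@le_trans _ _ (\int[@lebesgue_measure R]_(x in @torus R) (stepf c x)%:E)%E).
    have mi : measurable_fun setT (fun x : MR => interpolant (W i t) x).
      exact: (measurable_slice t mf).
    apply: ge0_le_integral.
    + exact: measurable_torus.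
    + by move=> x _; rewrite lee_fin.
    + apply/measurable_EFinP; apply: measurable_funTS; apply: measurableT_comp => //.
      exact: measurable_funX.
    + by apply/measurable_EFinP; apply: measurable_funTS; exact: measurable_stepf.
    + move=> x Tx; have [k kx] := @torus_cell R m x Tx; rewrite lee_fin (stepf_cell _ kx).
      have /andP[f0 fS] : 0 <= interpolant (W i t) x <= S.
        by apply: interpolant_itv => // l; rewrite W0 WS.
      rewrite ger0_norm ?exprn_ge0// exprSr ler_pM ?exprn_ge0//.
        by rewrite lerXn2r ?nnegrE.
      rewrite (interpolant_cell _ kx) /delta; have /andP[t0 t1] := cell_theta kx.
      have := ler_wpM2l t0 (W0 i t k).
      have := ler_wpM2r (W0 i t (ordS k)) (ltW t1).
      by rewrite mulr0 mul1r; lra.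
  rewrite integral_stepf lee_fin /mean -mulr_sumr big_split/= (sum_ordS (W i t)).
  have -> : h * (S ^+ 3 * (\sum_k W i t k + \sum_k W i t k)) = (2 * mean (W i t)) * S ^+ 3.
    by rewrite /mean; ring.
  rewrite -[leRHS]mulrA; apply: ler_pM => //; last by rewrite ler_pM2l.
  by rewrite mulr_ge0// mulr_ge0 ?sumr_ge0// ltW// mesh_gt0.
under eq_integral do rewrite EFinM.
rewrite ge0_integralZl//; first last.
- by rewrite lee_fin mulr_ge0 ?cube_const_ge0// mulr_ge0.
- by move=> t _; rewrite lee_fin (le_trans ler01)// heightt_ge1.
rewrite integral_heightt// P0 subr0 -EFinM lee_fin ler_wpM2l ?PT// ?(ltW T0)//.
by rewrite mulr_ge0 ?cube_const_ge0// mulr_ge0.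
Qed.

Definition slope i t : 'I_m.+1 -> R := fun k => delta (W i t) k / h.

Lemma slope_L2 i (T : R) : 0 < T ->
  (\int[leb2 R]_(z in cylinder T) (`|stepf (slope i z.1) z.2 ^+ 2|)%:E <= (T + E)%:E)%E.
Proof.
move=> T0; have h0 := mesh_gt0 R m.
have sc k : continuous (fun t => slope i t k).
  move=> t; apply: cvgM; last exact: cvg_cst.
  by apply: cvgB; exact: Wc.
apply: le_trans (rect_integral_le (B := fun t => heightt W t) _ _ _) _.
- by apply: measurable_funX; exact: measurable_stepf2.
- exact: continuous_measurable_fun.
- move=> t _ /=.
  rewrite (_ : (\int[_]_(_ in _) _)%E = (mean (fun k => slope i t k ^+ 2))%:E).
    rewrite lee_fin /slope /mean.
    apply: le_trans (grad2_le_height (fun i => W i t) i).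
    rewrite /grad2 mulr_sumr mulr_suml; apply: ler_sum => k _.
    by rewrite le_eqVlt; apply/orP; left; apply/eqP; field; rewrite gt_eqF.
  rewrite -integral_stepf; apply: eq_integral => x /set_mem Tx; have [k kx] := @torus_cell R m x Tx.
  by rewrite !(stepf_cell _ kx) ger0_norm ?sqr_ge0.
by rewrite integral_heightt// P0 subr0 lee_fin PT// ltW.
Qed.

End Controlled.

Section IntegralTools.
Context d (T : measurableType d) (R : realType).
Variable mu : {measure set T -> \bar R}.
Local Open Scope ereal_scope.

Lemma integral_setU_le (A B : set T) (f : T -> \bar R) : measurable A -> measurable B ->
  measurable_fun setT f -> (forall x, 0 <= f x) ->
  \int[mu]_(x in A `|` B) f x <= \int[mu]_(x in A) f x + \int[mu]_(x in B) f x.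
Proof.
move=> mA mB mf f0; have mD : measurable (B `\` A) by exact: measurableD.
have -> : A `|` B = A `|` (B `\` A) by rewrite setUDr setDv setD0.
rewrite ge0_integral_setU//; last 2 first.
- exact: measurable_funTS.
- by apply/disj_setPS => x [Ax [_]].
rewrite leeD2l//; apply: ge0_subset_integral => //.
exact: measurable_funTS.
Qed.

End IntegralTools.

(** The constants in [controlled] depend on the data and on [B0], not on [m]; from here on this is
    all that compactness uses of the equation. *)
Lemma solution_controlled (R : realType) (n m : nat) (D : 'I_n -> R)
    (A : 'I_n -> 'I_n -> R) (pi_ : 'I_n -> R) (u0 : 'I_n -> R -> R) (B0 : R)
    (u : 'I_n -> R -> 'I_m.+1 -> R) :
  (forall i, 0 <= D i) -> (forall i j, 0 <= A i j) -> (forall i, 0 < A i i) ->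
  (forall i, 0 < pi_ i) -> (forall i j, pi_ i * A i j = pi_ j * A j i) ->
  (forall i x, 0 < u0 i x) -> (forall i x, u0 i x <= B0) ->
  discrete_solution D A u0 u -> (forall i t k, 0 <= t -> 0 < u i t k) ->
  exists P, controlled B0 (flux_const D A B0) (entropy_bound A pi_ B0) (frozen u) P.
Proof.
move=> D0 A0 Ad p0 Ar u0p u0B us up.
have [P [P0 Pc Pd PT]] := height_primitive D0 A0 Ad p0 Ar u0B us up.
exists P; split.
- by move=> i k; exact: frozen_continuous us i k.
- split=> [i t k|i t]; first exact/ltW/frozen_gt0.
  exact: frozen_mean us i t.
- by split => // t t0; apply: is_derive_has_tderiv; exact: Pd.
- by move=> i k s t lam s0 st l0 l1; exact: (time_modulus D0 A0 u0p u0B us up).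
Qed.

(** * Compactness of the interpolants in L^1 *)

Section Compactness.
Variables (R : realType) (n : nat) (B0 C E : R).
Variables (W : forall m : nat, 'I_n -> R -> 'I_m.+1 -> R) (P : nat -> R -> R).
Hypothesis B00 : 0 <= B0.
Hypothesis C0 : 0 <= C.
Hypothesis WP : forall m, controlled B0 C E (@W m) (P m).
Local Notation MR := (measurableTypeR R).
Local Notation mu := (@lebesgue_measure R).

Definition interp (m : nat) (i : 'I_n) (z : MR * MR) : R :=
  interpolant (@W m i z.1) z.2.

Local Notation H m := (heightt (@W m)).

Lemma Wcont m i k : continuous (fun t => @W m i t k).
Proof. by have [+ _ _ _] := WP m; exact. Qed.

Lemma measurable_interp m i : measurable_fun setT (interp m i).
Proof. by apply: measurable_interpolant => k; exact: Wcont. Qed.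

Lemma measurable_H m : measurable_fun setT (H m : MR -> R).
Proof. by apply: continuous_measurable_fun; apply: heightt_continuous; exact: Wcont. Qed.

Lemma primitive_ge m t : 0 <= t -> t <= P m t.
Proof.
move=> t0; have := primitive_mono (WP m) (lexx 0) t0.
by have [_ _ [_ _ -> _] _] := WP m; rewrite !subr0.
Qed.

Lemma primitive_ub m t : 0 <= t -> P m t <= t + E.
Proof. by have [_ _ [_ _ _ +] _] := WP m; exact. Qed.

Lemma E_ge0 : 0 <= E.
Proof. by have := primitive_ub 0 (lexx 0); have := primitive_ge 0 (lexx 0); lra. Qed.

Lemma slab_integral_le i (M N : nat) (a b al be : R) : 0 <= a -> a < b -> 0 <= al ->
  0 <= be ->
  (forall t x, a <= t <= b -> torus x -> `|interp M i (t, x) - interp N i (t, x)| <=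
     al * H M t + al * H N t + be) ->
  (\int[leb2 R]_(z in [set` `[a, b]] `*` @torus R) (`|interp M i z - interp N i z|)%:E <=
   (al * (P M b - P M a) + al * (P N b - P N a) + be * (b - a))%:E)%E.
Proof.
move=> a0 ab al0 be0 le.
have mS (X : set MR) m : measurable_fun X (fun t : MR => (al * H m t)%:E).
  apply/measurable_EFinP/measurable_funTS; apply: measurable_funM => //.
  exact: measurable_H.
have H0 m t : 0 <= al * H m t by rewrite mulr_ge0// (le_trans ler01)// heightt_ge1.
apply: le_trans (rect_integral_le (B := fun t => al * H M t + al * H N t + be) _ _ _) _.
- by apply: measurable_funB; exact: measurable_interp.
- by apply: measurable_funD => //; apply: measurable_funD; apply: measurable_funM => //;
    exact: measurable_H.
- move=> t tab; rewrite -integral_torus_cst; apply: ge0_le_integral => //.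
  + exact: measurable_torus.
  + apply/measurable_EFinP/measurable_funTS; apply: measurableT_comp => //.
    by apply: measurable_funB; apply: measurable_slice; exact: measurable_interp.
  + by move=> x Tx; rewrite lee_fin; exact: le.
have mab : measurable ([set` `[a, b]] : set MR) by exact: measurable_itv.
under eq_integral do rewrite !EFinD.
rewrite ge0_integralD//; first last.
- by apply: emeasurable_funD.
- by move=> t _; rewrite adde_ge0// lee_fin.
rewrite ge0_integralD//; first last.
- by move=> t _; rewrite lee_fin.
- by move=> t _; rewrite lee_fin.
under eq_integral do rewrite EFinM.
under [X in (_ + X + _)%E]eq_integral do rewrite EFinM.
have h0 m t : (0 <= (H m t)%:E)%E by rewrite lee_fin (le_trans ler01)// heightt_ge1.
rewrite !ge0_integralZl//; last 2 first.
- by apply/measurable_EFinP/measurable_funTS; exact: measurable_H.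
- by apply/measurable_EFinP/measurable_funTS; exact: measurable_H.
rewrite !(integral_heightt (WP _))// integral_cst//= lebesgue_measure_itv/= lte_fin ab.
by rewrite !EFinD !EFinM !EFinB.
Qed.

(** Induction on the number of slabs; the increments of the primitives telescope. *)
Lemma cylinder_slabs i (M N : nat) (tau al be : R) (p : nat) : 0 < tau ->
  (forall l, (l < p.+1)%N ->
   (\int[leb2 R]_(z in [set` `[(l%:R * tau)%R, (l.+1%:R * tau)%R]] `*` @torus R)
     (`|interp M i z - interp N i z|)%:E <=
   (al * (P M (l.+1%:R * tau) - P M (l%:R * tau)) +
    al * (P N (l.+1%:R * tau) - P N (l%:R * tau)) + be)%:E)%E) ->
  (\int[leb2 R]_(z in cylinder (p.+1%:R * tau)) (`|interp M i z - interp N i z|)%:E <=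
   (al * P M (p.+1%:R * tau) + al * P N (p.+1%:R * tau) + be * p.+1%:R)%:E)%E.
Proof.
move=> tau0.
have P0 m : P m 0 = 0 by have [_ _ []] := WP m.
have mG : measurable_fun setT (fun z => (`|interp M i z - interp N i z|)%:E).
  apply/measurable_EFinP; apply: measurableT_comp => //.
  by apply: measurable_funB; exact: measurable_interp.
elim: p => [/(_ 0%N isT)|p IH le].
  by rewrite !mul0r !P0 !subr0 mulr1.
have -> : cylinder (p.+2%:R * tau) = cylinder (p.+1%:R * tau) `|`
    ([set` `[(p.+1%:R * tau)%R, (p.+2%:R * tau)%R]] `*` @torus R).
  have p1 : 0 <= p.+1%:R * tau by rewrite mulr_ge0// ltW.
  have p2 : p.+1%:R * tau <= p.+2%:R * tau by rewrite ler_pM2r// ler_nat.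
  apply/seteqP; split => [[t x]|[t x]]; rewrite /cylinder /= !in_itv/=.
    move=> [/andP[t0 t2] Tx]; have [t1|/ltW t1] := leP t (p.+1%:R * tau).
      by left; split => //; apply/andP.
    by right; split => //; apply/andP.
  move=> [] [/andP[t0 t2] Tx]; split => //; apply/andP; split => //.
    exact: le_trans p2.
  exact: le_trans t0.
have m1 := @measurable_cylinder R (p.+1%:R * tau).
have m2 : measurable ([set` `[(p.+1%:R * tau)%R, (p.+2%:R * tau)%R]] `*` @torus R).
  by apply: measurableX; [exact: measurable_itv | exact: measurable_torus].
apply: le_trans (integral_setU_le (leb2 R) m1 m2 mG _) _; first by move=> z; rewrite lee_fin.
apply: le_trans (leeD (IH _) (le p.+1 (ltnSn _))) _.
  by move=> l lp; apply: le; exact: leqW.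
have -> : be * p.+2%:R = be * p.+1%:R + be by rewrite -(natr1 p.+1) mulrDr mulr1.
rewrite -EFinD lee_fin; set x := P M _; set y := P M _; set x' := P N _; set y' := P N _.
lra.
Qed.

Lemma mesh_le (p q : nat) : (p <= q)%N -> mesh R q <= mesh R p.
Proof. by move=> pq; rewrite /mesh lef_pV2 ?posrE// ler_nat. Qed.

Lemma ex_mesh_le (e : R) : 0 < e -> exists q, mesh R q <= e.
Proof.
move=> e0; exists (Num.bound e^-1); rewrite /mesh invf_ple ?posrE//.
apply: le_trans (ltW (archi_boundP _)) _; first by rewrite invr_ge0 ltW.
by rewrite ler_nat.
Qed.

(** Total boundedness, read along an ultrafilter. Cut [[0, T]] into [p.+1] slabs, take a good time
    in each, and sample there near the nodes of a fixed grid [q]. These finitely many samples are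
    bounded uniformly in [M], hence converge along [F], and on a set of the ultrafilter they are
    within [eta] of their limits. Two interpolants with indices in that set, fine enough, are
    compared through their samples. *)
Lemma ultra_cauchy (F : set_system nat) (T eps : R) : UltraFilter F ->
  (forall N, F [set M | (N <= M)%N]) -> 0 < T -> 0 < eps ->
  exists2 S, F S & forall M N i, S M -> S N ->
    (\int[leb2 R]_(z in cylinder T) (`|interp M i z - interp N i z|)%:E <= eps%:E)%E.
Proof.
move=> FU Foo T0 eps0; have FP : ProperFilter F by exact: ultra_proper.
pose kap := T + E; have kap0 : 0 < kap by rewrite ltr_wpDr// E_ge0.
(* The budget: the rates [3 * r], [2 * lam] and [lam ^- 3 * C * tau], each multiplied by two
   primitives bounded by [kap], cost a quarter of [eps] each; the samples cost [2 * eta * T], the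
   last quarter. [lam] must be fixed before the slab length [tau]. *)
pose r := eps / (24 * kap); have r0 : 0 < r by rewrite divr_gt0// mulr_gt0.
pose lam := Num.min 1 (eps / (16 * kap)).
have lam0 : 0 < lam by rewrite lt_min ltr01 divr_gt0// mulr_gt0.
have lam1 : lam <= 1 by rewrite ge_min lexx.
have lamk : lam * (16 * kap) <= eps.
  by rewrite -ler_pdivlMr ?mulr_gt0// ge_min lexx orbT.
have l30 : 0 <= lam ^- 3 * C by rewrite mulr_ge0// invr_ge0 exprn_ge0// ltW.
have [p pP] : exists p, lam ^- 3 * C * (T * mesh R p) * (8 * kap) <= eps.
  have D0 : 0 <= lam ^- 3 * C * T * (8 * kap).
    by apply: mulr_ge0; apply: mulr_ge0 => //; exact: ltW.
  have den : 0 < lam ^- 3 * C * T * (8 * kap) + 1 by rewrite ltr_wpDl.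
  have [p ph] := ex_mesh_le (divr_gt0 eps0 den).
  exists p; have -> : lam ^- 3 * C * (T * mesh R p) * (8 * kap) =
    (lam ^- 3 * C * T * (8 * kap)) * mesh R p by ring.
  apply: le_trans (ler_wpM2l D0 ph) _.
  by rewrite mulrCA ger_pMr// ler_pdivrMr// mul1r lerDl.
pose tau := T * mesh R p; have tau0 : 0 < tau by rewrite mulr_gt0// mesh_gt0.
have pT : p.+1%:R * tau = T by rewrite /tau mulrCA mesh1 mulr1.
pose eta := eps / (8 * T); have eta0 : 0 < eta by rewrite divr_gt0// mulr_gt0.
have [q qr] := ex_mesh_le (exprn_gt0 2 r0).
have lt0 (l : nat) : 0 <= l%:R * tau by rewrite mulr_ge0// ltW.
have lS (l : nat) : l%:R * tau < l.+1%:R * tau by rewrite ltr_pM2r// ltr_nat.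
have lStau (l : nat) : l.+1%:R * tau - l%:R * tau = tau by rewrite -natr1; ring.
have lT (l : 'I_p.+1) : l.+1%:R * tau <= T by rewrite -pT ler_pM2r// ler_nat.
have /choice[s sP] : forall Ml : nat * 'I_p.+1, exists s,
    Ml.2%:R * tau <= s <= Ml.2.+1%:R * tau /\
    H Ml.1 s * tau = P Ml.1 (Ml.2.+1%:R * tau) - P Ml.1 (Ml.2%:R * tau).
  move=> [M l] /=; have := good_time (WP M) (lt0 l) (lS l); rewrite lStau.
  by move=> [s sH]; exists s.
have tor (j : 'I_q.+1) : @torus R (j%:R * mesh R q).
  apply: (@cell_sub_torus R q j); rewrite /cell /= in_itv/= lexx/=.
  by rewrite ltr_pM2r ?mesh_gt0// ltr_nat.
(* A node of the grid [q] need not be a node of the grid [M]; the cell of the latter that contains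
   it takes its place. *)
pose idx M (j : 'I_q.+1) := sval (cid (torus_cell M (tor j))).
have idxP M j : cell (idx M j) (j%:R * mesh R q) by rewrite /idx; case: cid.
pose a (x : 'I_n * ('I_p.+1 * 'I_q.+1)) M : R :=
  @W M x.1 (s (M, x.2.1)) (idx M x.2.2).
have a_ge0 x M : 0 <= a x M by have [_ [+ _] _ _] := WP M; exact.
have aK x M : `|a x M| <= 1 + cube_const B0 * (kap / tau).
  rewrite ger0_norm//; apply: le_trans (value_le B00 (WP M) _ _ _) _.
  rewrite lerD2l ler_wpM2l ?cube_const_ge0// ler_pdivlMr//.
  have [_ ->] := sP (M, x.2.1); rewrite /=.
  have := primitive_ub M (lt0 x.2.1.+1); have := primitive_ge M (lt0 x.2.1).
  by have := lT x.2.1; have := lt0 x.2.1; rewrite /kap; lra.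
have /choice[l lP] : forall x, exists l : R, a x @ F --> l.
  by move=> x; apply: bounded_ultra_cvg => M; exact: aK.
pose S := [set M | (q <= M)%N] `&` [set M | forall x, `|l x - a x M| < eta].
exists S.
  apply: filterI; first exact: Foo.
  apply: (@filter_forall _ _ (fun x M => `|l x - a x M| < eta) F _) => x.
  by have /cvgrPdist_lt := lP x; apply.
move=> M N i [qM SM] [qN SN].
pose al := 3 * r + lam.
pose be (j : 'I_p.+1) := lam * (H M (s (M, j)) + H N (s (N, j))) + lam ^- 3 * C *
  ((P M (j.+1%:R * tau) - P M (j%:R * tau)) + (P N (j.+1%:R * tau) - P N (j%:R * tau))) +
  2 * eta.
(* The rate after integration over a slab: at a good time [H * tau] is an increment of the
   primitive, which accounts for the second [lam]. *)
pose al' := 3 * r + 2 * lam + lam ^- 3 * C * tau.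
rewrite -[in cylinder T]pT.
have slab (j : nat) : (j < p.+1)%N ->
   (\int[leb2 R]_(z in [set` `[(j%:R * tau)%R, (j.+1%:R * tau)%R]] `*` @torus R)
     (`|interp M i z - interp N i z|)%:E <=
   (al' * (P M (j.+1%:R * tau) - P M (j%:R * tau)) +
    al' * (P N (j.+1%:R * tau) - P N (j%:R * tau)) + 2 * eta * tau)%:E)%E.
  move=> jp; pose J := Ordinal jp.
  have Pm m : 0 <= P m (j.+1%:R * tau) - P m (j%:R * tau).
    have := primitive_mono (WP m) (lt0 j) (ltW (lS j)); rewrite lStau.
    exact/le_trans/ltW.
  have H0 m t : 0 <= H m t := le_trans ler01 (heightt_ge1 _ _).
  apply: le_trans (@slab_integral_le i M N _ _ al (be J) (lt0 j) (lS j) _ _ _) _.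
  - by apply: addr_ge0; [apply: mulr_ge0 => //|]; exact: ltW.
  - apply: addr_ge0; last by apply: mulr_ge0 => //; exact: ltW.
    apply: addr_ge0; apply: mulr_ge0 => //; first exact: ltW.
      by rewrite addr_ge0.
    by rewrite addr_ge0.
  - move=> t x tJ /[dup] Tx /(@torus_cell R q)[k kx].
    have xk : `|x - k%:R * mesh R q| <= r ^+ 2.
      move: kx; rewrite /cell /= in_itv/= -natr1 mulrDl mul1r => /andP[kx xk].
      rewrite ger0_norm ?subr_ge0//; move: qr xk; lra.
    have dist m : (q <= m)%N -> `|interp m i (t, x) - a (i, (J, k)) m| <= 3 * r * H m t +
        (lam * (H m t + H m (s (m, J))) + lam ^- 3 * (C * (P m (j.+1%:R * tau) - P m (j%:R * tau)))).
      move=> qm.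
      apply: (@interpolant_sample_dist R n m B0 C E (@W m) (P m) C0 (WP m) i t
        (s (m, J)) r lam (j%:R * tau) (j.+1%:R * tau) x (k%:R * mesh R q)) => //.
        by apply: le_trans qr; exact: mesh_le.
      by have [] := sP (m, J).
    have dM := dist M qM; have dN := dist N qN.
    have eM := ltW (SM (i, (J, k))); have eN := ltW (SN (i, (J, k))).
    set fM := interp M i (t, x) in dM *; set fN := interp N i (t, x) in dN *.
    set aM := a _ M in dM eM; set aN := a _ N in dN eN; set ll := l _ in eM eN.
    have -> : fM - fN = (fM - aM) - (ll - aM) + (ll - aN) - (fN - aN) by ring.
    rewrite (le_trans (ler_normB _ _))// (le_trans (lerD (ler_normD _ _) (lexx _)))//.
    rewrite (le_trans (lerD (lerD (ler_normB _ _) (lexx _)) (lexx _)))//.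
    apply: le_trans (lerD (lerD (lerD dM eM) eN) dN) _.
    rewrite /al /be /=; lra.
  rewrite lStau lee_fin /be; have [_ /= sM] := sP (M, J); have [_ /= sN] := sP (N, J).
  move: sM sN; set pM := P M _ - _; set pN := P N _ - _.
  set hM := H M _; set hN := H N _ => sM sN.
  have : lam * (hM + hN) * tau = lam * (pM + pN) by rewrite -sM -sN; ring.
  by rewrite /al /al'; set L3 := lam ^- 3 * C; lra.
have main := cylinder_slabs tau0 slab.
apply: le_trans main _; rewrite pT lee_fin.
have al'0 : 0 <= al'.
  apply: addr_ge0; last by apply: mulr_ge0 => //; exact: ltW.
  by apply: addr_ge0; apply: mulr_ge0 => //; exact: ltW.
have PM := primitive_ub M (ltW T0); have PN := primitive_ub N (ltW T0).
have := ler_wpM2l al'0 PM; have := ler_wpM2l al'0 PN; rewrite -/kap => h1 h2.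
have e1 : 2 * eta * tau * p.+1%:R = eps / 4.
  by rewrite -mulrA [tau * _]mulrC pT /eta; field; rewrite gt_eqF.
have e2 : 3 * r * kap = eps / 8 by rewrite /r; field; rewrite gt_eqF.
have e3 : al' * kap = eps / 8 + 2 * (lam * kap) + lam ^- 3 * C * tau * kap.
  by rewrite -e2 /al'; ring.
rewrite e1; move: h1 h2 lamk pP; rewrite e3 -/tau mulrCA (mulrCA _ 8 kap).
set x := _ * tau * kap; set y := lam * kap; lra.
Qed.

End Compactness.

(** * The converging subsequence and its limit *)

Section Limit.
Variables (R : realType) (n : nat) (B0 C E : R).
Variables (W : forall m : nat, 'I_n -> R -> 'I_m.+1 -> R) (P : nat -> R -> R).
Hypothesis B00 : 0 <= B0.
Hypothesis C0 : 0 <= C.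
Hypothesis WP : forall m, controlled B0 C E (@W m) (P m).
Local Notation MR := (measurableTypeR R).
Local Notation mu := (@lebesgue_measure R).

Lemma cylinder_sub (S T : R) : S <= T -> cylinder S `<=` cylinder T.
Proof.
move=> ST [t x]; rewrite /cylinder /= !in_itv/= => -[/andP[t0 tS] Tx].
by split => //; rewrite t0 (le_trans tS).
Qed.

(** An ultrafilter finer than the Fréchet filter contains, for each [q], a set of indices whose
    interpolants are pairwise close on [[0, q + 1]]. A strictly increasing diagonal sequence meets
    the first [q.+1] of these sets at its [q]-th term. *)
Lemma convergent_subsequence : exists sigma : nat -> nat,
  {homo sigma : a b / (a < b)%N} /\
  forall q M N i, (q <= M)%N -> (q <= N)%N ->
    (\int[leb2 R]_(z in cylinder q.+1%:R)
       (`|interp W (sigma M) i z - interp W (sigma N) i z|)%:E <=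
     (2 / (2 ^ q.+1)%:R)%:E)%E.
Proof.
have [F [FU Foo]] := ultraFilterLemma eventually_filter.
have FP : ProperFilter F by exact: ultra_proper.
have FN N : F [set M | (N <= M)%N] by apply: Foo; exists N.
have /choice[S SP] : forall q : nat, exists S : set nat, F S /\ forall M N i, S M -> S N ->
    (\int[leb2 R]_(z in cylinder q.+1%:R)
       (`|interp W M i z - interp W N i z|)%:E <= (2 / (2 ^ q.+1)%:R)%:E)%E.
  move=> q; have [S FS SP] := @ultra_cauchy R n B0 C E W P B00 C0 WP F q.+1%:R
    (2 / (2 ^ q.+1)%:R) FU FN (ltr0Sn _ _) ltac:(by rewrite divr_gt0// ltr0n expn_gt0).
  by exists S.
have FI q : F [set M | forall j, (j <= q)%N -> S j M].
  elim: q => [|q IH].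
    by apply: filterS (SP 0%N).1 => M SM j; rewrite leqn0 => /eqP ->.
  apply: filterS (filterI IH (SP q.+1).1) => M [H1 H2] j.
  by rewrite leq_eqVlt ltnS => /predU1P[->|/H1].
have /choice[g gP] : forall x : nat * nat, exists M, (x.2 < M)%N /\
    forall j, (j <= x.1)%N -> S j M.
  move=> [q b] /=; have [M [M1 M2]] := filter_ex (filterI (FN b.+1) (FI q)).
  by exists M.
pose sigma := fix sigma q := if q is q'.+1 then g (q, sigma q') else g (0%N, 0%N).
have sS j q : (j <= q)%N -> S j (sigma q).
  by case: q => [|q]; [exact: (gP (0%N, 0%N)).2 | exact: (gP (q.+1, sigma q)).2].
exists sigma; split.
  apply: homo_ltn; first exact: ltn_trans.
  by move=> q; exact: (gP (q.+1, sigma q)).1.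
by move=> q M N i qM qN; apply: (SP q).2; exact: sS.
Qed.

Variable sigma : nat -> nat.
Hypothesis sigmaP : forall q M N i, (q <= M)%N -> (q <= N)%N ->
    (\int[leb2 R]_(z in cylinder q.+1%:R)
       (`|interp W (sigma M) i z - interp W (sigma N) i z|)%:E <=
     (2 / (2 ^ q.+1)%:R)%:E)%E.

Definition ulim (i : 'I_n) : MR * MR -> R := limfun (fun N => interp W (sigma N) i).

Lemma measurable_ulim i : measurable_fun setT (ulim i).
Proof. by apply: measurable_limfun => N; exact: (measurable_interp WP). Qed.

(** Shifting the sequence by [q] makes every cylinder in the hypothesis contain [cylinder T]. *)
Let le_cyl (T : R) q i M N : T <= q.+1%:R -> (M <= N)%N ->
  (\int[leb2 R]_(z in cylinder T)
     (`|interp W (sigma (N + q)) i z - interp W (sigma (M + q)) i z|)%:E <=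
  (2 / (2 ^ M.+1)%:R)%:E)%E.
Proof.
move=> Tq MN.
have mf k : measurable_fun setT (interp W k i) by exact: (measurable_interp WP).
apply: (@le_trans _ _ (\int[leb2 R]_(z in cylinder (M + q).+1%:R)
     (`|interp W (sigma (N + q)) i z - interp W (sigma (M + q)) i z|)%:E)%E).
  apply: ge0_subset_integral; rewrite //; try exact: measurable_cylinder.
    apply/measurable_EFinP/measurable_funTS; apply: measurableT_comp => //.
    exact: measurable_funB.
  by apply: cylinder_sub; rewrite (le_trans Tq)// ler_nat ltnS leq_addl.
apply: le_trans (sigmaP _ _ _) _; rewrite ?leq_add2r//.
rewrite lee_fin ler_pM2l// lef_pV2 ?posrE ?ltr0n ?expn_gt0//.
by rewrite ler_nat leq_exp2l// ltnS leq_addr.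
Qed.

Let ex_q (T : R) : exists q : nat, T <= q.+1%:R.
Proof.
exists (Num.bound `|T|); apply: le_trans (ler_norm _) _.
by apply: le_trans (ltW (archi_boundP (normr_ge0 _))) _; rewrite ler_nat.
Qed.

Lemma ulim_ae i (T : R) :
  {ae leb2 R, forall z, cylinder T z -> interp W (sigma N) i z @[N --> \oo] --> ulim i z}.
Proof.
have [q Tq] := ex_q T.
have := @cauchy_integral_ae_cvg _ _ R (leb2 R) (cylinder T) (@measurable_cylinder R T)
  (fun N => interp W (sigma (N + q)) i) (fun N => measurable_interp WP _ _).
move=> /(_ (fun M N MN => le_cyl i Tq MN)); apply: filterS => z /= + Tz => /(_ Tz).
move=> /cvg_ex[l fl]; apply: (@cvg_limfun _ _ _ (fun N => interp W (sigma N) i)).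
by apply/cvg_ex; exists l; rewrite -(cvg_shiftn q).
Qed.

Lemma ulim_L1 i (T eps : R) : 0 < eps -> exists N0, forall N, (N0 <= N)%N ->
  (\int[leb2 R]_(z in cylinder T)
    (`|ulim i z - interp W (sigma N) i z|)%:E <= eps%:E)%E.
Proof.
move=> eps0; have [q Tq] := ex_q T.
have [k kP] := ex_mesh_le eps0.
exists (k + q)%N => N kN.
have := @riesz_fischer_L1 _ _ R (leb2 R) (cylinder T) (@measurable_cylinder R T)
  (fun N => interp W (sigma (N + q)) i) (ulim i) (fun N => (2 / (2 ^ N.+1)%:R)%:E)
  (fun N => measurable_interp WP _ _) (measurable_ulim i).
have ae : {ae leb2 R, forall z, cylinder T z ->
   interp W (sigma (N + q)) i z @[N --> \oo] --> ulim i z}.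
  apply: filterS (ulim_ae i T) => z /= H Tz.
  by move: (H Tz); rewrite -(cvg_shiftn q).
move=> /(_ ae (fun M N MN => le_cyl i Tq MN) (N - q)%N).
rewrite subnK; last by rewrite (leq_trans _ kN)// leq_addl.
move=> /le_trans; apply; rewrite lee_fin; apply: le_trans kP.
rewrite /mesh expnS natrM invfM mulrA mulfV// mul1r lef_pV2 ?posrE ?ltr0n ?expn_gt0//.
rewrite ler_nat (@leq_trans (2 ^ k)%N)//; first exact: ltn_expl.
have qN : (q <= N)%N by rewrite (leq_trans _ kN)// leq_addl.
by rewrite leq_exp2l// leq_subRL// addnC.
Qed.

Lemma interp_L4 M i (T : R) : 0 < T ->
  (\int[leb2 R]_(z in cylinder T) (`|interp W M i z ^+ 4|)%:E <=
   (2 * B0 * cube_const B0 * (T + E))%:E)%E.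
Proof. exact: (interpolant_L4 B00 (WP M)). Qed.

Lemma ulim_L4 i (T : R) : 0 < T ->
  (\int[leb2 R]_(z in cylinder T) (`|ulim i z ^+ 4|)%:E <=
   (2 * B0 * cube_const B0 * (T + E))%:E)%E.
Proof.
move=> T0.
apply: (@fatou_bound _ _ R (leb2 R) (cylinder T) (@measurable_cylinder R T)
  (fun N z => `|interp W (sigma N) i z ^+ 4|) (fun z => ulim i z ^+ 4)).
- move=> N; apply: measurableT_comp => //; apply: measurable_funX.
  exact: (measurable_interp WP).
- by apply: measurable_funX; exact: measurable_ulim.
- by [].
- apply: filterS (ulim_ae i T) => z /= H Tz.
  have -> : ulim i z ^+ 4 = `|ulim i z ^+ 4| by rewrite ger0_norm// exprn_even_ge0.
  apply: cvg_norm; apply: (@cvg_comp _ _ _ _ (fun x : R => x ^+ 4) _ (nbhs (ulim i z))).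
    exact: H.
  exact: exprn_continuous.
- by move=> N; exact: interp_L4.
Qed.

End Limit.

(** * From L^1 convergence and L^4 bounds to L^p convergence *)

Section LpTools.
Context d (T : measurableType d) (R : realType).
Variables (mu : {measure set T -> \bar R}) (D : set T).
Hypothesis mD : measurable D.

Lemma Lnorm_patch (p : R) (f : T -> R) : 0 < p ->
  ('N[mu]_p%:E [EFin \o f \_ D] =
   (\int[mu]_(x in D) (`|f x| `^ p)%:E) `^ p^-1)%E.
Proof.
move=> p0; rewrite unlock; congr (_ `^ _)%E.
rewrite [RHS]integral_mkcond; apply: eq_integral => x _.
rewrite /patch /=; case: ifP => // _; last by rewrite normr0 powR0// gt_eqF.
Qed.

Lemma Lfun_patch (p : R) (f : T -> R) : 0 < p -> measurable_fun setT f ->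
  (\int[mu]_(x in D) (`|f x| `^ p)%:E < +oo)%E -> f \_ D \in Lfun mu p%:E.
Proof.
move=> p0 mf fin; apply/andP; split; rewrite inE.
  by apply/(measurable_restrictT _ _).1 => //; exact: measurable_funTS.
by rewrite /= /finite_norm Lnorm_patch//; exact: poweR_lty.
Qed.

(** Split at the level [k]: below it, the power [p - 1] of [x] is at most that of [k]; above it, the
    same holds for the negative power [p - 4]. *)
Lemma powR_interpolate (p k x : R) : 1 <= p -> p < 4 -> 1 <= k -> 0 <= x ->
  x `^ p <= k `^ (p - 1) * x + k `^ (p - 4) * x ^+ 4.
Proof.
move=> p1 p4 k1 x0; have k0 : 0 < k := lt_le_trans ltr01 k1.
have t1 : 0 <= k `^ (p - 1) * x by rewrite mulr_ge0 ?powR_ge0.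
have t2 : 0 <= k `^ (p - 4) * x ^+ 4 by rewrite mulr_ge0 ?powR_ge0 ?exprn_ge0.
have [xk|kx] := leP x k.
  apply: (@le_trans _ _ (k `^ (p - 1) * x)); last by rewrite lerDl.
  rewrite -mulr_powRB1//; last exact: lt_le_trans p1.
  rewrite mulrC ler_wpM2r//; apply: ge0_ler_powR; rewrite ?nnegrE ?subr_ge0//.
  exact: ltW.
apply: (@le_trans _ _ (k `^ (p - 4) * x ^+ 4)); last by rewrite lerDr.
have xp : 0 < x := lt_trans k0 kx.
have -> : x `^ p = x `^ (p - 4) * x ^+ 4.
  have xn : x != 0 by rewrite gt_eqF.
  by rewrite -powR_mulrn// -powRD ?xn ?implybT// subrK.
rewrite ler_wpM2r ?exprn_ge0// -[p - 4]opprB !powRN lef_pV2 ?posrE ?powR_gt0//.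
by apply: ge0_ler_powR; rewrite ?nnegrE ?subr_ge0// ltW.
Qed.

Lemma cvg_ge0_ereal (u : nat -> \bar R) : (forall n, 0 <= u n)%E ->
  (forall e : R, 0 < e -> exists N, forall n, (N <= n)%N -> (u n <= e%:E)%E) ->
  u @ \oo --> 0%E.
Proof.
move=> u0 ue; apply/fine_cvgP; split.
  have [N NP] := ue 1 ltr01; exists N => // n /= Nn.
  by rewrite ge0_fin_numE// (le_lt_trans (NP n Nn))// ltry.
apply/cvgrPdist_le => e e0; have [N NP] := ue e e0; exists N => // n /= Nn.
rewrite sub0r normrN ger0_norm ?fine_ge0// -lee_fin fineK ?NP//.
by rewrite ge0_fin_numE// (le_lt_trans (NP n Nn))// ltry.
Qed.

Lemma Lnorm_interpolation_cvg (p K : R) (g : nat -> T -> R) : 1 <= p -> p < 4 ->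
  (forall n, measurable_fun setT (g n)) ->
  (forall n, \int[mu]_(x in D) (`|g n x| ^+ 4)%:E <= K%:E)%E ->
  (forall e : R, 0 < e -> exists N, forall n, (N <= n)%N ->
     (\int[mu]_(x in D) (`|g n x|)%:E <= e%:E)%E) ->
  ('N[mu]_p%:E [EFin \o g n \_ D])%E @[n --> \oo] --> 0%E.
Proof.
move=> p1 p4 mg gK g1; have p0 : 0 < p := lt_le_trans ltr01 p1.
have K0 : 0 <= K.
  by rewrite -lee_fin; apply: le_trans (gK 0%N); apply: integral_ge0 => x _; rewrite lee_fin exprn_ge0.
apply: cvg_ge0_ereal => [n|e e0]; first exact: Lnorm_ge0.
have ep0 : 0 < e `^ p by exact: powR_gt0.
(* This level makes the L^4 part at most half of the target; the L^1 part then becomes small far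
   along the sequence. The added [1] ensures [k >= 1]. *)
pose k := (2 * K / e `^ p + 1) `^ (4 - p)^-1.
have base1 : 1 <= 2 * K / e `^ p + 1 by rewrite lerDr divr_ge0 ?mulr_ge0// ltW.
have k1 : 1 <= k.
  apply: (@le_trans _ _ (1 `^ (4 - p)^-1)); first by rewrite powR1.
  apply: ge0_ler_powR; rewrite ?nnegrE ?invr_ge0 ?subr_ge0 ?(ltW p4)//.
  exact: le_trans base1.
have kp : k `^ (p - 4) * K <= e `^ p / 2.
  rewrite /k -[p - 4]opprB powRN -powRrM mulVf ?powRr1 ?(le_trans ler01 base1)//; last first.
    by rewrite subr_eq0 gt_eqF.
  rewrite mulrC ler_pdivrMr ?(lt_le_trans ltr01 base1)//.
  have -> : e `^ p / 2 * (2 * K / e `^ p + 1) = K + e `^ p / 2 by field; rewrite gt_eqF.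
  by rewrite lerDl divr_ge0// ltW.
have c0 : 0 < k `^ (p - 1) by rewrite powR_gt0// (lt_le_trans ltr01).
have [N NP] := g1 (e `^ p / 2 / k `^ (p - 1)) (divr_gt0 (divr_gt0 ep0 (ltr0Sn _ 1)) c0).
exists N => n Nn; rewrite Lnorm_patch//.
have mn : measurable_fun setT (fun x => `|g n x|) by exact: measurableT_comp.
have -> : e%:E = ((e `^ p)%:E `^ p^-1)%E.
  by rewrite poweR_EFin -powRrM mulfV ?gt_eqF// powRr1// ltW.
apply: gt0_ler_poweR; rewrite ?invr_ge0 ?(ltW p0)//.
- by rewrite in_itv/= leey andbT; apply: integral_ge0 => x _; rewrite lee_fin powR_ge0.
- by rewrite in_itv/= leey andbT lee_fin ltW.
apply: (@le_trans _ _ (\int[mu]_(x in D) ((k `^ (p - 1))%:E * (`|g n x|)%:E +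
   (k `^ (p - 4))%:E * (`|g n x| ^+ 4)%:E))%E).
  apply: (ge0_le_integral mu mD).
  - by move=> x _; rewrite lee_fin powR_ge0.
  - apply/measurable_EFinP/measurable_funTS.
    exact: (measurableT_comp (measurable_powR _) mn).
  - apply/measurable_funTS; apply: emeasurable_funD; apply/measurable_EFinP;
      apply: measurable_funM => //.
    exact: measurable_funX.
  - by move=> x _; rewrite -!EFinM -EFinD lee_fin powR_interpolate.
have m1 : measurable_fun D (fun x => (`|g n x|)%:E).
  exact/measurable_EFinP/measurable_funTS.
have m4 : measurable_fun D (fun x => (`|g n x| ^+ 4)%:E).
  by apply/measurable_EFinP/measurable_funTS; exact: measurable_funX.
rewrite ge0_integralD//; first last.
- exact: emeasurable_funM.
- by move=> x _; rewrite mule_ge0 ?lee_fin ?powR_ge0 ?exprn_ge0.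
- exact: emeasurable_funM.
- by move=> x _; rewrite mule_ge0 ?lee_fin ?powR_ge0.
rewrite !ge0_integralZl ?lee_fin ?powR_ge0//.
rewrite [X in (_ <= X%:E)%E](_ : _ = e `^ p / 2 + e `^ p / 2); last by rewrite -splitr.
rewrite EFinD; apply: leeD.
  apply: (@le_trans _ _ ((k `^ (p - 1))%:E * (e `^ p / 2 / k `^ (p - 1))%:E)%E).
    by rewrite lee_pmul2l//; exact: NP.
  by rewrite -EFinM lee_fin mulrC divfK// gt_eqF.
apply: (@le_trans _ _ ((k `^ (p - 4))%:E * K%:E)%E); last by rewrite -EFinM lee_fin.
by apply: lee_wpmul2l => //; rewrite lee_fin powR_ge0.
Qed.

End LpTools.

(** * Weak derivative of an interpolant *)

Section WeakDerivative.
Variable R : realType.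
Local Notation MR := (measurableTypeR R).
Local Notation mu := (@lebesgue_measure R).

Lemma torus_bounded_integrable (f : MR -> R) (b : R) : measurable_fun setT f ->
  (forall x, torus x -> `|f x| <= b) -> mu.-integrable (@torus R) (EFin \o f).
Proof.
move=> mf fb; apply: measurable_bounded_integrable.
- exact: measurable_torus.
- by rewrite [X in (X < _)%E]measure_torus ltry.
- exact: measurable_funTS.
- exists b; split; first exact: num_real.
  by move=> c bc x Tx; apply: le_trans (fb x Tx) (ltW bc).
Qed.

Lemma continuous_bounded01 (f : R -> R) : continuous f ->
  exists2 b, 0 <= b & forall x, torus x -> `|f x| <= b.
Proof.
move=> fc; have [||c _ cP] := @EVT_max R (fun x => `|f x|) 0 1.
- exact: ler01.
- by apply: continuous_subspaceT => x; apply: cvg_norm; exact: fc.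
exists `|f c| => // x; rewrite /torus /= in_itv/= => /andP[x0 x1].
by apply: cP; rewrite in_itv/= x0 ltW.
Qed.

Lemma torus_integral_cells m (f : R -> R) : measurable_fun setT (f : MR -> R) ->
  (\int[mu]_(x in @torus R) (f x)%:E = \sum_(k < m.+1) \int[mu]_(x in cell k) (f x)%:E)%E.
Proof.
move=> mf.
have TE : @torus R = \big[setU/set0]_(k < m.+1) cell k.
  apply/seteqP; split=> x.
    move=> Tx; have [k kx] := torus_cell m Tx.
    by rewrite -bigcup_seq; exists k => //=; exact: mem_index_enum.
  by rewrite -bigcup_seq => -[k _ kx]; exact: (@cell_sub_torus R m k).
rewrite TE; apply: integral_bigsetU_EFin.
- by move=> k; exact: measurable_cell.
- exact: index_enum_uniq.
- move=> k l _ _ [x [kx lx]].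
  have := stepf_cell (fun j : 'I_m.+1 => (j : nat)%:R) kx.
  rewrite (stepf_cell _ lx) => /eqP; rewrite eqr_nat => /eqP kl.
  exact/val_inj.
- by apply/measurable_EFinP; exact: measurable_funTS.
Qed.

Lemma derivable_continuous1 (f : R -> R) : (forall x, derivable f x 1) -> continuous f.
Proof. by move=> fd x; apply: differentiable_continuous; exact/derivable1_diffP. Qed.

Lemma test_torus_continuous (psi : R -> R) : test_torus psi ->
  [/\ periodic psi 1, continuous psi, continuous psi^`()%classic &
      forall x : R, is_derive x 1 psi (psi^`()%classic x)].
Proof.
move=> [pper pd]; have d0 := pd 0%N; have d1 := pd 1%N.
split; [exact: pper | exact: derivable_continuous1 d0 | exact: derivable_continuous1 d1 |].
by move=> x; rewrite derive1E; exact: derivableP (d0 x).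
Qed.

Lemma interpolant_bounded m (w : 'I_m.+1 -> R) x : torus x ->
  `|interpolant w x| <= \sum_k `|w k|.
Proof.
move=> Tx; have H k : - (\sum_k `|w k|) <= w k <= \sum_k `|w k|.
  by rewrite -ler_norml (bigD1 k)//= lerDl sumr_ge0.
by rewrite ler_norml; exact: interpolant_itv.
Qed.

Lemma stepf_bounded m (w : 'I_m.+1 -> R) x : torus x -> `|stepf w x| <= \sum_k `|w k|.
Proof.
move=> /(@torus_cell R m)[k kx]; rewrite (stepf_cell _ kx).
by rewrite (bigD1 k)//= lerDl sumr_ge0.
Qed.

(** On the cell the interpolant is an affine function [L], so the integrand is the derivative of
    [L * psi] and only the end values remain. *)
Lemma cell_integration_by_parts m (w : 'I_m.+1 -> R) (psi : R -> R) k : test_torus psi ->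
  (\int[mu]_(x in cell k) (interpolant w x * psi^`()%classic x +
     stepf (fun k => delta w k / mesh R m) x * psi x)%:E =
   (w (ordS k) * psi (k.+1%:R * mesh R m) - w k * psi (k%:R * mesh R m))%:E)%E.
Proof.
move=> /test_torus_continuous[pper pc p'c pd].
have h0 := mesh_gt0 R m; set h := mesh R m.
set a := k%:R * h; set b := k.+1%:R * h; set s := delta w k / h.
pose L (x : R) := w k + (x - a) * s.
have ab : a < b by rewrite ltr_pM2r// ltr_nat.
have Ld (x : R) : is_derive x 1 L s.
  have d1 := is_deriveM (is_deriveB (is_derive_id x 1) (is_derive_cst a x 1)) (is_derive_cst s x 1).
  have := is_deriveD (is_derive_cst (w k) x 1) d1.
  rewrite /GRing.scale /= mulr0 subr0 mulr1 !add0r; exact.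
have Lc : continuous L.
  by apply: derivable_continuous1 => x; have [] := Ld x.
transitivity (\int[mu]_(x in cell k) (L x * psi^`()%classic x + s * psi x)%:E)%E.
  apply: eq_integral => x /set_mem kx; rewrite (stepf_cell _ kx) (interpolant_cell w kx).
  congr (((_ + _) * _ + _)%:E); rewrite /s /a -/h.
  by rewrite [RHS]mulrA mulrAC; congr (_ * _); rewrite mulrBl mulfK ?gt_eqF.
have Fc : continuous (fun x => L x * psi^`()%classic x + s * psi x).
  move=> x; apply: cvgD; first by apply: cvgM; [exact: Lc | exact: p'c].
  by apply: cvgM; [exact: cvg_cst | exact: pc].
have Gd (x : R) : is_derive x 1 (fun x => L x * psi x) (L x * psi^`()%classic x + s * psi x).
  have := is_deriveM (Ld x) (pd x).
  by rewrite /GRing.scale /= [psi x * s]mulrC.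
have Gc : continuous (fun x => L x * psi x).
  by apply: derivable_continuous1 => x; have [] := Gd x.
rewrite /cell integral_itv_bndo_bndc; last first.
  by apply/measurable_EFinP/measurable_funTS; exact: continuous_measurable_fun.
rewrite (@continuous_FTC2 _ _ (fun x => L x * psi x))//.
- rewrite -EFinB /L subrr mul0r addr0; congr (((_ * _) - _)%:E).
  have -> : b - a = h by rewrite /b /a -natr1; ring.
  by rewrite /s mulrC divfK ?gt_eqF// /delta addrC subrK.
- exact: continuous_subspaceT.
- split; last 2 first.
  + by apply: cvg_at_right_filter; exact: Gc.
  + by apply: cvg_at_left_filter; exact: Gc.
  by move=> x _; have [] := Gd x.
- by move=> x _; rewrite derive1E; have [_ ->] := Gd x.
Qed.

(** Summed over the cells, the boundary terms cancel after a cyclic shift of the index; in the last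
    cell this uses the periodicity of [psi]. *)
Lemma interpolant_weak_derivative m (w : 'I_m.+1 -> R) :
  measurable_fun setT (interpolant w : MR -> R) ->
  weak_derivative (interpolant w) (stepf (fun k => delta w k / mesh R m)).
Proof.
move=> mw psi psiT; have [pper pc p'c _] := test_torus_continuous psiT.
have [b b0 pb] := continuous_bounded01 pc; have [c c0 p'b] := continuous_bounded01 p'c.
set s := fun k : 'I_m.+1 => delta w k / mesh R m.
have mp := continuous_measurable_fun pc; have mp' := continuous_measurable_fun p'c.
have i1 : mu.-integrable (@torus R) (EFin \o (fun x => interpolant w x * psi^`()%classic x)).
  apply: (@torus_bounded_integrable _ ((\sum_k `|w k|) * c)).
    exact: measurable_funM.
  by move=> x Tx; rewrite normrM ler_pM//; [exact: interpolant_bounded | exact: p'b].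
have i2 : mu.-integrable (@torus R) (EFin \o (fun x => stepf s x * psi x)).
  apply: (@torus_bounded_integrable _ ((\sum_k `|s k|) * b)).
    by apply: measurable_funM => //; exact: measurable_stepf.
  by move=> x Tx; rewrite normrM ler_pM//; [exact: stepf_bounded | exact: pb].
apply/eqP; rewrite -addr_eq0 -RintegralD//; last exact: measurable_torus.
rewrite /Rintegral (@torus_integral_cells m); last first.
  apply: measurable_funD; apply: measurable_funM => //.
  exact: measurable_stepf.
under eq_bigr do rewrite cell_integration_by_parts//.
rewrite sumEFin /= sumrB subr_eq0.
rewrite -(sum_ordS (fun k : 'I_m.+1 => w k * psi (k%:R * mesh R m))); apply/eqP.
apply: eq_bigr => k _; congr (_ * _).
have [km|mk] := ltnP k m; first by rewrite /= modn_small.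
have kE : k.+1 = m.+1 by apply/eqP; rewrite eqn_leq ltn_ord ltnS mk.
by rewrite /= kE modnn mul0r mesh1 -[1]add0r pper.
Qed.

End WeakDerivative.

(** Here [z] is bounded and [y] is integrable because [y - z] is. This passes to the limit in
    integrals over one time slice. *)
Lemma torus_weighted_dist (R : realType) (y z phi : R -> R) (a b e : R) :
  measurable_fun setT (y : measurableTypeR R -> R) ->
  measurable_fun setT (z : measurableTypeR R -> R) ->
  measurable_fun setT (phi : measurableTypeR R -> R) ->
  (forall x : R, torus x -> `|phi x| <= a) ->
  (forall x : R, torus x -> `|z x| <= b) ->
  (\int[@lebesgue_measure R]_(x in @torus R) (`|y x - z x|)%:E <= e%:E)%E ->
  `|\int[@lebesgue_measure R]_(x in @torus R) (y x * phi x) -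
    \int[@lebesgue_measure R]_(x in @torus R) (z x * phi x)| <= a * e.
Proof.
move=> my mz mphi pa zb Ie; set mu := @lebesgue_measure R.
have mT := @measurable_torus R.
have T0 : @torus R 0 by rewrite /torus/= in_itv/= lexx ltr01.
have a0 : 0 <= a := le_trans (normr_ge0 _) (pa _ T0).
have id : mu.-integrable (@torus R) (EFin \o (fun x => y x - z x)).
  apply/integrableP; split.
    by apply/measurable_EFinP/measurable_funTS; exact: measurable_funB.
  by apply: le_lt_trans Ie _; exact: ltry.
have iz := torus_bounded_integrable mz zb.
have iy : mu.-integrable (@torus R) (EFin \o y).
  have := integrableD mT id iz; apply: eq_integrable => // x _ /=.
  by rewrite -EFinD subrK.
have ip (h : R -> R) : measurable_fun setT (h : measurableTypeR R -> R) ->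
    mu.-integrable (@torus R) (EFin \o h) ->
    mu.-integrable (@torus R) (EFin \o (fun x => h x * phi x)).
  move=> mh ih; apply: (le_integrable mT (g := fun x => (a%:E * (EFin \o h) x)%E)).
  - by apply/measurable_EFinP/measurable_funTS; exact: measurable_funM.
  - move=> x Tx /=; rewrite lee_fin normrM mulrC normrM (ger0_norm a0).
    by rewrite ler_wpM2r//; exact: pa.
  - exact: integrableZl.
have ipd := integrableB mT (ip _ my iy) (ip _ mz iz).
rewrite -RintegralB//; [|exact: ip|exact: ip].
rewrite -lee_fin EFin_normr_Rintegral//.
apply: le_trans (le_abse_integral mu mT (measurable_int _ ipd)) _.
rewrite EFinM; apply: le_trans (lee_wpmul2l _ Ie); last by rewrite lee_fin.
have mn : measurable_fun (@torus R) (fun x => (`|y x - z x|)%:E).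
  by apply/measurable_EFinP/measurable_funTS; apply: measurableT_comp => //; exact: measurable_funB.
rewrite -ge0_integralZl//.
apply: ge0_le_integral => //.
- by apply: measurableT_comp => //; exact: measurable_int ipd.
- exact: emeasurable_funM.
- move=> x Tx /=; rewrite -EFinM lee_fin -mulrBl normrM mulrC.
  by rewrite ler_wpM2r//; exact: pa.
Qed.

(** * Mazur's argument for the weak gradient *)

Section Mazur.
Variables (R : realType) (T K : R).
Hypothesis T0 : 0 < T.
Local Notation MR := (measurableTypeR R).
Local Notation mu := (@lebesgue_measure R).
Local Notation D := (cylinder T).
Variables (f g : nat -> MR * MR -> R) (u : MR * MR -> R).
Hypothesis mf : forall k, measurable_fun setT (f k).
Hypothesis mg : forall k, measurable_fun setT (g k).
Hypothesis mu_ : measurable_fun setT u.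
Hypothesis fg_bounded : forall k (t : R), exists b, forall x : R, torus x ->
  `|f k (t, x)| <= b /\ `|g k (t, x)| <= b.
Hypothesis fg_weak : forall k t, weak_derivative (fun x => f k (t, x)) (fun x => g k (t, x)).
Hypothesis g_L2 : forall k, (\int[leb2 R]_(z in D) (g k z ^+ 2)%:E <= K%:E)%E.
Hypothesis f_L1 : forall e : R, 0 < e -> exists N, forall k, (N <= k)%N ->
  (\int[leb2 R]_(z in D) (`|u z - f k z|)%:E <= e%:E)%E.

Let mD : measurable D. Proof. exact: measurable_cylinder. Qed.

(** Functions paired with their gradients, generated by the tail [k >= N] under midpoints. Midpoints
    are the convex combinations that the parallelogram law calls for. *)
Inductive hull (N : nat) : (MR * MR -> R) -> (MR * MR -> R) -> Prop :=
| hull_gen k : (N <= k)%N -> hull N (f k) (g k)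
| hull_mid w v w' v' : hull N w v -> hull N w' v' ->
    hull N (fun z => (w z + w' z) / 2) (fun z => (v z + v' z) / 2).

Lemma hullS N N' w v : (N <= N')%N -> hull N' w v -> hull N w v.
Proof.
move=> NN'; elim=> [k kN'|w1 v1 w2 v2 _ h1 _ h2]; last exact: hull_mid.
by apply: hull_gen; exact: leq_trans kN'.
Qed.

Lemma hull_measurable N w v : hull N w v ->
  measurable_fun setT w /\ measurable_fun setT v.
Proof.
elim=> [k _|w1 v1 w2 v2 _ [mw1 mv1] _ [mw2 mv2]]; first by split.
by split; apply: measurable_funM => //; exact: measurable_funD.
Qed.

Lemma hull_bounded N w v (t : R) : hull N w v -> exists b, forall x : R, torus x ->
  `|w (t, x)| <= b /\ `|v (t, x)| <= b.
Proof.
elim=> [k _|w1 v1 w2 v2 _ [b1 H1] _ [b2 H2]]; first exact: fg_bounded.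
exists ((b1 + b2) / 2) => x Tx; have [h1 h2] := H1 x Tx; have [h3 h4] := H2 x Tx.
have n2 : `|2^-1 : R| = 2^-1 by rewrite ger0_norm ?invr_ge0.
rewrite !normrM n2; split; rewrite ler_pM2r//.
  by rewrite (le_trans (ler_normD _ _))// lerD.
by rewrite (le_trans (ler_normD _ _))// lerD.
Qed.

Let slice_integrable (w : MR * MR -> R) (t : R) (psi : R -> R) b :
  measurable_fun setT w -> continuous psi ->
  (forall x : R, torus x -> `|w (t, x)| <= b) ->
  mu.-integrable (@torus R) (EFin \o (fun x => w (t, x) * psi x)).
Proof.
move=> mw pc wb; have [c c0 pb] := continuous_bounded01 pc.
apply: (@torus_bounded_integrable _ _ (b * c)).
  apply: measurable_funM; first exact: measurable_slice.
  exact: continuous_measurable_fun.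
by move=> x Tx; rewrite normrM ler_pM//; [exact: wb | exact: pb].
Qed.

Lemma hull_weak N w v t : hull N w v ->
  weak_derivative (fun x => w (t, x)) (fun x => v (t, x)).
Proof.
elim=> [k _|w1 v1 w2 v2 h1 IH1 h2 IH2]; first exact: fg_weak.
move=> psi psiT; have [_ pc p'c _] := test_torus_continuous psiT.
have mT := @measurable_torus R.
have [mw1 mv1] := hull_measurable h1; have [mw2 mv2] := hull_measurable h2.
have [b1 B1] := hull_bounded t h1; have [b2 B2] := hull_bounded t h2.
have split_ (z1 z2 : MR * MR -> R) (phi : R -> R) : measurable_fun setT z1 ->
    measurable_fun setT z2 -> continuous phi ->
    (forall x : R, torus x -> `|z1 (t, x)| <= b1) ->
    (forall x : R, torus x -> `|z2 (t, x)| <= b2) ->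
    \int[mu]_(x in @torus R) ((z1 (t, x) + z2 (t, x)) / 2 * phi x) =
    (\int[mu]_(x in @torus R) (z1 (t, x) * phi x) +
     \int[mu]_(x in @torus R) (z2 (t, x) * phi x)) / 2.
  move=> m1 m2 phic H1 H2.
  have i1 := slice_integrable m1 phic H1; have i2 := slice_integrable m2 phic H2.
  rewrite -RintegralD// -RintegralZr//; last first.
    by have := integrableD mT i1 i2.
  by apply: eq_Rintegral => x _; ring.
rewrite !split_ => [||||||||||]; try by [].
- by rewrite IH1// IH2// -opprD mulNr.
- by move=> x /B1[].
- by move=> x /B2[].
- by move=> x /B1[].
- by move=> x /B2[].
Qed.

Let Q (v : MR * MR -> R) : \bar R := (\int[leb2 R]_(z in D) (v z ^+ 2)%:E)%E.

Let mE (v : MR * MR -> R) : measurable_fun setT v ->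
  measurable_fun D (fun z => (v z)%:E).
Proof. by move=> mv; apply/measurable_EFinP; exact: measurable_funTS. Qed.

(** The half difference and the half sum have squared norms adding up to the average of those of [v]
    and [w]; a lower bound for the midpoint is an upper bound for the difference. *)
Lemma parallelogram v w (a b : R) : measurable_fun setT v -> measurable_fun setT w ->
  (Q v <= a%:E)%E -> (Q w <= a%:E)%E ->
  (b%:E <= Q (fun z => ((v z + w z) / 2)%R))%E ->
  (Q (fun z => ((v z - w z) / 2)%R) <= (a - b)%:E)%E.
Proof.
move=> mv mw va wa bm.
have sq0 (x : R) : (0 <= (x ^+ 2)%:E)%E by rewrite lee_fin sqr_ge0.
have mS : measurable_fun setT (fun z => ((v z + w z) / 2) ^+ 2).
  by apply: measurable_funX; apply: measurable_funM => //; exact: measurable_funD.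
have mB : measurable_fun setT (fun z => ((v z - w z) / 2) ^+ 2).
  by apply: measurable_funX; apply: measurable_funM => //; exact: measurable_funB.
rewrite EFinB leeBrDr//; apply: le_trans (leeD2l _ bm) _.
rewrite -ge0_integralD//; try by [exact: mE].
rewrite (eq_integral (fun z => (2^-1)%:E * (v z ^+ 2)%:E + (2^-1)%:E * (w z ^+ 2)%:E)%E); last first.
  by move=> z _; rewrite -!EFinM -!EFinD; congr (_%:E); field.
have mv2 := measurable_funX 2 mv; have mw2 := measurable_funX 2 mw.
rewrite ge0_integralD//; first last.
- by apply: emeasurable_funM => //; exact: mE.
- by move=> z _; rewrite mule_ge0// lee_fin invr_ge0.
- by apply: emeasurable_funM => //; exact: mE.
- by move=> z _; rewrite mule_ge0// lee_fin invr_ge0.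
rewrite !ge0_integralZl ?lee_fin ?invr_ge0//; try exact: mE.
have -> : a%:E = ((2^-1)%:E * a%:E + (2^-1)%:E * a%:E)%E.
  by rewrite -!EFinM -EFinD; congr (_%:E); field.
by apply: leeD; apply: lee_wpmul2l; rewrite ?lee_fin ?invr_ge0.
Qed.

Lemma measure_cylinder : leb2 R D = T%:E.
Proof.
pose I : set MR := [set` `[0, T]].
have mI : mu I = T%:E.
  by rewrite lebesgue_measure_itv/= lte_fin T0 sube0.
transitivity (mu I * mu (@torus R))%E; last by rewrite mI measure_torus mule1.
by apply: (@product_measure1E _ _ _ _ R mu mu); [exact: measurable_itv | exact: measurable_torus].
Qed.

Lemma L1_of_L2 (v w : MR * MR -> R) (de : R) : 0 < de -> measurable_fun setT v -> measurable_fun setT w ->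
  (Q (fun z => ((v z - w z) / 2)%R) <= (2 * (de ^+ 2 / (32 * (T + 1))))%:E)%E ->
  (\int[leb2 R]_(z in D) (`|v z - w z|)%:E <= de%:E)%E.
Proof.
move=> de0 mv mw; have T10 : 0 < T + 1 by rewrite ltr_wpDr.
(* Young's inequality [x <= a + x ^+ 2 / a] is integrated over a cylinder of measure [T]; with this
   [a] both terms contribute at most [de / 2]. *)
set a := de / (2 * (T + 1)); have a0 : 0 < a by rewrite divr_gt0// mulr_gt0.
have mB : measurable_fun setT (fun z => ((v z - w z) / 2) ^+ 2).
  by apply: measurable_funX; apply: measurable_funM => //; exact: measurable_funB.
move=> Qle.
apply: (@le_trans _ _ (\int[leb2 R]_(z in D) (a%:E + (4 / a)%:E * (((v z - w z) / 2) ^+ 2)%:E))%E).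
  apply: (ge0_le_integral (leb2 R) mD).
  - by move=> z _; rewrite lee_fin.
  - by apply: mE; apply: measurableT_comp => //; exact: measurable_funB.
  - apply: emeasurable_funD => //; apply: emeasurable_funM => //; exact: mE.
  - move=> z _; rewrite -EFinM -EFinD lee_fin.
    have n2 : `|2^-1 : R| = 2^-1 by rewrite ger0_norm ?invr_ge0.
    rewrite -(real_normK (num_real ((v z - w z) / 2))) normrM n2.
    set x := `|_|; have x0 : 0 <= x by exact: normr_ge0.
    have -> : a + 4 / a * (x / 2) ^+ 2 = (x - a) ^+ 2 / a + 2 * x by field; rewrite gt_eqF.
    have : 0 <= (x - a) ^+ 2 / a by rewrite divr_ge0 ?sqr_ge0// ltW.
    by set y := _ / a; lra.
have da0 : 0 <= 4 / a by rewrite divr_ge0// ltW.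
rewrite ge0_integralD//; first last.
- by apply: emeasurable_funM => //; exact: mE.
- by move=> z _; rewrite mule_ge0// lee_fin ?sqr_ge0.
- by move=> z _; rewrite lee_fin ltW.
rewrite integral_cst// measure_cylinder ge0_integralZl ?lee_fin//; first last.
- by move=> z _; rewrite lee_fin sqr_ge0.
- exact: mE.
apply: le_trans (leeD (lexx _) (lee_wpmul2l _ Qle)) _; first by rewrite lee_fin.
rewrite -!EFinM -EFinD lee_fin.
have -> : a * T + 4 / a * (2 * (de ^+ 2 / (32 * (T + 1)))) = de / 2 * (T / (T + 1)) + de / 2.
  by rewrite /a; field; rewrite !gt_eqF.
have : T / (T + 1) <= 1 by rewrite ler_pdivrMr// mul1r lerDl.
by rewrite -(ler_pM2l (divr_gt0 de0 (ltr0Sn R 1))); lra.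
Qed.

Lemma hull_L2 N w v : hull N w v -> (Q v <= K%:E)%E.
Proof.
elim=> [k _|w1 v1 w2 v2 h1 IH1 h2 IH2]; first exact: g_L2.
have [_ mv1] := hull_measurable h1; have [_ mv2] := hull_measurable h2.
have mNv2 : measurable_fun setT (fun z => - v2 z).
  exact: measurable_funN mv2.
have := @parallelogram v1 (fun z => - v2 z) K 0 mv1 mNv2 IH1.
rewrite subr0.
have -> : Q (fun z => ((v1 z + v2 z) / 2)%R) = Q (fun z => ((v1 z - - v2 z) / 2)%R).
  by apply: eq_integral => z _; rewrite opprK.
apply.
  rewrite (_ : Q _ = Q v2)//; apply: eq_integral => z _; by rewrite sqrrN.
by apply: integral_ge0 => z _; rewrite lee_fin sqr_ge0.
Qed.

Lemma hull_L1 N w v (e : R) : (forall k, (N <= k)%N ->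
    (\int[leb2 R]_(z in D) (`|u z - f k z|)%:E <= e%:E)%E) -> hull N w v ->
  (\int[leb2 R]_(z in D) (`|u z - w z|)%:E <= e%:E)%E.
Proof.
move=> He; elim=> [k kN|w1 v1 w2 v2 h1 IH1 h2 IH2]; first exact: He.
have [mw1 _] := hull_measurable h1; have [mw2 _] := hull_measurable h2.
have n2 : `|2^-1 : R| = 2^-1 by rewrite ger0_norm ?invr_ge0.
have md (w' : MR * MR -> R) : measurable_fun setT w' ->
    measurable_fun setT (fun z => `|u z - w' z|).
  by move=> mw; apply: measurableT_comp => //; exact: measurable_funB.
apply: (@le_trans _ _ (\int[leb2 R]_(z in D) ((2^-1)%:E * (`|u z - w1 z|)%:E +
   (2^-1)%:E * (`|u z - w2 z|)%:E))%E).
  apply: (ge0_le_integral (leb2 R) mD).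
  - by move=> z _; rewrite lee_fin.
  - by apply: mE; apply: md; apply: measurable_funM => //; exact: measurable_funD.
  - by apply: emeasurable_funD; apply: emeasurable_funM => //; apply: mE; exact: md.
  - move=> z _; rewrite -!EFinM -EFinD lee_fin -mulrDr.
    have -> : u z - (w1 z + w2 z) / 2 = 2^-1 * ((u z - w1 z) + (u z - w2 z)) by field.
    by rewrite normrM n2 ler_pM2l// ler_normD.
rewrite ge0_integralD//; first last.
- by apply: emeasurable_funM => //; apply: mE; exact: md.
- by apply: emeasurable_funM => //; apply: mE; exact: md.
rewrite !ge0_integralZl ?lee_fin ?invr_ge0//; try by [apply: mE; exact: md].
have -> : e%:E = ((2^-1)%:E * e%:E + (2^-1)%:E * e%:E)%E.
  by rewrite -!EFinM -EFinD; congr (_%:E); field.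
by apply: leeD; apply: lee_wpmul2l; rewrite ?lee_fin ?invr_ge0.
Qed.

(** [d] is the supremum over [N] of the infimum of the squared norm on the hull of the [N]-th tail.
    These infima increase with [N] and stay below [K], so far enough out the infimum is within [eta]
    of [d]. *)
Lemma hull_approx : exists d : R, forall (eta : R) N0, 0 < eta -> exists N w v,
  [/\ (N0 <= N)%N, hull N w v, (Q v <= (d + eta)%:E)%E &
    forall w' v', hull N w' v' -> ((d - eta)%:E <= Q v')%E].
Proof.
pose S N := [set q | exists w v, hull N w v /\ q = Q v].
pose dE N := ereal_inf (S N).
have Q0 v : (0 <= Q v)%E by apply: integral_ge0 => z _; rewrite lee_fin sqr_ge0.
have dE0 N : (0 <= dE N)%E by apply: le_ereal_inf_tmp => _ [w [v [_ ->]]].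
have dEK N : (dE N <= K%:E)%E.
  apply: (@le_trans _ _ (Q (g N))); last exact: g_L2.
  by apply: ereal_inf_lbound; exists (f N), (g N); split => //; exact: hull_gen.
pose s := ereal_sup (range dE).
have s_fin : s \is a fin_num.
  rewrite ge0_fin_numE; last by apply: le_trans (dE0 0%N) _; apply: ereal_sup_ubound; exists 0%N.
  by apply: le_lt_trans (ltry K); apply: ge_ereal_sup => _ [N _ <-].
exists (fine s) => eta N0 eta0.
have [_ [N1 _ <-] N1P] := ub_ereal_sup_adherent eta0 s_fin.
pose N := maxn N0 N1.
have dEN : (dE N1 <= dE N)%E.
  apply: ereal_inf_le_tmp => _ [w [v [h ->]]]; exists w, v; split => //.
  by apply: hullS h; rewrite leq_maxr.
have dEs : (dE N < (fine s + eta)%:E)%E.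
  apply: (@le_lt_trans _ _ s); first by apply: ereal_sup_ubound; exists N.
  by rewrite EFinD fineK// lteDl// lte_fin.
have [_ [w [v [h ->]]] Qv] := ereal_inf_lt dEs.
exists N, w, v; split => //; first by rewrite leq_maxl.
  exact: ltW.
move=> w' v' h'; apply: le_trans (_ : dE N <= _)%E; last first.
  by apply: ereal_inf_lbound; exists w', v'.
by apply: le_trans dEN; rewrite EFinB fineK// ltW.
Qed.

Let de k : R := 2 / (2 ^ k.+1)%:R.

Let de_gt0 k : 0 < de k.
Proof. by rewrite divr_gt0// ltr0n expn_gt0. Qed.

Let de_le k l : (k <= l)%N -> de l <= de k.
Proof.
move=> kl; rewrite ler_pM2l// lef_pV2 ?posrE ?ltr0n ?expn_gt0//.
by rewrite ler_nat leq_exp2l.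
Qed.

(** The [v k] are near-minimisers. One of two tail hulls contains the other, hence also the midpoint
    of [v k] and [v l], whose squared norm is then nearly at least [d]; by the parallelogram law the
    gradients are Cauchy. Their partners [w k], being averages of late [f], still converge to
    [u]. *)
Lemma mazur_sequence : exists w v : nat -> MR * MR -> R,
  [/\ forall k, exists N, hull N (w k) (v k),
      forall k, (\int[leb2 R]_(z in D) (`|u z - w k z|)%:E <= (de k)%:E)%E &
      forall k l, (k <= l)%N ->
        (\int[leb2 R]_(z in D) (`|v l z - v k z|)%:E <= (de k)%:E)%E].
Proof.
have [d dP] := hull_approx.
have T10 : 0 < T + 1 by rewrite ltr_wpDr.
pose eta k := de k ^+ 2 / (32 * (T + 1)).
have eta0 k : 0 < eta k by rewrite divr_gt0 ?exprn_gt0 ?de_gt0// mulr_gt0.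
have /choice[X XP] : forall k, exists X : nat * ((MR * MR -> R) * (MR * MR -> R)),
    [/\ hull X.1 X.2.1 X.2.2,
        (\int[leb2 R]_(z in D) (`|u z - X.2.1 z|)%:E <= (de k)%:E)%E,
        (Q X.2.2 <= (d + eta k)%:E)%E &
        forall w' v', hull X.1 w' v' -> ((d - eta k)%:E <= Q v')%E].
  move=> k; have [N0 N0P] := f_L1 (de_gt0 k).
  have [N [w [v [NN h Qv low]]]] := dP (eta k) N0 (eta0 k).
  exists (N, (w, v)); split => //=; apply: (@hull_L1 N w v) => // j Nj.
  by apply: N0P; exact: leq_trans Nj.
exists (fun k => (X k).2.1), (fun k => (X k).2.2); split.
- by move=> k; have [h _ _ _] := XP k; exists (X k).1.
- by move=> k; have [_ h _ _] := XP k.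
move=> k l kl; have [hk _ Qk lowk] := XP k; have [hl _ Ql lowl] := XP l.
have [_ mk] := hull_measurable hk; have [_ ml] := hull_measurable hl.
have ekl : eta l <= eta k.
  rewrite ler_pM2r ?invr_gt0 ?mulr_gt0// lerXn2r ?nnegrE ?(ltW (de_gt0 _))//.
  exact: de_le.
apply: L1_of_L2 => //.
have -> : 2 * (de k ^+ 2 / (32 * (T + 1))) = (d + eta k) - (d - eta k).
  by rewrite /eta; ring.
apply: parallelogram => //.
  by apply: le_trans Ql _; rewrite lee_fin lerD2l.
case: (leqP (X k).1 (X l).1) => [kl'|/ltnW lk].
  by apply: lowk; apply: hull_mid hk; exact: hullS hl.
apply: (@le_trans _ _ (d - eta l)%:E); first by rewrite lee_fin lerB.
by apply: lowl; apply: hull_mid hl _; exact: hullS hk.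
Qed.

(** By Tonelli the L^1 distances of the slices have summable time integrals, so they tend to 0 at
    almost every time. *)
Let inner_ae (v : nat -> MR * MR -> R) (v0 : MR * MR -> R) :
  (forall k, measurable_fun setT (v k)) -> measurable_fun setT v0 ->
  (forall k, (\int[leb2 R]_(z in D) (`|v0 z - v k z|)%:E <= (de k)%:E)%E) ->
  {ae mu, forall t, [set` `[0, T]] t ->
    (\int[mu]_(x in @torus R) (`|v0 (t, x) - v k (t, x)|)%:E)%E @[k --> \oo] --> 0%E}.
Proof.
move=> mv mv0 le.
have md k : measurable_fun setT (fun z => (`|v0 z - v k z|)%:E).
  by apply/measurable_EFinP; apply: measurableT_comp => //; exact: measurable_funB.
have mI : measurable ([set` `[0, T]] : set MR) by exact: measurable_itv.
apply: (summable_integral_cvg0 mI).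
- move=> k; apply: measurable_funTS; apply: (measurable_inner (md k)) => z.
  by rewrite lee_fin.
- by move=> k t _; apply: integral_ge0 => x _; rewrite lee_fin.
- move=> k; apply: le_trans (le k).
  have := @tonelli_rect _ _ _ _ R mu mu [set` `[0, T]] (@torus R) _ mI (@measurable_torus R) (md k).
  rewrite -[(\int[leb2 R]_(z in D) _)%E]/(\int[(mu \x mu)%E]_(z in _ `*` _) _)%E => ->//.
Qed.

(** At almost every time the slices of [w k] and [v k] converge in L^1 of the torus, which is enough
    to pass to the limit in the weak derivative identity, [psi] and its derivative being bounded.
    The L^2 bound is Fatou's. *)
Theorem mazur : exists g' : MR * MR -> R, [/\ measurable_fun setT g',
  (\int[leb2 R]_(z in D) (`|g' z ^+ 2|)%:E <= K%:E)%E &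
  {ae mu, forall t, [set` `[0, T]] t ->
     weak_derivative (fun x => u (t, x)) (fun x => g' (t, x))}].
Proof.
have [w [v [wvh wL1 vC]]] := mazur_sequence.
have mw k : measurable_fun setT (w k) by have [N /hull_measurable[]] := wvh k.
have mv k : measurable_fun setT (v k) by have [N /hull_measurable[]] := wvh k.
have vae := cauchy_integral_ae_cvg mD mv vC.
have mg' := measurable_limfun mv.
have vae' : {ae leb2 R, forall z, D z -> v k z @[k --> \oo] --> limfun v z}.
  by apply: filterS vae => z /= H Dz; apply: cvg_limfun; exact: H.
have gL1 := riesz_fischer_L1 mD mv mg' vae' vC.
exists (limfun v); split => //.
  apply: (@fatou_bound _ _ R (leb2 R) D mD (fun k z => v k z ^+ 2)).
  - by move=> k; exact: measurable_funX.
  - exact: measurable_funX.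
  - by move=> k z; exact: sqr_ge0.
  - apply: filterS vae' => z /= H Dz.
    under eq_fun do rewrite expr2; rewrite expr2.
    by apply: cvgM; exact: H.
  - by move=> k; have [N h] := wvh k; exact: hull_L2 h.
have ae1 := inner_ae mw mu_ wL1; have ae2 := inner_ae mv mg' gL1.
have aeF : Filter (almost_everywhere mu) := ae_filter_ringOfSetsType mu.
apply: (@filterS _ _ aeF _ _ _ (@filterI _ _ aeF _ _ ae1 ae2)) => t [/= H1 H2] tT psi psiT.
have {H1} H1 := H1 tT; have {H2} H2 := H2 tT.
have [_ pc p'c _] := test_torus_continuous psiT.
have [b b0 pb] := continuous_bounded01 pc; have [c c0 p'b] := continuous_bounded01 p'c.
have c1 : 0 < c + b + 1 by rewrite ltr_wpDl ?addr_ge0.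
(* By contradiction: a defect [x0 > 0] would be at most [c + b] times slice errors that can be made
   smaller than [x0 / (c + b + 1)]. *)
apply/eqP; rewrite -subr_eq0 -normr_le0 leNgt; apply/negP => e0.
set x0 := `|_| in e0.
have e40 : 0 < x0 / (c + b + 1) by rewrite divr_gt0.
have small (y : nat -> \bar R) : y k @[k --> \oo] --> 0%E ->
    \forall k \near \oo, (y k < (x0 / (c + b + 1))%:E)%E.
  move=> H; apply: (H [set r | (r < (x0 / (c + b + 1))%:E)%E]).
  by apply: open_ereal_lt'; rewrite lte_fin.
have [k [Ik1 Ik2]] : exists k,
    (\int[mu]_(x in @torus R) (`|u (t, x) - w k (t, x)|)%:E < (x0 / (c + b + 1))%:E)%E /\
    (\int[mu]_(x in @torus R) (`|limfun v (t, x) - v k (t, x)|)%:E < (x0 / (c + b + 1))%:E)%E.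
  exact: (filter_ex (filterI (small _ H1) (small _ H2))).
have [N h] := wvh k; have [B HB] := hull_bounded t h.
have D1 := torus_weighted_dist (measurable_slice t mu_) (measurable_slice t (mw k))
  (continuous_measurable_fun p'c) p'b (fun x Tx => (HB x Tx).1) (ltW Ik1).
have D2 := torus_weighted_dist (measurable_slice t mg') (measurable_slice t (mv k))
  (continuous_measurable_fun pc) pb (fun x Tx => (HB x Tx).2) (ltW Ik2).
move: D1 D2; rewrite (hull_weak t h psiT).
move: (e0); rewrite /x0 opprK.
set a1 := \int[mu]_(x in _) _; set a2 := \int[mu]_(x in _) _; set a3 := \int[mu]_(x in _) _.
move=> {}e0 h1 h2.
have : `|a1 + a2| <= `|a1 - - a3| + `|a2 - a3|.
  have -> : a1 + a2 = (a1 - - a3) + (a2 - a3) by ring.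
  exact: ler_normD.
have -> : `|a1 + a2| = (c + b + 1) * (`|a1 + a2| / (c + b + 1)) by field; rewrite gt_eqF.
have e4 : 0 < `|a1 + a2| / (c + b + 1) by rewrite divr_gt0.
by move: h1 h2 e4; set n0 := _ / _; lra.
Qed.

End Mazur.

Lemma uncurriedE (R : realType) (f : measurableTypeR R * measurableTypeR R -> R) :
  uncurried (fun t x => f (t, x)) = f.
Proof. by apply/funext => -[]. Qed.

Lemma Lp_torus_slices (R : realType) (T K : R)
    (v : measurableTypeR R * measurableTypeR R -> R) : measurable_fun setT v ->
  (\int[leb2 R]_(z in cylinder T) (`|v z ^+ 2|)%:E <= K%:E)%E ->
  {ae @lebesgue_measure R, forall t, [set` `[0, T]] t -> Lp_torus 2 (fun x => v (t, x))}.
Proof.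
move=> mv vK; set mu := @lebesgue_measure R.
have mI : measurable ([set` `[0, T]] : set (measurableTypeR R)) by exact: measurable_itv.
have mT := @measurable_torus R.
have mv2 : measurable_fun setT (fun z => (`|v z ^+ 2|)%:E).
  by apply/measurable_EFinP; apply: measurableT_comp => //; exact: measurable_funX.
have mG : measurable_fun setT
    (fun t : measurableTypeR R => (\int[mu]_(x in @torus R) (`|v (t, x) ^+ 2|)%:E)%E).
  by apply: (measurable_inner mv2) => z; rewrite lee_fin.
have iG : mu.-integrable [set` `[0, T]]
    (fun t => (\int[mu]_(x in @torus R) (`|v (t, x) ^+ 2|)%:E)%E).
  apply/integrableP; split; first exact: measurable_funTS.
  under eq_integral do rewrite gee0_abs ?integral_ge0//.
  have := @tonelli_rect _ _ _ _ R mu mu [set` `[0, T]] (@torus R) _ mI mT mv2.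
  rewrite -[(\int[(_ \x _)%E]_(z in _ `*` _) _)%E]/(\int[leb2 R]_(z in cylinder T) _)%E => <-.
    by apply: le_lt_trans vK _; exact: ltry.
  by move=> z; rewrite lee_fin.
have := integrable_ae mI iG; apply: filterS => t /= + tT => /(_ tT) fin.
apply: Lfun_patch => //; first exact: measurable_slice.
rewrite (eq_integral (fun x => (`|v (t, x) ^+ 2|)%:E)); last first.
  by move=> x _; rewrite powR_mulrn// normrX.
by rewrite ltey_eq fin.
Qed.

(** * Function spaces of the limit *)

Section LimitSpaces.
Variables (R : realType) (n : nat) (B0 C E : R).
Variables (W : forall m : nat, 'I_n -> R -> 'I_m.+1 -> R) (P : nat -> R -> R).
Hypothesis B00 : 0 <= B0.
Hypothesis C0 : 0 <= C.
Hypothesis WP : forall m, controlled B0 C E (@W m) (P m).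
Local Notation MR := (measurableTypeR R).
Local Notation mu := (@lebesgue_measure R).
Variable sigma : nat -> nat.
Hypothesis sigmaP : forall q M N i, (q <= M)%N -> (q <= N)%N ->
    (\int[leb2 R]_(z in cylinder q.+1%:R)
       (`|interp W (sigma M) i z - interp W (sigma N) i z|)%:E <=
     (2 / (2 ^ q.+1)%:R)%:E)%E.
Variables (i : 'I_n) (T : R).
Hypothesis T0 : 0 < T.

Local Notation u := (ulim W sigma i).
Local Notation f N := (interp W (sigma N) i).
Local Notation K := (2 * B0 * cube_const B0 * (T + E)).

Let mu_ : measurable_fun setT u. Proof. exact: (measurable_ulim WP). Qed.
Let mf N : measurable_fun setT (f N). Proof. exact: (measurable_interp WP). Qed.
Let mD : measurable (cylinder T). Proof. exact: measurable_cylinder. Qed.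

(** The fourth power of [a - b] is at most [8 * a ^+ 4 + 8 * b ^+ 4], the gap being a sum of
    squares; so the differences are bounded in L^4, and L^1 convergence interpolates. *)
Lemma limit_cvg_Lp (p : R) : 1 <= p -> p < 4 ->
  ('N[leb2 R]_p%:E [EFin \o (fun z => f N z - u z)%R \_ (cylinder T)])%E @[N --> \oo] --> 0%E.
Proof.
move=> p1 p4; apply: (@Lnorm_interpolation_cvg _ _ R (leb2 R) _ mD p (16 * K)) => //.
- by move=> N; exact: measurable_funB.
- move=> N.
  have m4 (g : MR * MR -> R) : measurable_fun setT g ->
      measurable_fun (cylinder T) (fun z => (`|g z ^+ 4|)%:E).
    move=> mg; apply/measurable_EFinP/measurable_funTS; apply: measurableT_comp => //.
    exact: measurable_funX.
  apply: (@le_trans _ _ (\int[leb2 R]_(z in cylinder T)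
     (8%:E * (`|f N z ^+ 4|)%:E + 8%:E * (`|u z ^+ 4|)%:E))%E).
    apply: (ge0_le_integral (leb2 R) mD).
    - by move=> z _; rewrite lee_fin exprn_ge0.
    - apply/measurable_EFinP/measurable_funTS; apply: measurable_funX.
      by apply: measurableT_comp => //; exact: measurable_funB.
    - by apply: emeasurable_funD; apply: emeasurable_funM => //; exact: m4.
    - move=> z _; rewrite -!EFinM -EFinD lee_fin -normrX.
      set a := f N z; set b := u z.
      rewrite !ger0_norm ?exprn_even_ge0//.
      have -> : 8 * a ^+ 4 + 8 * b ^+ 4 = (a - b) ^+ 4 + (7 * a ^+ 4 + 7 * b ^+ 4
         + 4 * a ^+ 3 * b - 6 * a ^+ 2 * b ^+ 2 + 4 * a * b ^+ 3) by ring.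
      rewrite lerDl.
      have -> : 7 * a ^+ 4 + 7 * b ^+ 4 + 4 * a ^+ 3 * b - 6 * a ^+ 2 * b ^+ 2 + 4 * a * b ^+ 3 =
        2 * (a ^+ 2 + a * b) ^+ 2 + 2 * (b ^+ 2 + a * b) ^+ 2 + 5 * (a ^+ 2 - b ^+ 2) ^+ 2 by ring.
      have h1 := sqr_ge0 (a ^+ 2 + a * b); have h2 := sqr_ge0 (b ^+ 2 + a * b).
      by have h3 := sqr_ge0 (a ^+ 2 - b ^+ 2); lra.
  rewrite ge0_integralD//; try by [apply: emeasurable_funM => //; exact: m4];
    try by [move=> z _; rewrite mule_ge0// lee_fin].
  rewrite !ge0_integralZl ?lee_fin//; try exact: m4.
  have -> : (16 * K)%:E = (8%:E * K%:E + 8%:E * K%:E)%E.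
    by rewrite -!EFinM -EFinD; congr (_%:E); ring.
  apply: leeD; apply: lee_wpmul2l; rewrite ?lee_fin//.
    exact: (interp_L4 B00 WP).
  exact: (ulim_L4 B00 WP sigmaP).
- move=> e e0; have [N0 N0P] := ulim_L1 WP sigmaP i T e0; exists N0 => N NN.
  by under eq_integral do rewrite distrC; exact: N0P.
Qed.

Let u4 := ulim_L4 B00 WP sigmaP i T0.

Lemma limit_L4 : Lp_cylinder 4 T (fun t x => u (t, x)).
Proof.
rewrite /Lp_cylinder uncurriedE; apply: (@Lfun_patch _ _ R (leb2 R)) => //.
rewrite (eq_integral (fun z => (`|u z ^+ 4|)%:E)); last first.
  by move=> x _; rewrite powR_mulrn// normrX.
by apply: le_lt_trans u4 _; exact: ltry.
Qed.

Lemma limit_L2_bound : (\int[leb2 R]_(z in cylinder T) (`|u z ^+ 2|)%:E <= (T + K)%:E)%E.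
Proof.
apply: (@le_trans _ _ (\int[leb2 R]_(z in cylinder T) (1%:E + (`|u z ^+ 4|)%:E))%E).
  apply: (ge0_le_integral (leb2 R) mD).
  - by move=> z _; rewrite lee_fin.
  - apply/measurable_EFinP/measurable_funTS; apply: measurableT_comp => //.
    exact: measurable_funX.
  - apply: emeasurable_funD => //.
    apply/measurable_EFinP/measurable_funTS; apply: measurableT_comp => //.
    exact: measurable_funX.
  - move=> z _; rewrite -EFinD lee_fin !ger0_norm ?exprn_even_ge0//.
    have -> : 1 + u z ^+ 4 = u z ^+ 2 + ((u z ^+ 2 - 2^-1) ^+ 2 + 3 / 4) by field.
    by rewrite lerDl addr_ge0 ?sqr_ge0// divr_ge0.
rewrite ge0_integralD//; last first.
  apply/measurable_EFinP/measurable_funTS; apply: measurableT_comp => //.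
  exact: measurable_funX.
by rewrite integral_cst// measure_cylinder// mul1e EFinD leeD2l.
Qed.

Lemma Lp2_cylinder (v : MR * MR -> R) (a : R) : measurable_fun setT v ->
  (\int[leb2 R]_(z in cylinder T) (`|v z ^+ 2|)%:E <= a%:E)%E ->
  Lp_cylinder 2 T (fun t x => v (t, x)).
Proof.
move=> mv va; rewrite /Lp_cylinder uncurriedE; apply: (@Lfun_patch _ _ R (leb2 R)) => //.
rewrite (eq_integral (fun z => (`|v z ^+ 2|)%:E)); last first.
  by move=> x _; rewrite powR_mulrn// normrX.
by apply: le_lt_trans va _; exact: ltry.
Qed.

(** Mazur's argument is applied to the interpolants and their slopes, whose L^2 norms are bounded
    through the primitive of the height. *)
Lemma limit_L2H1 : L2H1 T (fun t x => u (t, x)).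
Proof.
pose s N t := slope (@W (sigma N)) i t.
pose g N z := stepf (s N z.1) z.2.
have sc N k : continuous (fun t => s N t k).
  move=> t; apply: cvgM; last exact: cvg_cst.
  by apply: cvgB; exact: (Wcont WP).
have mg N : measurable_fun setT (g N) by apply: measurable_stepf2; exact: sc.
have [g' [mg' g'2 g'w]] : exists g' : MR * MR -> R, [/\ measurable_fun setT g',
  (\int[leb2 R]_(z in cylinder T) (`|g' z ^+ 2|)%:E <= (T + E)%:E)%E &
  {ae mu, forall t, [set` `[0, T]] t ->
     weak_derivative (fun x => u (t, x)) (fun x => g' (t, x))}].
  apply: (@mazur R T (T + E) T0 (fun N => f N) g u mf mg mu_).
  - move=> N t; exists (\sum_k `|@W (sigma N) i t k| + \sum_k `|s N t k|) => x Tx.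
    have h1 : `|f N (t, x)| <= \sum_k `|@W (sigma N) i t k| by exact: interpolant_bounded.
    have h2 : `|g N (t, x)| <= \sum_k `|s N t k| by exact: stepf_bounded.
    split; first by rewrite (le_trans h1)// lerDl sumr_ge0.
    by rewrite (le_trans h2)// lerDr sumr_ge0.
  - move=> N t.
    exact: (interpolant_weak_derivative (w := @W (sigma N) i t) (measurable_slice t (mf N))).
  - move=> N; have := slope_L2 (WP (sigma N)) i T0; apply: le_trans.
    rewrite le_eqVlt; apply/predU1P; left; apply: eq_integral => z _.
    by rewrite ger0_norm ?sqr_ge0.
  - by move=> e e0; exact: (ulim_L1 WP sigmaP i T e0).
exists (fun t x => g' (t, x)); split.
- exact: (Lp2_cylinder mu_ limit_L2_bound).
- exact: (Lp2_cylinder mg' g'2).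
have aeF : Filter (almost_everywhere mu) := ae_filter_ringOfSetsType mu.
have ae1 := Lp_torus_slices mu_ limit_L2_bound.
have ae2 := Lp_torus_slices mg' g'2.
apply: (@filterS _ _ aeF _ _ _ (@filterI _ _ aeF _ _ (@filterI _ _ aeF _ _ ae1 ae2) g'w)).
by move=> t [[/= H1 H2] H3] tT; split; [exact: H1 | exact: H2 | exact: H3].
Qed.

End LimitSpaces.

(** * Test functions and second differences *)

Section TestFunctions.
Variable R : realType.
Implicit Types (phi : R -> R -> R) (g : R -> R).

Lemma frozen_within_continuous phi :
  {within [set z : R * R | halfline z.1], continuous (fun z : R * R => phi z.1 z.2)} ->
  continuous (fun z : R * R => phi (Num.max 0 z.1) z.2).
Proof.
move=> /subspace_continuousP H z.
pose G (w : R * R) : R * R := (Num.max 0 w.1, w.2).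
have Gz : halfline (G z).1 by rewrite /halfline/= le_max lexx.
have Gc : G @ nbhs z --> nbhs (G z).
  have c1 : (fun w : R * R => Num.max 0 w.1) @ nbhs z --> Num.max 0 z.1.
    apply: (@continuous_comp _ _ _ (fun w : R * R => w.1) (fun s : R => Num.max 0 s)).
      by case: z {Gz} => a b; exact: cvg_fst.
    exact: max0_continuous.
  have c2 : (fun w : R * R => w.2) @ nbhs z --> z.2 by case: z {Gz c1} => a b; exact: cvg_snd.
  exact: (cvg_pair c1 c2).
move=> B /(H (G z) Gz) /= HB.
have := Gc _ HB; rewrite /= nbhs_simpl /= nbhs_filterE; apply: filterS => w /= Hw; apply: Hw.
by rewrite /halfline/= le_max lexx.
Qed.

(** Compactness of the rectangle. In the modulus only [x] is confined to [[a, b]]; [y] may leave it,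
    which covers the neighbours of end points. *)
Lemma rectangle_uniform (f : R * R -> R) (T a b : R) : continuous f ->
  (exists2 c, 0 <= c & forall t x, 0 <= t <= T -> a <= x <= b -> `|f (t, x)| <= c) /\
  forall e, 0 < e -> exists2 d, 0 < d & forall t x y, 0 <= t <= T ->
    a <= x <= b -> `|y - x| <= d -> `|f (t, y) - f (t, x)| <= e.
Proof.
move=> fc; pose K := `[0, T]%classic `*` `[a, b]%classic.
have Kc : compact K by apply: compact_setX; exact: segment_compact.
have KP (t x : R) : 0 <= t <= T -> a <= x <= b -> K (t, x).
  by move=> tT xab; rewrite /K; split; rewrite /= in_itv.
split.
  have cf : compact (f @` K).
    by apply: continuous_compact => //; exact: continuous_subspaceT.
  have [c [_ cP]] := compact_bounded cf.
  exists (`|c| + 1) => [|t x tT xab]; first by rewrite addr_ge0.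
  apply: (cP (`|c| + 1)); first by rewrite (le_lt_trans (ler_norm c))// ltrDl.
  by exists (t, x) => //; exact: KP.
move=> e e0.
have near_unif := (compact_near_coveringP K).1 Kc R (nbhs (0 : R)^'+)
  (fun d z => forall y, `|y - z.2| <= d -> `|f (z.1, y) - f z| <= e) _.
have {near_unif} : \forall d \near (0 : R)^'+, K `<=` (fun z => forall y, `|y - z.2| <= d ->
    `|f (z.1, y) - f z| <= e).
  apply: near_unif.
  move=> [t x] Kx; have e20 : 0 < e / 2 by rewrite divr_gt0.
  have /cvgrPdist_lt/(_ _ e20) := fc (t, x).
  move=> /nbhs_ballP[r /= r0 rP]; have r20 : 0 < r / 2 by rewrite divr_gt0.
  exists (ball (t, x) (r / 2), [set d | 0 < d /\ d < r / 2]) => /=.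
    split; first exact: nbhsx_ballx.
    exact: (filterI (nbhs_right_gt 0) (nbhs_right_lt r20)).
  move=> [[t' x'] d] /= [[/= tb xb]] [d0 dr] y yd.
  have h1 : `|f (t, x) - f (t', x')| < e / 2.
    apply: rP; split => /=; [apply: le_ball tb | apply: le_ball xb];
      by rewrite ler_pdivrMr// ler_pMr// ler1n.
  have h2 : `|f (t, x) - f (t', y)| < e / 2.
    apply: rP; split => /=; first by apply: le_ball tb; rewrite ler_pdivrMr// ler_pMr// ler1n.
    move: xb yd; rewrite /ball/= !ltr_norml !ler_norml => /andP[? ?] /andP[? ?].
    by apply/andP; split; lra.
  move: h1 h2; rewrite !ltr_norml ler_norml => /andP[? ?] /andP[? ?].
  by apply/andP; split; lra.
move=> /(filterI (nbhs_right_gt (0 : R)))/filter_ex[d [/= d0 dP]].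
by exists d => // t x y tT xab yx; apply: (dP (t, x)) => //; exact: KP.
Qed.

Lemma has_tderiv_shift g (x s l : R) : is_derive (x + s) 1 g l ->
  has_tderiv (fun s => g (x + s)) s l.
Proof.
move=> /is_deriveP H; apply: is_derive_has_tderiv; apply/is_deriveP => e /H[d d0 dP].
exists d => // r rs rd; have -> : r - s = x + r - (x + s) by ring.
apply: dP; first by rewrite (inj_eq (addrI x)).
by have -> : x + r - (x + s) = r - s by ring.
Qed.

Lemma has_tderiv_reflect g (x s l : R) : is_derive (x - s) 1 g l ->
  has_tderiv (fun s => g (x - s)) s (- l).
Proof.
move=> /is_deriveP H; apply: is_derive_has_tderiv; apply/is_deriveP => e /H[d d0 dP].
exists d => // r rs rd.
have -> : (g (x - r) - g (x - s)) / (r - s) - - l =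
    - ((g (x - r) - g (x - s)) / (x - r - (x - s)) - l).
  have -> : x - r - (x - s) = - (r - s) by ring.
  by rewrite invrN; ring.
rewrite normrN; apply: dP.
  by rewrite (inj_eq (addrI x)) (inj_eq oppr_inj).
have -> : x - r - (x - s) = - (r - s) by ring.
by rewrite normrN.
Qed.

Lemma has_tderiv_eq (f : R -> R) (t l k : R) : has_tderiv f t l -> l = k -> has_tderiv f t k.
Proof. by move=> + <-. Qed.

Lemma has_tderiv_monomial (c t : R) : has_tderiv (fun s => c * s) t c /\
  has_tderiv (fun s => c * s ^+ 2) t (2 * c * t).
Proof.
have hid : has_tderiv (fun s : R => s) t 1 by apply: is_derive_has_tderiv; exact: is_derive_id.
have hc := has_tderiv_cst c t; split.
  by apply: has_tderiv_eq (has_tderivM hc hid) _; rewrite /cst; ring.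
by apply: has_tderiv_eq (has_tderivM hc (has_tderivM hid hid)) _; rewrite /cst; ring.
Qed.

(** The even function [q s = g (x + s) + g (x - s)] has zero slope at [0] and a second derivative
    within [2 * e] of [2 * g'' x]; two comparisons enclose [q] between parabolas. *)
Lemma second_difference g (g' g'' : R -> R) (x h e : R) : 0 < h ->
  (forall y : R, is_derive y 1 g (g' y)) -> (forall y : R, is_derive y 1 g' (g'' y)) ->
  (forall y, `|y - x| <= h -> `|g'' y - g'' x| <= e) ->
  `|(g (x + h) + g (x - h) - 2 * g x) / h ^+ 2 - g'' x| <= e.
Proof.
move=> h0 dg dg' g''e.
have gc : continuous g by apply: derivable_continuous1 => y; case: (dg y).
have g'c : continuous g' by apply: derivable_continuous1 => y; case: (dg' y).
have shc (f : R -> R) : continuous f -> continuous (fun s => f (x + s)) /\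
    continuous (fun s => f (x - s)).
  move=> fc; split=> s.
    apply: (@continuous_comp _ _ _ (fun s => x + s) f); last exact: fc.
    by apply: cvgD; [exact: cvg_cst | exact: cvg_id].
  apply: (@continuous_comp _ _ _ (fun s => x - s) f); last exact: fc.
  by apply: cvgB; [exact: cvg_cst | exact: cvg_id].
have [gp gm] := shc _ gc; have [g'p g'm] := shc _ g'c.
have linc (c : R) : continuous (fun s : R => c * s).
  by move=> s; apply: cvgM; [exact: cvg_cst | exact: cvg_id].
have sqrc (c : R) : continuous (fun s : R => c * s ^+ 2).
  by move=> s; apply: cvgM; [exact: cvg_cst | exact: exprn_continuous].
pose q (s : R) := g (x + s) + g (x - s).
pose q' (s : R) := g' (x + s) - g' (x - s).
have qc : continuous q by move=> s; apply: cvgD; [exact: gp | exact: gm].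
have q'c : continuous q' by move=> s; apply: cvgB; [exact: g'p | exact: g'm].
have dq s : has_tderiv q s (q' s).
  by apply: has_tderivD; [exact: has_tderiv_shift | exact: has_tderiv_reflect].
have dq' s : has_tderiv q' s (g'' (x + s) + g'' (x - s)).
  apply: has_tderiv_eq (has_tderivD _ _) _; [exact: has_tderiv_shift | | reflexivity].
  by have := has_tderivN (has_tderiv_reflect (dg' (x - s))); rewrite opprK.
have b s : 0 <= s -> s <= h -> (2 * (g'' x - e)) * s <= q' s <= (2 * (g'' x + e)) * s.
  move=> s0 sh; have q'0 : q' 0 = 0 by rewrite /q' addr0 subr0 subrr.
  have bd (r : R) : 0 < r -> r < s -> 2 * (g'' x - e) <= g'' (x + r) + g'' (x - r) <= 2 * (g'' x + e).
    move=> r0 rs; have rh : r <= h by rewrite (le_trans (ltW rs)).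
    have := g''e (x + r); have := g''e (x - r).
    rewrite [x - r - x]addrAC [x + r - x]addrAC subrr !add0r normrN (gtr0_norm r0) => /(_ rh) + /(_ rh).
    by rewrite !ler_norml => /andP[? ?] /andP[? ?]; apply/andP; split; lra.
  apply/andP; split.
    apply: (tderiv_le_from (lexx 0) _ s0 (linc _) q'c (fun r _ _ => (has_tderiv_monomial _ r).1)
      (fun r _ _ => dq' r)); first by rewrite mulr0 q'0.
    by move=> r r0 rs; have /andP[] := bd r r0 rs.
  apply: (tderiv_le_from (lexx 0) _ s0 q'c (linc _) (fun r _ _ => dq' r)
    (fun r _ _ => (has_tderiv_monomial _ r).1)); first by rewrite mulr0 q'0.
  by move=> r r0 rs; have /andP[] := bd r r0 rs.
pose p (c s : R) := 2 * g x + c * s ^+ 2.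
have pc c : continuous (p c) by move=> s; apply: cvgD; [exact: cvg_cst | exact: sqrc].
have dp c s : has_tderiv (p c) s (2 * c * s).
  apply: has_tderiv_eq (has_tderivD (has_tderiv_cst _ s) (has_tderiv_monomial c s).2) _.
  by rewrite add0r.
have q0 c : q 0 = p c 0 by rewrite /q /p addr0 subr0 expr0n/= mulr0 addr0; ring.
have lo : p (g'' x - e) h <= q h.
  apply: (tderiv_le_from (lexx 0) _ (ltW h0) (pc _) qc (fun r _ _ => dp _ r) (fun r _ _ => dq r)).
    by rewrite -q0.
  by move=> r r0 rh; have /andP[] := b r (ltW r0) (ltW rh).
have up : q h <= p (g'' x + e) h.
  apply: (tderiv_le_from (lexx 0) _ (ltW h0) qc (pc _) (fun r _ _ => dq r) (fun r _ _ => dp _ r)).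
    by rewrite -q0.
  by move=> r r0 rh; have /andP[] := b r (ltW r0) (ltW rh).
have h20 : 0 < h ^+ 2 by rewrite exprn_gt0.
have -> : (g (x + h) + g (x - h) - 2 * g x) / h ^+ 2 - g'' x =
    (q h - 2 * g x - g'' x * h ^+ 2) / h ^+ 2 by rewrite /q; field; rewrite gt_eqF.
rewrite ler_norml ler_pdivlMr// ler_pdivrMr//.
by move: lo up; rewrite /p => lo up; apply/andP; split; lra.
Qed.

(* A test function of [Cc2] and the derivatives used below, frozen at time 0
   for negative times. *)
Record test_extension (T : R) (phi phit phixx : R -> R -> R) : Prop := TestExtension {
  test_cont : continuous (fun z : R * R => phi z.1 z.2);
  test_dt_cont : continuous (fun z : R * R => phit z.1 z.2);
  test_dxx_cont : continuous (fun z : R * R => phixx z.1 z.2);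
  test_dt : forall (t x : R), 0 < t -> is_derive t 1 (phi^~ x) (phit t x);
  test_dxx : forall t : R, exists g : R -> R, forall y : R,
    is_derive y 1 (phi t) (g y) /\ is_derive y 1 g (phixx t y);
  test_per : forall t, periodic (phi t) 1;
  test_supp : forall t x : R, T <= t -> phi t x = 0;
  test_dt_supp : forall t x : R, T <= t -> phit t x = 0;
  test_dxx_supp : forall t x : R, T <= t -> phixx t x = 0 }.

Lemma Cc2_extension phi : Cc2 phi -> exists2 T, 0 < T &
  test_extension T (fun t => phi (Num.max 0 t)) (fun t => dt phi (Num.max 0 t))
    (fun t => dx (dx phi) (Num.max 0 t)).
Proof.
move=> [[phic [phid [[phitc _] [_ [phixd [_ [phixxc _]]]]]]] phiper [T0 phi0]].
have max0 (t : R) : 0 <= Num.max 0 t by rewrite le_max lexx.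
have z0 (t x : R) : Num.max T0 0 <= t -> phi t x = 0.
  by move=> Tt; apply: phi0; apply: le_trans Tt; rewrite le_max lexx.
have T00 : 0 <= Num.max T0 0 by rewrite le_max lexx orbT.
have maxT (t : R) : Num.max T0 0 + 1 <= t -> Num.max 0 t = t.
  by move=> Tt; rewrite max_r//; apply: le_trans Tt; rewrite addr_ge0.
(* The support is enlarged by [1] so that beyond it the function vanishes around each time, and with
   it the time derivative. *)
exists (Num.max T0 0 + 1); first by rewrite ltr_wpDl.
split.
- exact: frozen_within_continuous.
- exact: frozen_within_continuous.
- exact: frozen_within_continuous.
- move=> t x t0 /=.
  rewrite [X in dt _ X _]max_r ?ltW//.
  apply: (@has_tderiv_max_is_derive R (fun t => phi t x)) => //.
  by apply: tderivable_tderiv; [exact: ltW | exact: (phid t x (ltW t0)).1].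
- move=> t; exists (dx phi (Num.max 0 t)) => y; split.
    have d := (phid (Num.max 0 t) y (max0 t)).2.
    exact: (DeriveDef d (esym (derive1E _ _))).
  have d := (phixd (Num.max 0 t) y (max0 t)).2.
  exact: (DeriveDef d (esym (derive1E _ _))).
- by move=> t; apply: phiper; exact: max0.
- by move=> t x Tt; rewrite maxT// z0// (le_trans _ Tt)// lerDl.
- move=> t x Tt; rewrite maxT//; apply: tderivE.
    by apply: le_trans Tt; rewrite addr_ge0.
  apply/has_tderivP => e e0; exists 1 => // s s0 st.
  rewrite ltr_norml => /andP[st1 _].
  by rewrite !z0 ?subrr ?mul0r ?subrr ?normr0//; lra.
- move=> t x Tt; rewrite maxT// /dx.
  have -> : phi t = cst 0 by apply/funext => y; rewrite z0//; lra.
  have -> : (fun y => (cst 0 : R -> R)^`()%classic y) = cst 0 :> (R -> R).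
    by apply/funext => y; rewrite derive1_cst.
  exact: derive1_cst.
Qed.

End TestFunctions.

(** Fubini for real-valued integrals. The inner integral is known to be finite only almost
    everywhere, so the passage from extended reals to reals under the outer integral holds up to a
    null set. *)
Lemma Rintegral_cylinder (R : realType) (T : R)
    (G : measurableTypeR R * measurableTypeR R -> R) : measurable_fun setT G ->
  (leb2 R).-integrable (cylinder T) (EFin \o G) ->
  \int[leb2 R]_(z in cylinder T) G z =
  \int[@lebesgue_measure R]_(t in [set` `[0, T]])
    \int[@lebesgue_measure R]_(x in @torus R) G (t, x).
Proof.
move=> mG iG; set mu := @lebesgue_measure R.
pose I : set (measurableTypeR R) := [set` `[0, T]].
have mI : measurable I by exact: measurable_itv.
have mD := @measurable_cylinder R T.
pose f := (EFin \o G) \_ (cylinder T).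
have if_ : (leb2 R).-integrable setT f by apply/(integrable_mkcond _ mD).1.
have FE t : fubini_F mu f t = ((fun t => \int[mu]_(x in @torus R) (G (t, x))%:E)%E \_ I) t.
  rewrite /fubini_F /f /patch; case: ifPn => [/set_mem It|/negP It].
    rewrite [RHS]integral_mkcond; apply: eq_integral => y _; rewrite /patch.
    by rewrite /cylinder in_setX mem_set.
  rewrite (eq_integral (cst 0%E)) ?integral0// => y _.
  by rewrite /cylinder in_setX; case: ifP => // /andP[].
have iF := @integrable_fubini_F _ _ _ _ R mu mu f if_.
have {FE} FE : fubini_F mu f = (fun t => \int[mu]_(x in @torus R) (G (t, x))%:E)%E \_ I.
  by apply/funext => t; exact: FE.
rewrite FE in iF; have iI := (integrable_mkcond _ mI).2 iF.
rewrite /Rintegral; congr fine.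
rewrite [LHS]integral_mkcond -/f.
rewrite -[LHS](@integral12_prod_meas1 _ _ _ _ R mu mu f if_) FE -integral_mkcond.
apply: ae_eq_integral => //.
- exact: measurable_int iI.
- apply/measurable_EFinP; apply: measurableT_comp => //; exact: measurable_int iI.
have := integrable_ae mI iI; apply: filterS => t /= + It => /(_ It) fin.
by rewrite fineK.
Qed.

(** * The discrete weak formulation *)

Section DiscreteIdentity.
Variables (R : realType) (n m : nat) (D : 'I_n -> R) (A : 'I_n -> 'I_n -> R).
Variables (u0 : 'I_n -> R -> R) (u : 'I_n -> R -> 'I_m.+1 -> R).
Hypothesis u_sol : discrete_solution D A u0 u.
Variables (T : R) (phi phit phixx : R -> R -> R).
Hypothesis T0 : 0 < T.
Hypothesis phiT : test_extension T phi phit phixx.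
Local Notation W := (frozen u).
Local Notation h := (mesh R m).
Local Notation X k := ((k : 'I_m.+1)%:R * h).

(** The time derivative of [W i t k * phi t (X k)] once the Laplacian has been moved to the test
    function; the two agree in mean, not node by node. *)
Definition discrete_rate i (t : R) (k : 'I_m.+1) : R :=
  W i t k * phit t (X k) +
  flux D A (fun j => W j t) i k * dlaplacian (fun l => phi t (X l)) k.

Let slice_continuous (f : R -> R -> R) (x : R) :
  continuous (fun z : R * R => f z.1 z.2) -> continuous (fun t : R => f t x).
Proof.
move=> fc t; apply: (@continuous_comp _ _ _ (fun t : R => (t, x)) (fun z => f z.1 z.2)).
  have c1 : (fun s : R => s) @ nbhs t --> t by exact: cvg_id.
  have c2 : (fun _ : R => x) @ nbhs t --> x by exact: cvg_cst.
  exact: (cvg_pair c1 c2).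
exact: fc.
Qed.

Let mean_continuous (f : R -> 'I_m.+1 -> R) : (forall k, continuous (fun t => f t k)) ->
  continuous (fun t => mean (f t)).
Proof.
by move=> fc t; apply: cvgM; [exact: cvg_cst | apply: continuous_sum => k; exact: fc].
Qed.

Lemma discrete_rate_continuous i k : continuous (fun t => discrete_rate i t k).
Proof.
have Wc j l : continuous (fun t => W j t l) := frozen_continuous u_sol (i := j) (k := l).
have pc l := slice_continuous (x := X l) (test_cont phiT).
move=> t; apply: cvgD.
  by apply: cvgM; [exact: Wc | exact: (slice_continuous (x := X k) (test_dt_cont phiT))].
apply: cvgM.
  apply: cvgD; first by apply: cvgM; [exact: cvg_cst | exact: Wc].
  apply: cvgM; first exact: Wc.
  apply: continuous_sum => j {}t; apply: cvgM; [exact: cvg_cst | exact: Wc].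
apply: cvgM; last exact: cvg_cst.
apply: cvgB; first by apply: cvgD; exact: pc.
by apply: cvgM; [exact: cvg_cst | exact: pc].
Qed.

(** The fundamental theorem of calculus for [Q], the mean of solution times test function, which
    vanishes at [T]. Summation by parts on both sides shows that the Laplacian may be moved. *)
Lemma discrete_identity i :
  \int[@lebesgue_measure R]_(t in [set` `[0, T]]) mean (discrete_rate i t) =
  - mean (fun k => u0 i (X k) * phi 0 (X k)).
Proof.
have h0 := mesh_gt0 R m.
have Wc j l : continuous (fun t => W j t l) := frozen_continuous u_sol (i := j) (k := l).
have pc l := slice_continuous (x := X l) (test_cont phiT).
pose Q t := mean (fun k => W i t k * phi t (X k)).
have Qc : continuous Q by apply: mean_continuous => k t; apply: cvgM; [exact: Wc | exact: pc].
have rc : continuous (fun t => mean (discrete_rate i t)).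
  by apply: mean_continuous => k; exact: discrete_rate_continuous.
have dQ (t : R) : 0 < t -> is_derive t 1 Q (mean (discrete_rate i t)).
  move=> t0; apply: (has_tderiv_is_derive t0).
  have dk k : has_tderiv (fun t => W i t k * phi t (X k)) t
    (dlaplacian (flux D A (fun j => W j t) i) k * phi t (X k) + W i t k * phit t (X k)).
    apply: has_tderivM; first by apply: is_derive_has_tderiv; exact: (frozen_derive u_sol).
    by apply: is_derive_has_tderiv; exact: (test_dt phiT).
  have dS := has_tderivM (has_tderiv_cst h t) (has_tderiv_sum dk).
  apply: has_tderiv_eq dS _; rewrite mul0r add0r /cst /mean.
  rewrite /discrete_rate !big_split/= !mulrDr addrC; congr (_ + _).
  rewrite [RHS]sum_by_parts; under eq_bigr do rewrite mulrC.
  rewrite sum_by_parts; congr (- _ / _).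
  by apply: eq_bigr => k _; rewrite mulrC.
have FTC : (\int[@lebesgue_measure R]_(t in [set` `[0%R, T]]) (mean (discrete_rate i t))%:E =
    (Q T - Q 0)%:E)%E.
  have dQ' (x : R) : x \in `]0%R, T[ -> is_derive x 1 Q (mean (discrete_rate i x)).
    by rewrite in_itv/= => /andP[x0 _]; exact: dQ.
  rewrite EFinB; apply: continuous_FTC2 => //.
  - exact: continuous_subspaceT.
  - split; last 2 first.
    + by apply: cvg_at_right_filter; exact: Qc.
    + by apply: cvg_at_left_filter; exact: Qc.
    by move=> x /dQ' [].
  - by move=> x /dQ' [_ <-]; rewrite derive1E.
rewrite /Rintegral FTC/=.
have -> : Q T = 0.
  rewrite /Q /mean big1 ?mulr0// => k _.
  by rewrite (test_supp phiT)// mulr0.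
rewrite sub0r; congr (- _); rewrite /Q; congr mean; apply/funext => k.
by rewrite frozenE// u_sol.1.
Qed.

End DiscreteIdentity.

(** * Pointwise consistency error of the scheme *)

Section PointwiseError.
Variables (R : realType) (n : nat) (D : 'I_n -> R) (A : 'I_n -> 'I_n -> R).
Hypothesis D_ge0 : forall i, 0 <= D i.
Hypothesis A_ge0 : forall i j, 0 <= A i j.

(** The flux as a function of the vector of values at one point, meaningful for interpolants and for
    the limit; it is [flux] on a grid with a single node. *)
Definition point_flux (a : 'I_n -> R) i : R := D i * a i + a i * \sum_j A i j * a j.

Local Notation L := (total_rate D A).

Lemma point_flux_dist (B : R) (a b : 'I_n -> R) i :
  (forall j, `|a j| <= B) -> (forall j, `|b j| <= B) ->
  `|point_flux a i - point_flux b i| <= L * (1 + 2 * B) * \sum_j `|a j - b j|.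
Proof.
exact: (@flux_dist R n 0 D A D_ge0 A_ge0 B (fun j _ => a j) (fun j _ => b j) i ord0).
Qed.

Lemma periodic_dlaplacian m (g : R -> R) (k : 'I_m.+1) : periodic g 1 ->
  let h := mesh R m in
  dlaplacian (fun l : 'I_m.+1 => g (l%:R * h)) k =
  (g (k%:R * h + h) + g (k%:R * h - h) - 2 * g (k%:R * h)) / h ^+ 2.
Proof.
move=> gper h; have mh : m.+1%:R * h = 1 := mesh1 R m.
have S : g ((ordS k)%:R * h) = g (k%:R * h + h).
  have -> : k%:R * h + h = k.+1%:R * h by rewrite -natr1; ring.
  rewrite /=; have := ltn_ord k; rewrite leq_eqVlt => /predU1P[[->]|km].
    by rewrite modnn mul0r mh -[1]add0r gper.
  by rewrite modn_small.
have Pd : g ((ord_pred k)%:R * h) = g (k%:R * h - h).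
  rewrite /= addnS /=; case: (posnP k) => [->|k0].
    rewrite add0n modn_small// mul0r sub0r -[RHS]gper; congr g.
    by move: mh; rewrite -natr1 mulrDl mul1r; set y := _ * h; lra.
  have -> : (k + m = k.-1 + m.+1)%N by rewrite addnS -addSn prednK.
  rewrite modnDr modn_small; last by rewrite (leq_ltn_trans (leq_pred _)).
  by congr g; rewrite -[in RHS](prednK k0) -natr1; ring.
by rewrite /dlaplacian S Pd.
Qed.

Variables (m : nat) (u : 'I_n -> R -> 'I_m.+1 -> R) (B0 C E : R) (P : R -> R).
Local Notation W := (frozen u).
Local Notation h := (mesh R m).
Hypothesis B00 : 0 <= B0.
Hypothesis C0 : 0 <= C.
Hypothesis WP : controlled B0 C E W P.
Variables (T : R) (phi phit phixx : R -> R -> R).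
Hypothesis phiT : test_extension T phi phit phixx.
Variables (c e : R).
Hypothesis phit_le : forall t x : R, 0 <= t <= T -> -1 <= x <= 2 -> `|phit t x| <= c.
Hypothesis phixx_le : forall t x : R, 0 <= t <= T -> -1 <= x <= 2 -> `|phixx t x| <= c.
Hypothesis phit_unif : forall t x y : R, 0 <= t <= T -> -1 <= x <= 2 -> `|y - x| <= h ->
  `|phit t y - phit t x| <= e.
Hypothesis phixx_unif : forall t x y : R, 0 <= t <= T -> -1 <= x <= 2 -> `|y - x| <= h ->
  `|phixx t y - phixx t x| <= e.

Local Notation K := (10 + 8 * cube_const B0).

(** Interpolation errors carry the factor [Num.sqrt h], those on the test function its modulus of
    continuity [e]; both tend to 0 with the mesh. *)
Definition error_rate : R :=
  (1 + L) * c * n%:R * Num.sqrt h * (K + 1) + (1 + 2 * L * n%:R) * K * e.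

(** Interpolants are replaced by node values, and the test function and its second derivative by
    node values and a second difference. The flux is Lipschitz with constant of order [1 + 2 * S]
    only, but [(1 + 2 * S) ^+ 2] is bounded by a multiple of the height and squared increments by
    [h] times the height; Young's inequality balanced by [Num.sqrt h] makes the product linear in
    the height. *)
Lemma weak_error_pointwise i (t x : R) : 0 <= t <= T -> @torus R x ->
  `|(interpolant (W i t) x * phit t x +
     point_flux (fun j => interpolant (W j t) x) i * phixx t x) -
    stepf (discrete_rate D A u phi phit i t) x| <= error_rate * heightt W t.
Proof.
move=> tT Tx; have [k kx] := torus_cell m Tx; have h0 := mesh_gt0 R m.
have W0 j r l : 0 <= W j r l by case: WP => _ [].
rewrite (stepf_cell _ kx) /discrete_rate; set X := k%:R * h.
have [S [S0 WS S3]] := sup_heightt B00 WP t.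
have S2 : (1 + 2 * S) ^+ 2 <= K * heightt W t := sup_sqr_height B00 S0 S3.
set H := heightt W t in S2 *.
have [x0 x1] : 0 <= x /\ x <= 1.
  by move: Tx; rewrite /torus/= in_itv/= => /andP[-> /ltW].
have [Xx xX] : X <= x /\ x <= X + h.
  move: (kx); rewrite /cell/= in_itv/= => /andP[? /ltW].
  by rewrite -natr1 mulrDl mul1r.
have h1 : h <= 1 by rewrite /mesh invf_le1 ?ltr0n// ler1n.
have X0 : 0 <= X by rewrite mulr_ge0// ltW.
have X12 : -1 <= X <= 2 by apply/andP; split; lra.
have x12 : -1 <= x <= 2 by apply/andP; split; lra.
have xXh : `|x - X| <= h by rewrite ler_norml; apply/andP; split; lra.
have e0 : 0 <= e := le_trans (normr_ge0 _) (phit_unif tT X12 xXh).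
have c0 : 0 <= c := le_trans (normr_ge0 _) (phit_le tT X12).
have L0 : 0 <= L := total_rate_ge0 D_ge0 A_ge0.
pose f j := interpolant (W j t) x; pose w j := W j t k.
have f_itv j : 0 <= f j <= S by apply: interpolant_itv => // l; rewrite W0 WS.
have fS j : `|f j| <= S by have /andP[a b] := f_itv j; rewrite ger0_norm.
have wS j : `|w j| <= S by rewrite ger0_norm; [exact: WS | exact: W0].
pose d : R := \sum_j `|f j - w j|; pose s := Num.sqrt h.
have s0 : 0 < s by rewrite sqrtr_gt0.
have ss : s ^+ 2 = h by rewrite sqr_sqrtr// ltW.
have Sd : (1 + 2 * S) * d <= n%:R * s * (K + 1) * H.
  rewrite /d mulr_sumr; have -> : n%:R * s * (K + 1) * H = \sum_(j < n) s * (K + 1) * H.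
    by rewrite sumr_const card_ord -mulr_natl; ring.
  apply: ler_sum => j _.
  apply: (@le_trans _ _ ((1 + 2 * S) * `|delta (W j t) k|)).
    rewrite ler_wpM2l ?addr_ge0 ?mulr_ge0//.
    exact: interpolant_dist.
  have dl : delta (W j t) k ^+ 2 <= h * H by exact: delta_sqr_le.
  set y := `|delta _ _|; have y2 : y ^+ 2 <= s ^+ 2 * H.
    by rewrite ss /y real_normK ?num_real.
  rewrite -(ler_pM2l s0).
  have -> : s * (s * (K + 1) * H) = s ^+ 2 * (K * H) + s ^+ 2 * H by ring.
  apply: (@le_trans _ _ (s ^+ 2 * (1 + 2 * S) ^+ 2 + y ^+ 2)); last first.
    by apply: lerD => //; rewrite ler_wpM2l ?sqr_ge0.
  have := sqr_ge0 (s * (1 + 2 * S) - y); have := sqr_ge0 (s * (1 + 2 * S)).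
  have := sqr_ge0 y; rewrite !exprMn; set q := 1 + 2 * S.
  have -> : (s * q - y) ^+ 2 = s ^+ 2 * q ^+ 2 - 2 * (s * (q * y)) + y ^+ 2 by ring.
  lra.
have d0 : 0 <= d by exact: sumr_ge0.
have fwd : `|f i - w i| <= d by rewrite /d (bigD1 i)//= lerDl sumr_ge0.
have q1 : 1 <= 1 + 2 * S by rewrite lerDl mulr_ge0.
have H0 : 0 <= H by exact: le_trans ler01 (height_ge1 _).
have SK : S <= K * H.
  apply: le_trans S2; rewrite expr2; apply: (@le_trans _ _ (1 * (1 + 2 * S))); first by lra.
  by rewrite ler_wpM2r// (le_trans ler01).
have t1 : `|f i * phit t x - w i * phit t X| <= (1 + 2 * S) * d * c + K * H * e.
  have -> : f i * phit t x - w i * phit t X =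
    (f i - w i) * phit t x + w i * (phit t x - phit t X) by ring.
  apply: le_trans (ler_normD _ _) _; rewrite !normrM; apply: lerD.
    apply: ler_pM => //; last exact: phit_le.
    by apply: le_trans fwd _; rewrite ler_peMl.
  apply: ler_pM => //; last exact: phit_unif.
  exact: le_trans (wS i) SK.
have fluxE : flux D A (fun j => W j t) i k = point_flux w i by [].
have pf : `|point_flux w i| <= L * n%:R * (K * H).
  have z0 : point_flux (fun=> 0) i = 0 by rewrite /point_flux mulr0 mul0r addr0.
  have z1 (j : 'I_n) : `|(fun=> 0 : R) j| <= S by rewrite normr0.
  have := point_flux_dist i wS z1; rewrite z0 subr0 => /le_trans; apply.
  rewrite -!mulrA; apply: ler_wpM2l => //.
  apply: (@le_trans _ _ ((1 + 2 * S) * (n%:R * S))).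
    rewrite ler_wpM2l ?(le_trans ler01)//.
    have -> : n%:R * S = \sum_(j < n) S by rewrite sumr_const card_ord mulr_natl.
    by apply: ler_sum => j _; rewrite subr0.
  rewrite mulrCA ler_wpM2l//; apply: le_trans S2; rewrite expr2 ler_wpM2l ?(le_trans ler01)//.
  by clear z1; lra.
have lap : `|dlaplacian (fun l : 'I_m.+1 => phi t (l%:R * h)) k - phixx t X| <= e.
  rewrite periodic_dlaplacian; last exact: test_per phiT t.
  have [g gP] := test_dxx phiT t.
  apply: (second_difference (g' := g)) => //.
  - by move=> y; exact: (gP y).1.
  - by move=> y; exact: (gP y).2.
  - by move=> y yX; exact: phixx_unif.
have t2 : `|point_flux f i * phixx t x -
    flux D A (fun j => W j t) i k * dlaplacian (fun l : 'I_m.+1 => phi t (l%:R * h)) k| <=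
    L * ((1 + 2 * S) * d) * c + L * n%:R * (K * H) * (2 * e).
  rewrite fluxE; set lp := dlaplacian _ _ in lap *.
  have -> : point_flux f i * phixx t x - point_flux w i * lp =
    (point_flux f i - point_flux w i) * phixx t x +
    point_flux w i * ((phixx t x - phixx t X) - (lp - phixx t X)) by ring.
  apply: le_trans (ler_normD _ _) _; rewrite !normrM; apply: lerD.
    apply: ler_pM => //; last exact: phixx_le.
    by rewrite mulrA; exact: point_flux_dist.
  apply: ler_pM => //; apply: le_trans (ler_normB _ _) _.
  have := phixx_unif tT X12 xXh; move: lap; lra.
rewrite -/(f i) -/(w i) -/f opprD addrACA.
apply: le_trans (ler_normD _ _) _; apply: le_trans (lerD t1 t2) _.
rewrite /error_rate -/s.
have -> : ((1 + L) * c * n%:R * s * (K + 1) + (1 + 2 * L * n%:R) * K * e) * H =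
  (1 + L) * c * (n%:R * s * (K + 1) * H) + (1 + 2 * L * n%:R) * (K * H * e) by ring.
have : (1 + L) * c * ((1 + 2 * S) * d) <= (1 + L) * c * (n%:R * s * (K + 1) * H).
  by rewrite ler_wpM2l// mulr_ge0// addr_ge0.
set a := (1 + 2 * S) * d; set b := n%:R * s * _ * H; set g := K * H.
have -> : a * c + g * e + (L * a * c + L * n%:R * g * (2 * e)) =
  (1 + L) * c * a + (1 + 2 * L * n%:R) * (g * e) by ring.
by move=> ?; rewrite lerD2r.
Qed.

End PointwiseError.

(** * Convergence of the quadratic integrand *)

(** If [|a| <= lam] the first term suffices; otherwise [|a * b| <= a ^+ 2 * |b| / lam], which Young
    bounds by the second. For [b] small in L^1 and both factors bounded in L^4, a large [lam] makes
    the product small in L^1. *)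
Lemma norm_mul_le (R : realFieldType) (lam a b : R) : 0 < lam ->
  `|a * b| <= lam * `|b| + (1 + a ^+ 4 + b ^+ 4) / lam.
Proof.
move=> l0; rewrite normrM.
have na : a ^+ 4 = `|a| ^+ 4 by rewrite -normrX ger0_norm// exprn_even_ge0.
have nb : b ^+ 4 = `|b| ^+ 4 by rewrite -normrX ger0_norm// exprn_even_ge0.
rewrite na nb; set x := `|a|; set y := `|b|.
have x0 : 0 <= x by exact: normr_ge0.
have y0 : 0 <= y by exact: normr_ge0.
have q0 : 0 <= 1 + x ^+ 4 + y ^+ 4 by rewrite !addr_ge0 ?exprn_ge0.
have [xl|/ltW lx] := leP x lam.
  apply: (@le_trans _ _ (lam * y)); first by rewrite ler_wpM2r.
  by rewrite lerDl divr_ge0// ltW.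
apply: (@le_trans _ _ ((1 + x ^+ 4 + y ^+ 4) / lam)); last by rewrite lerDr mulr_ge0// ltW.
rewrite ler_pdivlMr//; apply: (@le_trans _ _ (x * y * x)).
  by rewrite ler_wpM2l// mulr_ge0.
have := sqr_ge0 (x ^+ 2 - y); have := sqr_ge0 (y ^+ 2 - 1); have := sqr_ge0 (x ^+ 2).
have -> : (x ^+ 2 - y) ^+ 2 = x ^+ 4 - 2 * (x * y * x) + y ^+ 2 by ring.
have -> : (y ^+ 2 - 1) ^+ 2 = y ^+ 4 - 2 * y ^+ 2 + 1 by ring.
have -> : (x ^+ 2) ^+ 2 = x ^+ 4 by ring.
have : 0 <= y ^+ 4 by rewrite exprn_ge0.
lra.
Qed.

Lemma abs_le_pow4 (R : realFieldType) (a : R) : `|a| <= 1 + a ^+ 4.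
Proof.
have -> : a ^+ 4 = `|a| ^+ 4 by rewrite -normrX ger0_norm// exprn_even_ge0.
set x := `|a|; have x0 : 0 <= x by exact: normr_ge0.
have [x1|/ltW x1] := leP x 1; first by rewrite (le_trans x1)// lerDl exprn_ge0.
by rewrite exprS (@le_trans _ _ (x * x ^+ 3))// ?lerDr// ler_peMr// exprn_ege1.
Qed.

Section WeakIntegrand.
Variables (R : realType) (n : nat) (D : 'I_n -> R) (A : 'I_n -> 'I_n -> R).
Hypothesis D_ge0 : forall i, 0 <= D i.
Hypothesis A_ge0 : forall i j, 0 <= A i j.
Local Notation MR := (measurableTypeR R).
Local Notation L := (total_rate D A).
Variables (T c : R).
Hypothesis T0 : 0 < T.
Implicit Types (p q : MR * MR -> R) (v w : 'I_n -> MR * MR -> R).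

Definition integrand p q v (i : 'I_n) z : R :=
  v i z * p z + point_flux D A (v ^~ z) i * q z.

Lemma measurable_integrand p q v i : measurable_fun setT p -> measurable_fun setT q ->
  (forall j, measurable_fun setT (v j)) -> measurable_fun setT (integrand p q v i).
Proof.
move=> mp mq mv; apply: measurable_funD; first exact: measurable_funM.
apply: measurable_funM => //; apply: measurable_funD.
  by apply: measurable_funM.
apply: measurable_funM => //; apply: measurable_sum => j.
exact: measurable_funM.
Qed.

(** With [b = v - w], the quadratic part of the difference is a sum of products
    [v j * b i + w i * b j], each handled by [norm_mul_le]. *)
Lemma integrand_dist p q v w i z (lam : R) : 0 < lam -> `|p z| <= c -> `|q z| <= c ->
  `|integrand p q v i z - integrand p q w i z| <=
  c * (1 + L + 2 * L * lam) * \sum_j `|v j z - w j z| +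
  c * L / lam * (2 + 18 * \sum_j (v j z ^+ 4 + w j z ^+ 4)).
Proof.
move=> l0 pz qz; have c0 : 0 <= c := le_trans (normr_ge0 _) pz.
have L0 : 0 <= L := total_rate_ge0 D_ge0 A_ge0.
pose b j := v j z - w j z.
set be := \sum_j `|_|; set Q := \sum_j (_ + _).
have v4 j : 0 <= v j z ^+ 4 by rewrite exprn_even_ge0.
have w4 j : 0 <= w j z ^+ 4 by rewrite exprn_even_ge0.
have bb j : `|b j| <= be by rewrite /be (bigD1 j)//= lerDl sumr_ge0.
have vwQ j : v j z ^+ 4 + w j z ^+ 4 <= Q.
  by rewrite /Q (bigD1 j)//= lerDl sumr_ge0// => k _; rewrite addr_ge0.
have b4 j : b j ^+ 4 <= 8 * Q.
  apply: (@le_trans _ _ (8 * (v j z ^+ 4 + w j z ^+ 4))); last by rewrite ler_pM2l.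
  rewrite /b; set x := v j z; set y := w j z; rewrite -subr_ge0.
  have -> : 8 * (x ^+ 4 + y ^+ 4) - (x - y) ^+ 4 =
    2 * (x ^+ 2 + x * y) ^+ 2 + 2 * (y ^+ 2 + x * y) ^+ 2 + 5 * (x ^+ 2 - y ^+ 2) ^+ 2 by ring.
  have h1 := sqr_ge0 (x ^+ 2 + x * y); have h2 := sqr_ge0 (y ^+ 2 + x * y).
  by have h3 := sqr_ge0 (x ^+ 2 - y ^+ 2); lra.
have prod_le (a : R) j : a ^+ 4 <= Q -> `|a * b j| <= lam * be + (1 + 9 * Q) / lam.
  move=> aQ; apply: le_trans (norm_mul_le _ _ l0) _; apply: lerD.
    by rewrite ler_pM2l.
  by rewrite ler_pM2r ?invr_gt0//; have := b4 j; move: aQ; lra.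
have vQ j : v j z ^+ 4 <= Q by apply: le_trans (vwQ j); rewrite lerDl.
have wQ j : w j z ^+ 4 <= Q by apply: le_trans (vwQ j); rewrite lerDr.
have -> : integrand p q v i z - integrand p q w i z = b i * p z +
   (D i * b i + \sum_j A i j * (v j z * b i + w i z * b j)) * q z.
  rewrite /integrand /point_flux.
  have -> : \sum_j A i j * (v j z * b i + w i z * b j) =
    v i z * (\sum_j A i j * v j z) - w i z * (\sum_j A i j * w j z).
    rewrite !mulr_sumr -sumrB; apply: eq_bigr => j _; rewrite /b; ring.
  by rewrite /b; ring.
have flux_le : `|D i * b i + \sum_j A i j * (v j z * b i + w i z * b j)| <=
    L * be + L * (2 * (lam * be + (1 + 9 * Q) / lam)).
  apply: le_trans (ler_normD _ _) _; apply: lerD.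
    rewrite normrM ger0_norm//; apply: ler_pM => //.
    apply: le_trans (sumA_le_total_rate D_ge0 A_ge0 i).
    by rewrite lerDl sumr_ge0.
  apply: le_trans (ler_norm_sum _ _ _) _.
  set g := 2 * _; have g0 : 0 <= g.
    rewrite mulr_ge0// addr_ge0//; first by rewrite mulr_ge0 ?(ltW l0)// (le_trans (normr_ge0 _) (bb i)).
    by rewrite divr_ge0 ?(ltW l0)// addr_ge0// mulr_ge0// (le_trans (v4 i)).
  apply: (@le_trans _ _ (\sum_j A i j * g)).
    apply: ler_sum => j _; rewrite normrM ger0_norm// ler_wpM2l//.
    rewrite /g mulrDl mul1r; apply: le_trans (ler_normD _ _) _.
    by apply: lerD; exact: prod_le.
  rewrite -mulr_suml ler_wpM2r//; apply: le_trans (sumA_le_total_rate D_ge0 A_ge0 i).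
  by rewrite lerDr.
apply: le_trans (ler_normD _ _) _; rewrite !normrM.
apply: (@le_trans _ _ (be * c + (L * be + L * (2 * (lam * be + (1 + 9 * Q) / lam))) * c)).
  by apply: lerD; apply: ler_pM.
by rewrite le_eqVlt; apply/predU1P; left; field; rewrite gt_eqF.
Qed.

Local Notation "'Int' f" := (\int[leb2 R]_(z in cylinder T) (f z)%:E)%E (at level 10, f at level 8).

Let mD : measurable (cylinder T). Proof. exact: measurable_cylinder. Qed.

Let mE (v : MR * MR -> R) : measurable_fun setT v ->
  measurable_fun (cylinder T) (fun z => (v z)%:E).
Proof. by move=> mv; apply/measurable_EFinP; exact: measurable_funTS. Qed.

Let sum_integral (f : 'I_n -> MR * MR -> R) (a : R) : (forall j, measurable_fun setT (f j)) ->
  (forall j z, 0 <= f j z) ->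
  (forall j, (\int[leb2 R]_(z in cylinder T) (f j z)%:E <= a%:E)%E) ->
  (\int[leb2 R]_(z in cylinder T) (\sum_j f j z)%:E <= (n%:R * a)%:E)%E.
Proof.
move=> mf f0 fa.
under eq_integral do rewrite -sumEFin.
rewrite ge0_integral_sum//; last 2 first.
- by move=> j; exact: mE.
- by move=> j z _; rewrite lee_fin.
have -> : (n%:R * a)%:E = (\sum_(j < n) a%:E)%E.
  by rewrite sumEFin sumr_const card_ord mulr_natl.
exact: lee_sum.
Qed.

Lemma integrand_integral_dist p q v w i (lam eps K : R) : 0 < lam -> 0 <= c ->
  measurable_fun setT p -> measurable_fun setT q ->
  (forall z, `|p z| <= c) -> (forall z, `|q z| <= c) ->
  (forall j, measurable_fun setT (v j)) -> (forall j, measurable_fun setT (w j)) ->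
  (forall j, (\int[leb2 R]_(z in cylinder T) (`|v j z - w j z|)%:E <= eps%:E)%E) ->
  (forall j, (\int[leb2 R]_(z in cylinder T) (v j z ^+ 4)%:E <= K%:E)%E) ->
  (forall j, (\int[leb2 R]_(z in cylinder T) (w j z ^+ 4)%:E <= K%:E)%E) ->
  (\int[leb2 R]_(z in cylinder T) (`|integrand p q v i z - integrand p q w i z|)%:E <=
   (c * (1 + L + 2 * L * lam) * (n%:R * eps) +
    c * L / lam * (2 * T + 18 * (n%:R * (2 * K))))%:E)%E.
Proof.
move=> l0 c0 mp mq pc qc mv mw vweps vK wK.
have L0 : 0 <= L := total_rate_ge0 D_ge0 A_ge0.
set a1 := c * _; set a2 := c * L / lam.
have a10 : 0 <= a1.
  rewrite /a1; apply: mulr_ge0 => //; apply: addr_ge0; first exact: addr_ge0.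
  by apply: mulr_ge0 (ltW l0); exact: mulr_ge0.
have a20 : 0 <= a2 by apply: divr_ge0 (ltW l0); exact: mulr_ge0.
pose be z := \sum_j `|v j z - w j z|; pose Q z := \sum_j (v j z ^+ 4 + w j z ^+ 4).
have mb j : measurable_fun setT (fun z => `|v j z - w j z|).
  by apply: measurableT_comp => //; exact: measurable_funB.
have mv4 j : measurable_fun setT (fun z => v j z ^+ 4) by exact: measurable_funX.
have mw4 j : measurable_fun setT (fun z => w j z ^+ 4) by exact: measurable_funX.
have mbe : measurable_fun setT be by exact: measurable_sum.
have mQ : measurable_fun setT Q by apply: measurable_sum => j; exact: measurable_funD.
have v4 j z : 0 <= v j z ^+ 4 by rewrite exprn_even_ge0.
have w4 j z : 0 <= w j z ^+ 4 by rewrite exprn_even_ge0.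
have be0 z : 0 <= be z by exact: sumr_ge0.
have Q0 z : 0 <= Q z by apply: sumr_ge0 => j _; exact: addr_ge0.
have Ibe : (\int[leb2 R]_(z in cylinder T) (be z)%:E <= (n%:R * eps)%:E)%E by exact: sum_integral.
have IQ : (\int[leb2 R]_(z in cylinder T) (Q z)%:E <= (n%:R * (2 * K))%:E)%E.
  apply: sum_integral => [j|j z|j]; [exact: measurable_funD | exact: addr_ge0 |].
  under eq_integral do rewrite EFinD.
  rewrite ge0_integralD//; try by [move=> z _; rewrite lee_fin]; try exact: mE.
  have -> : (2 * K)%:E = (K%:E + K%:E)%E by rewrite -EFinD; congr (_%:E); ring.
  exact: leeD.
apply: (@le_trans _ _ (\int[leb2 R]_(z in cylinder T)
   (a1%:E * (be z)%:E + a2%:E * (2%:E + 18%:E * (Q z)%:E)))%E).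
  apply: (ge0_le_integral (leb2 R) mD).
  - by move=> z _; rewrite lee_fin.
  - apply: mE; apply: measurableT_comp => //.
    by apply: measurable_funB; exact: measurable_integrand.
  - apply: emeasurable_funD; first by apply: emeasurable_funM => //; exact: mE.
    apply: emeasurable_funM => //; apply: emeasurable_funD => //.
    by apply: emeasurable_funM => //; exact: mE.
  - move=> z _; rewrite -!EFinM -!EFinD lee_fin.
    exact: integrand_dist.
have m18 : measurable_fun (cylinder T) (fun z => 18%:E * (Q z)%:E)%E.
  by apply: emeasurable_funM => //; exact: mE.
have m2 : measurable_fun (cylinder T) (fun z => 2%:E + 18%:E * (Q z)%:E)%E.
  exact: emeasurable_funD.
have h18 z : (0 <= 18%:E * (Q z)%:E)%E by rewrite mule_ge0// lee_fin.
have h2 z : (0 <= 2%:E + 18%:E * (Q z)%:E)%E by rewrite adde_ge0// lee_fin.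
rewrite ge0_integralD//; last 4 first.
- by move=> z _; rewrite mule_ge0// lee_fin.
- by apply: emeasurable_funM => //; exact: mE.
- by move=> z _; rewrite mule_ge0// lee_fin.
- exact: emeasurable_funM.
rewrite ge0_integralZl ?lee_fin//; last 2 first.
- exact: mE.
- by move=> z _; rewrite lee_fin.
rewrite ge0_integralZl ?lee_fin// [leRHS]EFinD; apply: leeD.
  by rewrite [leRHS]EFinM lee_wpmul2l ?lee_fin.
rewrite [leRHS]EFinM lee_wpmul2l ?lee_fin//.
rewrite ge0_integralD// integral_cst// measure_cylinder// [leRHS]EFinD -EFinM leeD2l//.
rewrite ge0_integralZl ?lee_fin//; last 2 first.
- exact: mE.
- by move=> z _; rewrite lee_fin.
by rewrite [leRHS]EFinM lee_wpmul2l ?lee_fin.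
Qed.

(** Comparison with the zero vector, at which the integrand vanishes: the distance estimate with
    [lam = 1] is then an L^1 bound. *)
Lemma integrable_integrand p q v i (K : R) : 0 <= c ->
  measurable_fun setT p -> measurable_fun setT q ->
  (forall z, `|p z| <= c) -> (forall z, `|q z| <= c) ->
  (forall j, measurable_fun setT (v j)) ->
  (forall j, (\int[leb2 R]_(z in cylinder T) (v j z ^+ 4)%:E <= K%:E)%E) ->
  (leb2 R).-integrable (cylinder T) (EFin \o integrand p q v i).
Proof.
move=> c0 mp mq pc qc mv vK; apply/integrableP; split.
  by apply: mE; exact: measurable_integrand.
have v4 j z : 0 <= v j z ^+ 4 by rewrite exprn_even_ge0.
have K0 : 0 <= K.
  by rewrite -lee_fin; apply: le_trans (vK i); apply: integral_ge0 => z _; rewrite lee_fin.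
have vT j : (\int[leb2 R]_(z in cylinder T) (`|v j z - 0|)%:E <= (T + K)%:E)%E.
  apply: (@le_trans _ _ (\int[leb2 R]_(z in cylinder T) (1%:E + (v j z ^+ 4)%:E))%E).
    apply: (ge0_le_integral (leb2 R) mD).
    - by move=> z _; rewrite lee_fin.
    - by apply: mE; under eq_fun do rewrite subr0; exact: measurableT_comp.
    - by apply: emeasurable_funD => //; apply: mE; exact: measurable_funX.
    - by move=> z _; rewrite subr0 -EFinD lee_fin abs_le_pow4.
  rewrite ge0_integralD//; last 2 first.
  - by move=> z _; rewrite lee_fin.
  - by apply: mE; exact: measurable_funX.
  by rewrite integral_cst// measure_cylinder// mul1e EFinD leeD2l.
have z4 : forall _ : 'I_n, (\int[leb2 R]_(z in cylinder T) (0 ^+ 4 : R)%:E <= K%:E)%E.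
  by move=> _; rewrite expr0n/= integral0 lee_fin.
have z0 z : integrand p q (fun _ _ => 0) i z = 0.
  by rewrite /integrand /point_flux !(mulr0, mul0r, addr0).
have := @integrand_integral_dist p q v (fun _ _ => 0) i 1 (T + K) K ltr01 c0 mp mq pc qc mv
  (fun=> measurable_cst _) vT vK z4.
under eq_integral do rewrite z0 subr0.
by move=> /le_lt_trans; apply; exact: ltry.
Qed.

End WeakIntegrand.

(** * Passage to the limit in the weak formulation *)

Lemma Rintegral_dist_le d (S : measurableType d) (R : realType)
    (mu : {measure set S -> \bar R}) (X : set S) (f g : S -> R) (e : R) :
  measurable X -> mu.-integrable X (EFin \o f) -> mu.-integrable X (EFin \o g) ->
  (\int[mu]_(x in X) (`|f x - g x|)%:E <= e%:E)%E ->
  `|\int[mu]_(x in X) f x - \int[mu]_(x in X) g x| <= e.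
Proof.
move=> mX fi gi fge; have fgi := integrableB mX fi gi.
rewrite -RintegralB// -lee_fin EFin_normr_Rintegral//.
exact: le_trans (le_abse_integral mu mX (measurable_int _ fgi)) _.
Qed.

(** Measurability for the product sigma-algebra comes from approximation by functions that are
    continuous in time and step functions in space. *)
Lemma measurable_cylinder_continuous (R : realType) (T : R) (f : R -> R -> R) :
  continuous (fun z : R * R => f z.1 z.2) ->
  measurable_fun (cylinder T)
    (fun z : measurableTypeR R * measurableTypeR R => f z.1 z.2).
Proof.
move=> fc.
have fs (x : R) : continuous (fun t : R => f t x).
  move=> t; apply: (@continuous_comp _ _ _ (fun t : R => (t, x)) (fun z => f z.1 z.2)).
    have c1 : (fun s : R => s) @ nbhs t --> t by exact: cvg_id.
    have c2 : (fun _ : R => x) @ nbhs t --> x by exact: cvg_cst.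
    exact: (cvg_pair c1 c2).
  exact: fc.
have [_ unif] := @rectangle_uniform R _ T 0 1 fc.
apply/measurable_EFinP.
apply: (emeasurable_fun_cvg
  (fun m z => (stepf (fun k : 'I_m.+1 => f z.1 (k%:R * mesh R m)) z.2)%:E)).
  move=> m; apply/measurable_EFinP/measurable_funTS.
  exact: (@measurable_stepf2 R m (fun t (k : 'I_m.+1) => f t (k%:R * mesh R m)) (fun k => fs _)).
move=> [t x] [/= tT Tx]; apply: cvg_EFin; first by near=> m.
apply/cvgrPdist_le => e e0; have [dl dl0 dlP] := unif e e0.
have [q qP] := ex_mesh_le dl0; exists q => // m /= qm.
have [k kx] := torus_cell m Tx; rewrite (stepf_cell _ kx).
move: tT Tx kx; rewrite /torus /cell /= !in_itv/= => tT /andP[x0 x1] /andP[kx xk].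
have h0 := mesh_gt0 R m.
rewrite distrC; apply: (dlP t x (k%:R * mesh R m)); rewrite ?tT ?x0 ?(ltW x1)//.
apply: le_trans (le_trans (mesh_le _ qm) qP).
move: xk; rewrite -natr1 mulrDl mul1r => xk.
by rewrite ler_norml; apply/andP; split; lra.
Unshelve. all: by end_near.
Qed.

Lemma riemann_sum_dist (R : realType) m (F : R -> R) (e : R) : continuous F ->
  (forall x y : R, 0 <= x <= 1 -> `|y - x| <= mesh R m -> `|F y - F x| <= e) ->
  `|\int[@lebesgue_measure R]_(x in @torus R) F x -
    mean (fun k : 'I_m.+1 => F (k%:R * mesh R m))| <= e.
Proof.
move=> Fc Fe; set s := fun k : 'I_m.+1 => F (k%:R * mesh R m).
have mT := @measurable_torus R; have mF := continuous_measurable_fun Fc.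
have [b _ bP] := continuous_bounded01 Fc.
have ms := measurable_stepf s.
have -> : mean s = \int[@lebesgue_measure R]_(x in @torus R) stepf s x.
  by rewrite /Rintegral integral_stepf.
apply: Rintegral_dist_le => //.
- exact: (torus_bounded_integrable mF bP).
- exact: (torus_bounded_integrable ms (fun x => @stepf_bounded R m s x)).
rewrite -[leRHS]integral_torus_cst; apply: ge0_le_integral => //.
- apply/measurable_EFinP/measurable_funTS; apply: measurableT_comp => //.
  exact: measurable_funB.
- move=> x Tx; rewrite lee_fin; have [k kx] := torus_cell m Tx; rewrite (stepf_cell _ kx).
  move: Tx kx; rewrite /torus /cell /= !in_itv/= => /andP[x0 x1] /andP[kx xk].
  have h0 := mesh_gt0 R m.
  rewrite distrC; apply: Fe; first by rewrite x0 ltW.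
  move: xk; rewrite -natr1 mulrDl mul1r => xk.
  by rewrite ler_norml; apply/andP; split; lra.
Qed.

Section WeakLimit.
Variables (R : realType) (n : nat) (D : 'I_n -> R) (A : 'I_n -> 'I_n -> R).
Hypothesis D_ge0 : forall i, 0 <= D i.
Hypothesis A_ge0 : forall i j, 0 <= A i j.
Variable u0 : 'I_n -> R -> R.
Hypothesis u0_cont : forall i, continuous (u0 i).
Variables (B0 C E : R) (U : forall m : nat, 'I_n -> R -> 'I_m.+1 -> R) (P : nat -> R -> R).
Local Notation W := (fun m => frozen (@U m)).
Hypothesis B00 : 0 <= B0.
Hypothesis C0 : 0 <= C.
Hypothesis U_sol : forall m, discrete_solution D A u0 (@U m).
Hypothesis WP : forall m, controlled B0 C E (W m) (P m).
Local Notation MR := (measurableTypeR R).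
Local Notation mu := (@lebesgue_measure R).
Variable sigma : nat -> nat.
Hypothesis sigma_homo : {homo sigma : a b / (a < b)%N}.
Hypothesis sigmaP : forall q M N i, (q <= M)%N -> (q <= N)%N ->
    (\int[leb2 R]_(z in cylinder q.+1%:R)
       (`|interp W (sigma M) i z - interp W (sigma N) i z|)%:E <=
     (2 / (2 ^ q.+1)%:R)%:E)%E.
Variables (T : R) (phi phit phixx : R -> R -> R).
Hypothesis T0 : 0 < T.
Hypothesis phiT : test_extension T phi phit phixx.

Local Notation L := (total_rate D A).
(** The test functions are cut off outside the cylinder, so that they are bounded at every point, as
    the integral estimates require. *)
Local Notation on_cylinder f := ((fun z : MR * MR => f z.1 z.2) \_ (cylinder T)).
Local Notation p := (on_cylinder phit).
Local Notation q := (on_cylinder phixx).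
Local Notation K4 := (2 * B0 * cube_const B0 * (T + E)).

Let mD : measurable (cylinder T : set (MR * MR)). Proof. exact: measurable_cylinder. Qed.

Let measurable_patch (f : R -> R -> R) : continuous (fun z : R * R => f z.1 z.2) ->
  measurable_fun setT (on_cylinder f).
Proof.
move=> fc; apply/(measurable_restrictT _ _).1 => //.
exact: (@measurable_cylinder_continuous R T f fc).
Qed.

Let mp : measurable_fun setT p. Proof. exact: (@measurable_patch phit (test_dt_cont phiT)). Qed.
Let mq : measurable_fun setT q. Proof. exact: (@measurable_patch phixx (test_dxx_cont phiT)). Qed.

Lemma test_bound : exists2 c, 0 <= c &
  (forall t x : R, 0 <= t <= T -> -1 <= x <= 2 -> `|phit t x| <= c) /\
  (forall t x : R, 0 <= t <= T -> -1 <= x <= 2 -> `|phixx t x| <= c).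
Proof.
have [[c1 c10 c1P] _] := @rectangle_uniform R _ T (-1) 2 (test_dt_cont phiT).
have [[c2 c20 c2P] _] := @rectangle_uniform R _ T (-1) 2 (test_dxx_cont phiT).
exists (c1 + c2); first exact: addr_ge0.
split=> t x tT xI.
  by rewrite (le_trans (c1P t x tT xI))// lerDl.
by rewrite (le_trans (c2P t x tT xI))// lerDr.
Qed.

Let patch_le (f : R -> R -> R) (c : R) z : 0 <= c ->
  (forall t x : R, 0 <= t <= T -> -1 <= x <= 2 -> `|f t x| <= c) ->
  `|on_cylinder f z| <= c.
Proof.
move=> c0 fc; rewrite /patch; case: ifPn => [/set_mem|_]; last by rewrite normr0.
case: z => t x [/=]; rewrite /torus/= !in_itv/= => tT /andP[x0 x1]; apply: fc => //.
by apply/andP; split; lra.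
Qed.

Let v_L4 (v : MR * MR -> R) : (\int[leb2 R]_(z in cylinder T) (`|v z ^+ 4|)%:E <= K4%:E)%E ->
  (\int[leb2 R]_(z in cylinder T) (v z ^+ 4)%:E <= K4%:E)%E.
Proof.
move=> h; apply: le_trans h; rewrite le_eqVlt; apply/predU1P; left.
by apply: eq_integral => z _; rewrite ger0_norm// exprn_even_ge0.
Qed.

Lemma limit_integrable (p' q' : MR * MR -> R) i (c : R) : 0 <= c ->
  measurable_fun setT p' -> measurable_fun setT q' ->
  (forall z, `|p' z| <= c) -> (forall z, `|q' z| <= c) ->
  (leb2 R).-integrable (cylinder T) (EFin \o integrand D A p' q' (ulim W sigma) i).
Proof.
move=> c0 mp' mq' pc qc.
apply: (integrable_integrand D_ge0 A_ge0 T0 i c0 mp' mq' pc qc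
  (fun j => measurable_ulim WP sigma j) (K := K4)).
by move=> j; apply: v_L4; exact: (ulim_L4 B00 WP sigmaP).
Qed.

Let E0 : 0 <= E. Proof. exact: E_ge0 WP. Qed.
Let K40 : 0 <= K4.
Proof. by rewrite !mulr_ge0 ?cube_const_ge0// addr_ge0// ltW. Qed.

Lemma limit_error i (eta : R) : 0 < eta -> exists N0, forall N, (N0 <= N)%N ->
  (leb2 R).-integrable (cylinder T) (EFin \o integrand D A p q (interp W (sigma N)) i) /\
  (\int[leb2 R]_(z in cylinder T) (`|integrand D A p q (ulim W sigma) i z -
     integrand D A p q (interp W (sigma N)) i z|)%:E <= eta%:E)%E.
Proof.
move=> eta0; have [c c0 [pc qc]] := test_bound.
have L0 : 0 <= L := total_rate_ge0 D_ge0 A_ge0.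
set k := 2 * T + 18 * (n%:R * (2 * K4)).
have k0 : 0 <= k.
  apply: addr_ge0; first exact: mulr_ge0 (ler0n _ 2) (ltW T0).
  exact: mulr_ge0 (ler0n _ 18) (mulr_ge0 (ler0n _ n) (mulr_ge0 (ler0n _ 2) K40)).
have cLk : 0 <= c * L * k by rewrite mulr_ge0// mulr_ge0.
(* [lam] comes first and makes the L^4 part at most [eta / 2]; the L^1 tolerance [eps], chosen
   afterwards, compensates the factor that grows with [lam]. *)
pose lam := (c * L * k + 1) * 2 / eta.
have lam0 : 0 < lam by rewrite divr_gt0// mulr_gt0// ltr_wpDl.
set a := c * (1 + L + 2 * L * lam) * n%:R.
have a0 : 0 <= a.
  apply: mulr_ge0 => //; apply: mulr_ge0 => //; apply: addr_ge0; first exact: addr_ge0.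
  exact: mulr_ge0 (mulr_ge0 (ler0n _ 2) L0) (ltW lam0).
pose eps := eta / 2 / (a + 1).
have eps0 : 0 < eps by rewrite divr_gt0 ?divr_gt0// ltr_wpDl.
have /choice[M MP] : forall j, exists N0, forall N, (N0 <= N)%N ->
  (\int[leb2 R]_(z in cylinder T)
    (`|ulim W sigma j z - interp W (sigma N) j z|)%:E <= eps%:E)%E.
  by move=> j; exact: (ulim_L1 WP sigmaP).
exists (\max_j M j)%N => N NM.
have mi j : measurable_fun setT (interp W (sigma N) j) by exact: (measurable_interp WP).
have i4 j : (\int[leb2 R]_(z in cylinder T) (interp W (sigma N) j z ^+ 4)%:E <= K4%:E)%E.
  by apply: v_L4; exact: (interp_L4 B00 WP).
split.
  exact: (integrable_integrand D_ge0 A_ge0 T0 i c0 mp mq (fun z => patch_le z c0 pc)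
    (fun z => patch_le z c0 qc) mi i4).
have := @integrand_integral_dist R n D A D_ge0 A_ge0 T c T0 p q (ulim W sigma)
  (interp W (sigma N)) i lam eps K4 lam0 c0 mp mq (fun z => patch_le z c0 pc)
  (fun z => patch_le z c0 qc) (fun j => measurable_ulim WP sigma j) mi.
move=> /(_ _ _ i4)/le_trans; apply.
- by move=> j; apply: MP; apply: leq_trans NM; exact: (leq_bigmax j).
- by move=> j; apply: v_L4; exact: (ulim_L4 B00 WP sigmaP).
rewrite lee_fin -/k mulrA -/a.
have h1 : a * eps <= eta / 2.
  rewrite /eps mulrCA ler_piMr ?divr_ge0 ?(ltW eta0)//.
  by rewrite ler_pdivrMr ?ltr_wpDl// mul1r lerDl.
have h2 : c * L / lam * k <= eta / 2.
  rewrite mulrAC ler_pdivrMr//.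
  have -> : eta / 2 * lam = c * L * k + 1 by rewrite /lam; field; rewrite gt_eqF.
  by rewrite lerDl.
by rewrite [leRHS](splitr eta); exact: lerD.
Qed.

Lemma scheme_error i (eta : R) : 0 < eta -> exists N0, forall m, (N0 <= m)%N ->
  measurable_fun setT (fun z : MR * MR => stepf (discrete_rate D A (@U m) phi phit i z.1) z.2) /\
  (\int[leb2 R]_(z in cylinder T) (`|integrand D A p q (interp W m) i z -
     stepf (discrete_rate D A (@U m) phi phit i z.1) z.2|)%:E <= eta%:E)%E.
Proof.
move=> eta0; have [c c0 [pc qc]] := test_bound.
have L0 : 0 <= L := total_rate_ge0 D_ge0 A_ge0.
have [_ tunif] := @rectangle_uniform R _ T (-1) 2 (test_dt_cont phiT).
have [_ xunif] := @rectangle_uniform R _ T (-1) 2 (test_dxx_cont phiT).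
set K := 10 + 8 * cube_const B0.
have K0 : 0 <= K by rewrite addr_ge0// mulr_ge0// cube_const_ge0.
pose a := (1 + L) * c * n%:R * (K + 1); pose b := (1 + 2 * L * n%:R) * K.
have L1 : 0 <= 1 + L by exact: addr_ge0.
have K1 : 0 <= K + 1 by exact: addr_ge0.
have cn0 : 0 <= (1 + L) * c * n%:R := mulr_ge0 (mulr_ge0 L1 c0) (ler0n _ n).
have a0 : 0 <= a := mulr_ge0 cn0 K1.
have b0 : 0 <= b.
  apply: mulr_ge0 => //; apply: addr_ge0 => //.
  exact: mulr_ge0 (mulr_ge0 (ler0n _ 2) L0) (ler0n _ n).
have TE : 0 < T + E by rewrite ltr_wpDr.
(* [error_rate] is integrated against the height, whose integral is at most [T + E]; each of its two
   summands is made at most [g]. *)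
pose g := eta / 2 / (T + E); have g0 : 0 < g by rewrite divr_gt0// divr_gt0.
pose e := g / (b + 1); have e0 : 0 < e by rewrite divr_gt0// ltr_wpDl.
pose r := g / (a + 1); have r0 : 0 < r by rewrite divr_gt0// ltr_wpDl.
have [d1 d10 d1P] := tunif e e0; have [d2 d20 d2P] := xunif e e0.
have rho0 : 0 < Num.min (Num.min d1 d2) (r ^+ 2).
  by rewrite !lt_min d10 d20 exprn_gt0.
have [N0 N0P] := ex_mesh_le rho0; exists N0 => m mN.
have := le_trans (mesh_le R mN) N0P; rewrite !le_min => /andP[/andP[hd1 hd2] hr].
have ms : measurable_fun setT (fun z : MR * MR =>
    stepf (discrete_rate D A (@U m) phi phit i z.1) z.2).
  by apply: measurable_stepf2 => k; exact: (discrete_rate_continuous (U_sol m) phiT).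
split => //.
have mi j : measurable_fun setT (interp W m j) by exact: (measurable_interp WP).
have mG : measurable_fun setT (integrand D A p q (interp W m) i) by exact: measurable_integrand.
set er := error_rate D A m B0 c e.
have er0 : 0 <= er.
  rewrite /er /error_rate; apply: addr_ge0; last exact: mulr_ge0 (ltW e0).
  exact: mulr_ge0 (mulr_ge0 cn0 (sqrtr_ge0 _)) K1.
have er_le : er * (T + E) <= eta.
  have -> : eta = 2 * g * (T + E) by rewrite /g; field; rewrite gt_eqF.
  rewrite ler_pM2r//.
  have -> : er = a * Num.sqrt (mesh R m) + b * e by rewrite /er /error_rate /a /b -/K; ring.
  have sr : Num.sqrt (mesh R m) <= r.
    by rewrite -(ger0_norm (ltW r0)) -sqrtr_sqr ler_sqrt// exprn_ge0// ltW.
  have h1 : a * Num.sqrt (mesh R m) <= g.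
    apply: (@le_trans _ _ (a * r)); first by rewrite ler_wpM2l.
    rewrite /r mulrCA ler_piMr ?(ltW g0)//.
    by rewrite ler_pdivrMr ?ltr_wpDl// mul1r lerDl.
  have h2 : b * e <= g.
    rewrite /e mulrCA ler_piMr ?(ltW g0)//.
    by rewrite ler_pdivrMr ?ltr_wpDl// mul1r lerDl.
  by lra.
have Hc := heightt_continuous (fun j k => frozen_continuous (U_sol m) (i := j) (k := k)).
have mH : measurable_fun setT (fun t : MR => er * heightt (W m) t).
  apply: measurable_funM => //; exact: continuous_measurable_fun.
apply: le_trans (rect_integral_le (B := fun t => er * heightt (W m) t) _ mH _) _.
- exact: measurable_funB.
- move=> t tT.
  rewrite -[leRHS]integral_torus_cst; apply: ge0_le_integral => //.
  + exact: measurable_torus.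
  + apply/measurable_EFinP/measurable_funTS; apply: measurableT_comp => //.
    apply: measurable_funB; [exact: (measurable_slice t mG) | exact: (measurable_slice t ms)].
  + move=> x Tx; rewrite lee_fin.
    have cyl : (t, x) \in cylinder T.
      by rewrite inE; split => //=; rewrite in_itv.
    rewrite /integrand /patch cyl /=.
    apply: (@weak_error_pointwise R n D A D_ge0 A_ge0 m (@U m) B0 C E (P m) B00 (WP m)
      T phi phit phixx phiT c e) => //.
    * by move=> s y z sT yI yz; apply: d1P => //; exact: le_trans hd1.
    * by move=> s y z sT yI yz; apply: d2P => //; exact: le_trans hd2.
under eq_integral do rewrite EFinM.
rewrite ge0_integralZl//; last 2 first.
- apply/measurable_EFinP/measurable_funTS; exact: continuous_measurable_fun.
- by move=> t _; rewrite lee_fin (le_trans ler01)// heightt_ge1.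
rewrite (integral_heightt (WP m) (lexx 0) T0).
apply: le_trans (_ : (er * (T + E))%:E <= _)%E; last by rewrite lee_fin.
rewrite -EFinM lee_fin ler_wpM2l//.
have -> : P m 0 = 0 by have [_ _ [_ _ -> _] _] := WP m.
by rewrite subr0; exact: (primitive_ub WP m (ltW T0)).
Qed.

(** Three errors of [eta / 3] at one large index: limit against interpolant, interpolant against
    discrete rate, and, through the exact discrete identity, the initial grid sum against its
    integral. *)
Theorem weak_limit i :
  \int[leb2 R]_(z in cylinder T) integrand D A p q (ulim W sigma) i z =
  - \int[mu]_(x in @torus R) (u0 i x * phi 0 x).
Proof.
have mT := @measurable_torus R.
apply/eqP; rewrite -subr_eq0 -normr_le0 opprK; apply/ler_addgt0Pr => eta eta0; rewrite add0r.
have e30 : 0 < eta / 3 by rewrite divr_gt0.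
have [N1 H1] := limit_error i e30; have [N2 H2] := scheme_error i e30.
pose F x := u0 i x * phi 0 x.
have Fc : continuous F.
  move=> x; apply: cvgM; first exact: u0_cont.
  apply: (@continuous_comp _ _ _ (fun x : R => (0 : R, x)) (fun z => phi z.1 z.2)).
    have c1 : (fun _ : R => 0 : R) @ nbhs x --> (0 : R) by exact: cvg_cst.
    have c2 : (fun y : R => y) @ nbhs x --> x by exact: cvg_id.
    exact: (cvg_pair c1 c2).
  exact: (test_cont phiT).
have F2c : continuous (fun z : R * R => F z.2).
  move=> z; apply: (@continuous_comp _ _ _ (fun z : R * R => z.2) F); last exact: Fc.
  by case: z => a b; exact: cvg_snd.
have [_ Funif] := @rectangle_uniform R _ 0 0 1 F2c.
have [d d0 dP] := Funif _ e30; have [N3 N3P] := ex_mesh_le d0.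
pose N := maxn N1 (maxn N2 N3); pose m := sigma N.
have sigma_ge k : (k <= sigma k)%N.
  by elim: k => [//|k IH]; apply: leq_ltn_trans IH _; exact: sigma_homo.
have sN : (N <= m)%N := sigma_ge N.
have [iG G1] := H1 N (leq_maxl _ _).
have N2m : (N2 <= m)%N.
  by apply: leq_trans sN; rewrite leq_max leq_max leqnn orbT.
have N3m : (N3 <= m)%N.
  by apply: leq_trans sN; rewrite leq_max leq_max leqnn !orbT.
have [ms S1] := H2 m N2m.
have iS : (leb2 R).-integrable (cylinder T) (EFin \o
   (fun z : MR * MR => stepf (discrete_rate D A (@U m) phi phit i z.1) z.2)).
  have id : (leb2 R).-integrable (cylinder T) (EFin \o (fun z : MR * MR =>
    integrand D A p q (interp W m) i z - stepf (discrete_rate D A (@U m) phi phit i z.1) z.2)).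
    apply/integrableP; split; last by apply: le_lt_trans S1 _; exact: ltry.
    apply/measurable_EFinP/measurable_funTS; apply: measurable_funB => //.
    by apply: measurable_integrand => // j; exact: (measurable_interp WP).
  have := integrableB mD iG id; apply: eq_integrable => // z _ /=.
  by rewrite -EFinB opprB addrC subrK.
have [c c0 [pc qc]] := test_bound.
have iu := limit_integrable i c0 mp mq (fun z => patch_le z c0 pc) (fun z => patch_le z c0 qc).
have d1 := Rintegral_dist_le mD iu iG G1.
have d2 := Rintegral_dist_le mD iG iS S1.
have d3 : `|\int[mu]_(x in @torus R) F x - mean (fun k : 'I_m.+1 => F (k%:R * mesh R m))| <= eta / 3.
  apply: riemann_sum_dist => // x y x01 yx; apply: (dP 0); rewrite ?lexx//.
  exact: le_trans yx (le_trans (mesh_le R N3m) N3P).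
have Seq : \int[leb2 R]_(z in cylinder T) stepf (discrete_rate D A (@U m) phi phit i z.1) z.2 =
    - mean (fun k : 'I_m.+1 => F (k%:R * mesh R m)).
  rewrite (Rintegral_cylinder ms iS) -(discrete_identity (U_sol m) T0 phiT i).
  by apply: eq_Rintegral => t _; rewrite /Rintegral /= integral_stepf.
rewrite Seq in d2; move: d1 d2 d3; rewrite -/m.
set a := \int[_]_(z in _) _; set b := \int[_]_(z in _) _; set e := \int[_]_(x in _) _.
rewrite !ler_norml => /andP[? ?] /andP[? ?] /andP[? ?].
by apply/andP; split; lra.
Qed.

(** Each side is the space-time integral with one of the two test functions replaced by zero, to
    which Fubini applies separately. *)
Theorem weak_limit_iterated i :
  - (\int[mu]_(x in @torus R) (u0 i x * phi 0 x)) -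
  \int[mu]_(t in [set` `[0, T]]) (\int[mu]_(x in @torus R) (ulim W sigma i (t, x) * phit t x)) =
  \int[mu]_(t in [set` `[0, T]]) (\int[mu]_(x in @torus R)
    (point_flux D A (fun j => ulim W sigma j (t, x)) i * phixx t x)).
Proof.
have [c c0 [pc qc]] := test_bound.
have z0 (z : MR * MR) : `|0 : R| <= c by rewrite normr0.
have m0 : measurable_fun setT (fun _ : MR * MR => 0 : R) by exact: measurable_cst.
have mu_ j := measurable_ulim WP sigma j.
have i1 := limit_integrable i c0 mp m0 (fun z => patch_le z c0 pc) z0.
have i2 := limit_integrable i c0 m0 mq z0 (fun z => patch_le z c0 qc).
have m1 := measurable_integrand D A i mp m0 mu_.
have m2 := measurable_integrand D A i m0 mq mu_.
have cylE (t x : R) : t \in [set` `[0, T]] -> x \in @torus R -> (t, x) \in cylinder T.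
  by rewrite !inE.
have e1 : \int[mu]_(t in [set` `[0, T]])
    (\int[mu]_(x in @torus R) (ulim W sigma i (t, x) * phit t x)) =
    \int[leb2 R]_(z in cylinder T) integrand D A p (fun=> 0) (ulim W sigma) i z.
  rewrite (Rintegral_cylinder m1 i1); apply: eq_Rintegral => t tT.
  apply: eq_Rintegral => x Tx.
  by rewrite /integrand mulr0 addr0 /patch cylE.
have e2 : \int[mu]_(t in [set` `[0, T]]) (\int[mu]_(x in @torus R)
    (point_flux D A (fun j => ulim W sigma j (t, x)) i * phixx t x)) =
    \int[leb2 R]_(z in cylinder T) integrand D A (fun=> 0) q (ulim W sigma) i z.
  rewrite (Rintegral_cylinder m2 i2); apply: eq_Rintegral => t tT.
  apply: eq_Rintegral => x Tx.
  by rewrite /integrand mulr0 add0r /patch cylE.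
rewrite e1 e2; apply/eqP; rewrite subr_eq -weak_limit addrC -RintegralD//.
apply/eqP; apply: eq_Rintegral => z _.
by rewrite /integrand !mulr0 addr0 add0r.
Qed.

End WeakLimit.

(** * Bounded initial data, half-line integrals and the conclusion *)

Lemma periodic_bounded (R : realType) (f : R -> R) : continuous f -> periodic f 1 ->
  exists2 b, 0 <= b & forall x, f x <= b.
Proof.
move=> fc fper; have [b b0 fb] := continuous_bounded01 fc.
have fn (x : R) (k : nat) : f (x + k%:R) = f x.
  by elim: k => [|k IH]; rewrite ?addr0// -natr1 addrA fper.
exists b => // x; apply: le_trans (ler_norm _) _.
pose y := x - (Num.floor x)%:~R.
have -> : f x = f y.
  have -> : x = y + (Num.floor x)%:~R by rewrite subrK.
  case: (Num.floor x) => k; first by rewrite -pmulrn fn.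
  by rewrite NegzE mulrNz -pmulrn -[LHS](fn _ k.+1) subrK.
apply: fb; rewrite /torus/= in_itv/= subr_ge0 ltrBlDr.
by rewrite ge_floor/= addrC -intrD1 floorD1_gt.
Qed.

Lemma Rintegral_halfline (R : realType) (T : R) (F G : R -> R) :
  (forall t, 0 <= t <= T -> F t = G t) -> (forall t, T < t -> F t = 0) ->
  \int[@lebesgue_measure R]_(t in halfline) F t =
  \int[@lebesgue_measure R]_(t in [set` `[0, T]]) G t.
Proof.
move=> FG F0; rewrite Rintegral_mkcond [RHS]Rintegral_mkcond.
apply: eq_Rintegral => t _; rewrite /patch.
case: ifPn => [/set_mem|/negP]; rewrite /halfline/= => t0.
  case: ifPn => [/set_mem|/negP]; first by rewrite /= in_itv/=; exact: FG.
  move=> tT; apply: F0; rewrite ltNge; apply/negP => tT'; apply: tT.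
  by rewrite inE /= in_itv/= t0.
rewrite memNset//= in_itv/= => /andP[t0' _]; apply: t0.
by rewrite inE.
Qed.

Theorem theorem8 (R : realType) (n : nat) (D : 'I_n -> R)
    (A : 'I_n -> 'I_n -> R) (pi_ : 'I_n -> R) (u0 : 'I_n -> R -> R)
    (n_ge2 : (2 <= n)%N)
    (D_ge0 : forall i, 0 <= D i)
    (A_ge0 : forall i j, 0 <= A i j)
    (A_diag : forall i, 0 < A i i)
    (pi_gt0 : forall i, 0 < pi_ i)
    (A_rev : forall i j, pi_ i * A i j = pi_ j * A j i)
    (u0_per : forall i, periodic (u0 i) 1)
    (u0_cont : forall i, continuous (u0 i))
    (u0_gt0 : forall i x, 0 < u0 i x) :
  (forall m : nat, exists u : 'I_n -> R -> 'I_m.+1 -> R,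
     [/\ discrete_solution D A u0 u,
         forall i k, tsmooth (fun t => u i t k),
         forall i t k, 0 <= t -> 0 < u i t k
       & forall v : 'I_n -> R -> 'I_m.+1 -> R, discrete_solution D A u0 v ->
           forall i t k, 0 <= t -> v i t k = u i t k]) /\
  (forall U : (forall m : nat, 'I_n -> R -> 'I_m.+1 -> R),
     (forall m, discrete_solution D A u0 (U m)) ->
     exists sigma : nat -> nat, {homo sigma : a b / (a < b)%N} /\
     exists u : 'I_n -> R -> R -> R,
       [/\ forall i (T eps : R), 0 < T -> 0 < eps -> eps <= 3 ->
             cvg_Lp_cylinder (4 - eps) T
               (fun N t => interpolant (U (sigma N) i t)) (u i),
           forall i (T : R), 0 < T -> Lp_cylinder 4 T (u i) /\ L2H1 T (u i)
         & weak_solution D A u0 u]).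
Proof.
have exists_gt0 m : exists u : 'I_n -> R -> 'I_m.+1 -> R,
    discrete_solution D A u0 u /\ forall i t k, 0 <= t -> 0 < u i t k.
  by have [u [us up]] := discrete_solution_exists m D_ge0 A_ge0 u0_gt0; exists u.
split=> [m|U U_sol].
  have [u [us up]] := exists_gt0 m; exists u; split => //.
  - exact: discrete_solution_tsmooth us.
  - by move=> v vs i t k t0; exact: (discrete_solution_unique D_ge0 A_ge0 us vs).
(* An arbitrary family of solutions inherits positivity from the constructed ones by uniqueness. *)
have U_gt0 m i t k : 0 <= t -> 0 < U m i t k.
  move=> t0; have [u [us up]] := exists_gt0 m.
  by rewrite (discrete_solution_unique D_ge0 A_ge0 us (U_sol m))//; exact: up.
have [B0 B00 u0B] : exists2 B0, 0 <= B0 & forall i x, u0 i x <= B0.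
  have /choice[b bP] : forall i, exists b, 0 <= b /\ forall x, u0 i x <= b.
    by move=> i; have [b b0 bP] := periodic_bounded (@u0_cont i) (@u0_per i); exists b.
  exists (\sum_i b i) => [|i x]; first by apply: sumr_ge0 => i _; exact: (bP i).1.
  apply: le_trans ((bP i).2 x) _; rewrite (bigD1 i)//= lerDl sumr_ge0// => j _.
  exact: (bP j).1.
pose W m := frozen (U m).
pose C := flux_const D A B0; pose E := entropy_bound A pi_ B0.
have C0 : 0 <= C by apply: le_trans ler01 _; exact: flux_const_ge1.
have /choice[P WP] : forall m, exists P, controlled B0 C E (W m) P.
  move=> m; exact: (solution_controlled D_ge0 A_ge0 A_diag pi_gt0 A_rev u0_gt0 u0B (U_sol m) (U_gt0 m)).
have [sigma [sigma_homo sigmaP]] := convergent_subsequence B00 C0 WP.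
exists sigma; split => //; exists (fun i t x => ulim W sigma i (t, x)); split.
- move=> i T eps T0 eps0 eps3; rewrite /cvg_Lp_cylinder.
  have -> : (fun N => ('N[leb2 R]_(4 - eps)%:E [EFin \o uncurried (fun t x =>
      interpolant (U (sigma N) i t) x - ulim W sigma i (t, x))%R \_ (cylinder T)])%E) =
    (fun N => ('N[leb2 R]_(4 - eps)%:E [EFin \o (fun z =>
      interp W (sigma N) i z - ulim W sigma i z)%R \_ (cylinder T)])%E).
    apply/funext => N; congr Lnorm; apply/funext => -[t x] /=; congr EFin.
    rewrite /patch; case: ifPn => // /set_mem[/=]; rewrite in_itv/= => /andP[t0 _] _.
    rewrite /uncurried/= /interp/=; congr (interpolant _ _ - _).
    by apply/funext => k; rewrite /W frozenE.
  apply: (limit_cvg_Lp B00 WP sigmaP i T0); first by lra.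
  by lra.
- move=> i T T0; split; first exact: (limit_L4 B00 WP sigmaP i T0).
  exact: (limit_L2H1 B00 WP sigmaP i T0).
- move=> phi i phiC; have [T T0 phiT] := Cc2_extension phiC.
  have max0 (t : R) : 0 <= t -> Num.max 0 t = t by move=> t0; rewrite max_r.
  have zero (t x : R) : T < t -> dt phi t x = 0 /\ dx (dx phi) t x = 0.
    move=> Tt; have t0 := ltW (lt_trans T0 Tt).
    have := test_dt_supp phiT x (ltW Tt); have := test_dxx_supp phiT x (ltW Tt).
    by rewrite max0.
  have := weak_limit_iterated D_ge0 A_ge0 u0_cont B00 U_sol WP sigma_homo sigmaP T0 phiT i.
  rewrite /= !maxxx => H.
  have int0 (F : R -> R) : (forall x, F x = 0) ->
      \int[@lebesgue_measure R]_(x in @torus R) F x = 0.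
    move=> F0; rewrite /Rintegral (eq_integral (cst 0%E)) ?integral0// => x _.
    by rewrite F0.
  have e1 : \int[@lebesgue_measure R]_(t in halfline) (\int[@lebesgue_measure R]_(x in @torus R)
        (ulim W sigma i (t, x) * dt phi t x)) =
      \int[@lebesgue_measure R]_(t in [set` `[0, T]]) (\int[@lebesgue_measure R]_(x in @torus R)
        (ulim W sigma i (t, x) * dt phi (Num.max 0 t) x)).
    apply: Rintegral_halfline => t; first by move=> /andP[t0 _]; rewrite max0.
    by move=> Tt; apply: int0 => x; rewrite (zero t x Tt).1 mulr0.
  have e2 : \int[@lebesgue_measure R]_(t in halfline) (\int[@lebesgue_measure R]_(x in @torus R)
        ((D i * ulim W sigma i (t, x) +
          \sum_(j < n) A i j * ulim W sigma i (t, x) * ulim W sigma j (t, x)) * dx (dx phi) t x)) =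
      \int[@lebesgue_measure R]_(t in [set` `[0, T]]) (\int[@lebesgue_measure R]_(x in @torus R)
        (point_flux D A (fun j => ulim W sigma j (t, x)) i * dx (dx phi) (Num.max 0 t) x)).
    apply: Rintegral_halfline => t; last first.
      by move=> Tt; apply: int0 => x; rewrite (zero t x Tt).2 mulr0.
    move=> /andP[t0 _].
    rewrite (max0 _ t0).
    apply: eq_Rintegral => x _.
    apply: (congr1 (fun y => y * _)).
    rewrite /point_flux mulr_sumr.
    apply: (congr1 (fun y => _ + y)).
    apply: eq_bigr => j _.
    ring.
  refine (eq_trans _ (esym e2)).
  refine (eq_trans _ H).
  exact (congr1 (fun y => - _ - y) e1).
Qed.
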